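(* Let $A$ be a $\sigma$-unital $C^*$-algebra, let $G$ be a second-countable compact group, and let $\alpha\colon G\to\mathrm{Aut}(A)$ be an action with the Rokhlin property. (1) If $I$ is an ideal in $A^\alpha$, then there exists an $\alpha$-invariant ideal $J$ in $A$ such that $I=J\cap A^\alpha$. (2) If $I$ is an ideal in $A\rtimes_\alpha G$, then there exists an $\alpha$-invariant ideal $J$ in $A$ such that $I=J\rtimes_\alpha G$.
   Context: Conventions: homomorphisms between $C^*$-algebras are $*$-homomorphisms, ideals are closed and two-sided, subalgebras are $C^*$-subalgebras; actions on $C^*$-algebras are point-norm continuous; $A^\alpha$ is the fixed point algebra and $A\rtimes_\alpha G$ the crossed product; for an $\alpha$-invariant ideal $J$ of $A$, $J\rtimes_\alpha G$ is regarded as an ideal of $A\rtimes_\alpha G$. Sequence algebras: for a $C^*$-algebra $A$, let $\ell^\infty(\mathbb{N},A)$ be the $C^*$-algebra of bounded sequences in $A$, $c_0(\mathbb{N},A)$ the ideal of norm-null sequences, $A_\infty=\ell^\infty(\mathbb{N},A)/c_0(\mathbb{N},A)$ with quotient map $\eta_A$; $A$ sits in $A_\infty$ as constant sequences. For a subalgebra $D\subseteq A$, let $\mathrm{Ann}(D,A_\infty)$ be the annihilator of $D$ in $A_\infty$, an ideal of $A_\infty\cap D'$, let $F(D,A)=(A_\infty\cap D')/\mathrm{Ann}(D,A_\infty)$ and let $\kappa_{D,A}$ be the quotient map. If $\alpha\colon G\to\mathrm{Aut}(A)$ is an action and $D$ is $\alpha$-invariant, entrywise application of $\alpha$ gives actions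 (not necessarily continuous) $\alpha^\infty$ on $\ell^\infty(\mathbb{N},A)$, $\alpha_\infty$ on $A_\infty$ and on $A_\infty\cap D'$, and $F(\alpha)$ on $F(D,A)$. Let $\ell^\infty_\alpha(\mathbb{N},A)$ be the set of $a\in\ell^\infty(\mathbb{N},A)$ with $g\mapsto\alpha^\infty_g(a)$ norm continuous, $A_{\infty,\alpha}=\eta_A(\ell^\infty_\alpha(\mathbb{N},A))$ and $F_\alpha(D,A)=\kappa_{D,A}(A_{\infty,\alpha}\cap D')$. Rokhlin property: an action $\alpha\colon G\to\mathrm{Aut}(A)$ of a second-countable compact group $G$ on a $\sigma$-unital $C^*$-algebra $A$ has the Rokhlin property if for every separable $\alpha$-invariant subalgebra $D\subseteq A$ there is an equivariant unital homomorphism $\varphi\colon(C(G),\mathtt{Lt})\to(F_\alpha(D,A),F(\alpha))$, where $\mathtt{Lt}$ is the action of $G$ on $C(G)$ induced by left translation. *)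

(* Defs.v *)
From HB Require Import structures.
From mathcomp Require Import all_boot all_order all_algebra.
From mathcomp Require Import ring_quotient complex.
From mathcomp Require Import all_classical all_reals all_analysis.

Set Implicit Arguments.
Unset Strict Implicit.
Unset Printing Implicit Defensive.

Import Order.TTheory GRing.Theory Num.Theory numFieldNormedType.Exports.

Local Open Scope classical_set_scope.
Local Open Scope ring_scope.
Local Open Scope quotient_scope.

Reserved Notation "x ** y" (at level 40, left associativity).

(* Complex associative *-algebras, not necessarily unital: MathComp's rings
   all have a unit, so the product is an operation of its own on an lmodType. *)
HB.mixin Record isStarAlgebra (R : realType) A of GRing.Lmodule R[i] A := {
  amul : A -> A -> A;
  star : A -> A;
  amulA : associative amul;
  amulDl : left_distributive amul +%R;
  amulDr : right_distributive amul +%R;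
  amulZl : forall (c : R[i]) x y, amul (c *: x) y = c *: amul x y;
  amulZr : forall (c : R[i]) x y, amul x (c *: y) = c *: amul x y;
  starK : involutive star;
  starD : {morph star : x y / x + y};
  starZ : forall (c : R[i]) x, star (c *: x) = c^* *: star x;
  starM : forall x y, star (amul x y) = amul (star y) (star x)
}.

#[short(type="starAlgType")]
HB.structure Definition StarAlgebra (R : realType) :=
  {A of GRing.Lmodule R[i] A & isStarAlgebra R A}.

Notation "x ** y" := (amul x y) : ring_scope.

HB.mixin Record isCStar (R : realType) A
    of CompleteNormedModule R[i] A & isStarAlgebra R A := {
  normM : forall x y : A, `|x ** y| <= `|x| * `|y|;
  normCstar : forall x : A, `|star x ** x| = `|x| ^+ 2
}.

#[short(type="cstarAlgType")]
HB.structure Definition CStarAlgebra (R : realType) :=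
  {A of CompleteNormedModule R[i] A & isStarAlgebra R A & isCStar R A}.

Section StarAlgebraTheory.
Context {R : realType} {B : starAlgType R}.
Implicit Types x y : B.

Lemma amul0l x : 0 ** x = 0.
Proof. by rewrite -(scale0r x) amulZl !scale0r. Qed.

Lemma amul0r x : x ** 0 = 0.
Proof. by rewrite -(scale0r x) amulZr !scale0r. Qed.

Lemma amulNl x y : (- x) ** y = - (x ** y).
Proof. by rewrite -scaleN1r amulZl scaleN1r. Qed.

Lemma amulNr x y : x ** (- y) = - (x ** y).
Proof. by rewrite -scaleN1r amulZr scaleN1r. Qed.

Lemma star0 : star (0 : B) = 0.
Proof. by rewrite -(scale0r (0 : B)) starZ conjC0 !scale0r. Qed.

Lemma starN x : star (- x) = - star x.
Proof. by rewrite -scaleN1r starZ rmorphN1 scaleN1r. Qed.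

End StarAlgebraTheory.

Section FunctionStarAlgebra.
Context (R : realType) (T : Type) (B : starAlgType R).
Implicit Types f g h : T -> B.

Let fmul f g : T -> B := fun t => f t ** g t.
Let fstar f : T -> B := fun t => star (f t).

Let fmulA : associative fmul.
Proof. by move=> f g h; apply/funext => t; exact: amulA. Qed.
Let fmulDl : left_distributive fmul +%R.
Proof. by move=> f g h; apply/funext => t; exact: amulDl. Qed.
Let fmulDr : right_distributive fmul +%R.
Proof. by move=> f g h; apply/funext => t; exact: amulDr. Qed.
Let fmulZl (c : R[i]) f g : fmul (c *: f) g = c *: fmul f g.
Proof. by apply/funext => t; exact: amulZl. Qed.
Let fmulZr (c : R[i]) f g : fmul f (c *: g) = c *: fmul f g.
Proof. by apply/funext => t; exact: amulZr. Qed.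
Let fstarK : involutive fstar.
Proof. by move=> f; apply/funext => t; exact: starK. Qed.
Let fstarD : {morph fstar : f g / f + g}.
Proof. by move=> f g; apply/funext => t; exact: starD. Qed.
Let fstarZ (c : R[i]) f : fstar (c *: f) = c^* *: fstar f.
Proof. by apply/funext => t; exact: starZ. Qed.
Let fstarM f g : fstar (fmul f g) = fmul (fstar g) (fstar f).
Proof. by apply/funext => t; exact: starM. Qed.

HB.instance Definition _ := isStarAlgebra.Build R (T -> B)
  fmulA fmulDl fmulDr fmulZl fmulZr fstarK fstarD fstarZ fstarM.

End FunctionStarAlgebra.

Section ScalarStarAlgebra.
Context (R : realType).
Implicit Types x y : R[i]^o.

Let cmul x y : R[i]^o := x * y.
Let cstar x : R[i]^o := (x : R[i])^*.

Let cmulA : associative cmul. Proof. exact: mulrA. Qed.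
Let cmulDl : left_distributive cmul +%R. Proof. exact: mulrDl. Qed.
Let cmulDr : right_distributive cmul +%R. Proof. exact: mulrDr. Qed.
Let cmulZl (c : R[i]) x y : cmul (c *: x) y = c *: cmul x y.
Proof. by rewrite /cmul /GRing.scale /= mulrA. Qed.
Let cmulZr (c : R[i]) x y : cmul x (c *: y) = c *: cmul x y.
Proof. by rewrite /cmul /GRing.scale /= mulrCA. Qed.
Let cstarK : involutive cstar. Proof. exact: conjCK. Qed.
Let cstarD : {morph cstar : x y / x + y}.
Proof. by move=> x y; exact: rmorphD. Qed.
Let cstarZ (c : R[i]) x : cstar (c *: x) = c^* *: cstar x.
Proof. exact: rmorphM. Qed.
Let cstarM x y : cstar (cmul x y) = cmul (cstar y) (cstar x).
Proof. by rewrite /cmul mulrC; exact: rmorphM. Qed.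

HB.instance Definition _ := isStarAlgebra.Build R (R[i]^o)
  cmulA cmulDl cmulDr cmulZl cmulZr cstarK cstarD cstarZ cstarM.

End ScalarStarAlgebra.

Record starSubalg (R : realType) (B : starAlgType R) := StarSubalg {
  ssa_set :> set B;
  ssa0 : ssa_set 0;
  ssaP : forall (c : R[i]) x y, ssa_set x -> ssa_set y -> ssa_set (c *: x + y);
  ssaM : forall x y, ssa_set x -> ssa_set y -> ssa_set (x ** y);
  ssaS : forall x, ssa_set x -> ssa_set (star x)
}.

Definition ssa_pred (R : realType) (B : starAlgType R) (S : starSubalg B) :
  {pred B} := fun x => `[< ssa_set S x >].

Section SubalgebraStarAlgebra.
Context (R : realType) (B : starAlgType R) (S : starSubalg B).

Let ssa_submod : GRing.submod_closed (ssa_pred S).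
Proof.
split=> [|c x y /asboolP Sx /asboolP Sy]; apply/asboolP; first exact: ssa0.
exact: ssaP.
Qed.
HB.instance Definition _ := GRing.isSubmodClosed.Build R[i] B (ssa_pred S)
  ssa_submod.

Definition subalg_type := {x : B | ssa_pred S x}.
HB.instance Definition _ := SubChoice.on subalg_type.
HB.instance Definition _ := [SubChoice_isSubLmodule of subalg_type by <:].

Implicit Types x y z : subalg_type.

Lemma subalgP x : ssa_set S (val x).
Proof. exact/asboolP/(valP x). Qed.

Definition to_subalg (x : B) (Sx : ssa_set S x) : subalg_type := exist _ x (asboolT Sx).

Let smul x y := to_subalg (ssaM (subalgP x) (subalgP y)).
Let sstar x := to_subalg (ssaS (subalgP x)).

Let smulA : associative smul.
Proof. by move=> x y z; apply/val_inj; exact: amulA. Qed.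
Let smulDl : left_distributive smul +%R.
Proof. by move=> x y z; apply/val_inj; exact: amulDl. Qed.
Let smulDr : right_distributive smul +%R.
Proof. by move=> x y z; apply/val_inj; exact: amulDr. Qed.
Let smulZl (c : R[i]) x y : smul (c *: x) y = c *: smul x y.
Proof. by apply/val_inj; exact: amulZl. Qed.
Let smulZr (c : R[i]) x y : smul x (c *: y) = c *: smul x y.
Proof. by apply/val_inj; exact: amulZr. Qed.
Let sstarK : involutive sstar.
Proof. by move=> x; apply/val_inj; exact: starK. Qed.
Let sstarD : {morph sstar : x y / x + y}.
Proof. by move=> x y; apply/val_inj; exact: starD. Qed.
Let sstarZ (c : R[i]) x : sstar (c *: x) = c^* *: sstar x.
Proof. by apply/val_inj; exact: starZ. Qed.
Let sstarM x y : sstar (smul x y) = smul (sstar y) (sstar x).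
Proof. by apply/val_inj; exact: starM. Qed.

HB.instance Definition _ := isStarAlgebra.Build R subalg_type
  smulA smulDl smulDr smulZl smulZr sstarK sstarD sstarZ sstarM.

End SubalgebraStarAlgebra.

Record starIdeal (R : realType) (B : starAlgType R) := StarIdeal {
  si_set :> set B;
  si0 : si_set 0;
  siP : forall (c : R[i]) x y, si_set x -> si_set y -> si_set (c *: x + y);
  siMl : forall x y, si_set y -> si_set (x ** y);
  siMr : forall x y, si_set x -> si_set (x ** y);
  siS : forall x, si_set x -> si_set (star x)
}.

Definition si_pred (R : realType) (B : starAlgType R) (I : starIdeal B) :
  {pred B} := fun x => `[< si_set I x >].

Section QuotientStarAlgebra.
Context (R : realType) (B : starAlgType R) (I : starIdeal B).

Let si_submod : GRing.submod_closed (si_pred I).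
Proof.
split=> [|c x y /asboolP Sx /asboolP Sy]; apply/asboolP; first exact: si0.
exact: siP.
Qed.
HB.instance Definition _ := GRing.isSubmodClosed.Build R[i] B (si_pred I)
  si_submod.

Definition starquot := Quotient.quot (si_pred I).
HB.instance Definition _ := GRing.Zmodule.on starquot.
HB.instance Definition _ := EqQuotient.on starquot.

Definition qpi (x : B) : starquot := \pi_starquot x.

Implicit Types x y z : starquot.

Lemma qpiE (a b : B) : (qpi a = qpi b) <-> si_set I (a - b).
Proof.
split=> [/eqP|Iab].
  by rewrite /qpi -Quotient.idealrBE => /asboolP.
by apply/eqP; rewrite /qpi -Quotient.idealrBE; apply/asboolP.
Qed.

Lemma qpiD a b : qpi (a + b) = qpi a + qpi b.
Proof. by rewrite /qpi; exact: Quotient.pi_add. Qed.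

Lemma qpi_repr a : si_set I (repr (qpi a) - a).
Proof. by apply/qpiE; rewrite /qpi reprK. Qed.

Lemma qpiW (P : starquot -> Prop) : (forall a, P (qpi a)) -> forall x, P x.
Proof. by move=> Pq x; rewrite -[x]reprK; exact: Pq. Qed.

Let qscale (c : R[i]) x := qpi (c *: repr x).
Let qmul x y := qpi (repr x ** repr y).
Let qstar x := qpi (star (repr x)).

Let siZ (c : R[i]) (a : B) : si_set I a -> si_set I (c *: a).
Proof. by move=> Ia; rewrite -[c *: a]addr0; apply: siP => //; exact: si0. Qed.
Let siD (a b : B) : si_set I a -> si_set I b -> si_set I (a + b).
Proof. by move=> Ia Ib; rewrite -[a]scale1r; exact: siP. Qed.

Let qscaleE c a : qscale c (qpi a) = qpi (c *: a).
Proof. by apply/qpiE; rewrite -scalerBr; exact/siZ/qpi_repr. Qed.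
Let qmulE a b : qmul (qpi a) (qpi b) = qpi (a ** b).
Proof.
apply/qpiE.
have -> : repr (qpi a) ** repr (qpi b) - a ** b =
    (repr (qpi a) - a) ** repr (qpi b) + a ** (repr (qpi b) - b).
  by rewrite amulDl amulDr amulNl amulNr addrA subrK.
by apply: siD; [apply: siMr | apply: siMl]; exact: qpi_repr.
Qed.
Let qstarE a : qstar (qpi a) = qpi (star a).
Proof. by apply/qpiE; rewrite -starN -starD; exact/siS/qpi_repr. Qed.

Let qscaleA (c d : R[i]) x : qscale c (qscale d x) = qscale (c * d) x.
Proof. by elim/qpiW: x => a; rewrite !qscaleE scalerA. Qed.
Let qscale1 : left_id 1 qscale.
Proof. by elim/qpiW => a; rewrite qscaleE scale1r. Qed.
Let qscaleDr : right_distributive qscale +%R.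
Proof.
move=> c; elim/qpiW => a; elim/qpiW => b.
by rewrite -qpiD !qscaleE scalerDr qpiD.
Qed.
Let qscaleDl x : {morph qscale^~ x : c d / c + d}.
Proof. by elim/qpiW: x => a c d; rewrite !qscaleE scalerDl qpiD. Qed.

HB.instance Definition _ := GRing.Zmodule_isLmodule.Build R[i] starquot
  qscaleA qscale1 qscaleDr qscaleDl.

Lemma qpiZ (c : R[i]) a : qpi (c *: a) = c *: qpi a.
Proof. by rewrite -qscaleE. Qed.

Let qmulA : associative qmul.
Proof.
elim/qpiW => a; elim/qpiW => b; elim/qpiW => c.
by rewrite !qmulE amulA.
Qed.
Let qmulDl : left_distributive qmul +%R.
Proof.
elim/qpiW => a; elim/qpiW => b; elim/qpiW => c.
by rewrite -qpiD !qmulE amulDl qpiD.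
Qed.
Let qmulDr : right_distributive qmul +%R.
Proof.
elim/qpiW => a; elim/qpiW => b; elim/qpiW => c.
by rewrite -qpiD !qmulE amulDr qpiD.
Qed.
Let qmulZl (c : R[i]) x y : qmul (c *: x) y = c *: qmul x y.
Proof.
elim/qpiW: x => a; elim/qpiW: y => b.
by rewrite -qpiZ !qmulE amulZl qpiZ.
Qed.
Let qmulZr (c : R[i]) x y : qmul x (c *: y) = c *: qmul x y.
Proof.
elim/qpiW: x => a; elim/qpiW: y => b.
by rewrite -qpiZ !qmulE amulZr qpiZ.
Qed.
Let qstarK : involutive qstar.
Proof. by elim/qpiW => a; rewrite !qstarE starK. Qed.
Let qstarD : {morph qstar : x y / x + y}.
Proof.
by elim/qpiW => a; elim/qpiW => b; rewrite -qpiD !qstarE starD qpiD.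
Qed.
Let qstarZ (c : R[i]) x : qstar (c *: x) = c^* *: qstar x.
Proof. by elim/qpiW: x => a; rewrite -qpiZ !qstarE starZ qpiZ. Qed.
Let qstarM x y : qstar (qmul x y) = qmul (qstar y) (qstar x).
Proof.
by elim/qpiW: x => a; elim/qpiW: y => b; rewrite qmulE !qstarE qmulE starM.
Qed.

HB.instance Definition _ := isStarAlgebra.Build R starquot
  qmulA qmulDl qmulDr qmulZl qmulZr qstarK qstarD qstarZ qstarM.

Lemma qpiM a b : qpi (a ** b) = qpi a ** qpi b.
Proof. exact/esym/qmulE. Qed.

Lemma qpi_star a : qpi (star a) = star (qpi a).
Proof. exact/esym/qstarE. Qed.

End QuotientStarAlgebra.

Section CStarTheory.
Context {R : realType} {A : cstarAlgType R}.
Implicit Types x y : A.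

Lemma norm_star x : `|star x| = `|x|.
Proof.
have le_star y : `|y| <= `|star y|.
  have [->|y0] := eqVneq y 0; first by rewrite normr0.
  have : `|y| ^+ 2 <= `|star y| * `|y| by rewrite -normCstar normM.
  by rewrite expr2 ler_pM2r // normr_gt0.
by apply/eqP; rewrite eq_le le_star andbT -{2}(starK x) le_star.
Qed.

End CStarTheory.

(* linf A is l^oo(N, A), Ainf A is A_oo, commutant D is A_oo \cap D',
   ann_ideal D is Ann(D, A_oo) and Fcentral D is F(D, A). Only their algebraic
   structure is needed: no norm is put on the quotients. *)
Section SequenceAlgebras.
Context {R : realType} (A : cstarAlgType R).

Let linf_set : set (nat -> A) :=
  [set a | exists M : R[i], forall n, `|a n| <= M].

Let linf0 : linf_set 0.
Proof. by exists 0 => n; rewrite normr0. Qed.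
Let linfP (c : R[i]) a b : linf_set a -> linf_set b -> linf_set (c *: a + b).
Proof.
move=> [M aM] [N bN]; exists (`|c| * M + N) => n.
rewrite (le_trans (ler_normD _ _)) // lerD // normrZ.
by rewrite ler_wpM2l.
Qed.
Let linfM a b : linf_set a -> linf_set b -> linf_set (a ** b).
Proof.
move=> [M aM] [N bN]; exists (M * N) => n.
by rewrite (le_trans (normM _ _)) // ler_pM.
Qed.
Let linfS a : linf_set a -> linf_set (star a).
Proof. by move=> [M aM]; exists M => n; rewrite norm_star. Qed.

Definition linf_subalg : starSubalg (nat -> A) :=
  StarSubalg linf0 linfP linfM linfS.

Definition linf := subalg_type linf_subalg.

Let c0_set : set linf := [set a | val a n @[n --> \oo] --> (0 : A)].

Let cvg0_dom (u v : nat -> A) (M : R[i]) : (forall n, `|v n| <= M * `|u n|) ->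
  u n @[n --> \oo] --> (0 : A) -> v n @[n --> \oo] --> (0 : A).
Proof.
move=> uv /cvgr0Pnorm_lt u0; apply/cvgr0Pnorm_lt => e e0.
have K0 : 0 < `|M| + 1 by rewrite ltr_wpDl.
have MK n : `|v n| <= (`|M| + 1) * `|u n|.
  have vM : 0 <= M * `|u n| by apply: le_trans (uv n).
  rewrite (le_trans (uv n)) // -(ger0_norm vM) normrM normr_id.
  by rewrite ler_wpM2r // lerDl.
near=> n; apply: le_lt_trans (MK n) _; rewrite mulrC -ltr_pdivlMr //.
near: n; apply: u0; exact: divr_gt0.
Unshelve. all: by end_near. Qed.

Let c00 : c0_set 0.
Proof. exact: (@cvg_cst A). Qed.
Let c0P (c : R[i]) a b : c0_set a -> c0_set b -> c0_set (c *: a + b).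
Proof.
move=> a0 b0; have := cvgD (cvgZl_tmp (k := c) a0) b0.
by rewrite scaler0 addr0; exact.
Qed.
Let c0Ml a b : c0_set b -> c0_set (a ** b).
Proof.
have [M aM] := subalgP a; apply: (@cvg0_dom _ _ M) => n.
by rewrite (le_trans (normM _ _)) // ler_wpM2r.
Qed.
Let c0Mr a b : c0_set a -> c0_set (a ** b).
Proof.
have [M bM] := subalgP b; apply: (@cvg0_dom _ _ M) => n.
by rewrite (le_trans (normM _ _)) // mulrC ler_wpM2r.
Qed.
Let c0S a : c0_set a -> c0_set (star a).
Proof.
by apply: (@cvg0_dom _ _ 1) => n; rewrite mul1r norm_star.
Qed.

Definition c0_ideal : starIdeal linf := StarIdeal c00 c0P c0Ml c0Mr c0S.

Definition Ainf := starquot c0_ideal.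
Definition eta (a : linf) : Ainf := qpi c0_ideal a.

Lemma const_bounded (a : A) : ssa_set linf_subalg (fun=> a).
Proof. by exists `|a|. Qed.

Definition Ainf_const (a : A) : Ainf := eta (to_subalg (const_bounded a)).

Lemma Ainf_const_star (a : A) : Ainf_const (star a) = star (Ainf_const a).
Proof. by rewrite -qpi_star; congr qpi; apply/val_inj. Qed.

Section CentralSequences.
Variable D : starSubalg A.

Let comm_set : set Ainf :=
  [set x | forall d, ssa_set D d -> x ** Ainf_const d = Ainf_const d ** x].

Let comm0 : comm_set 0.
Proof. by move=> d _; rewrite amul0l amul0r. Qed.
Let commP (c : R[i]) x y : comm_set x -> comm_set y -> comm_set (c *: x + y).
Proof.
by move=> xD yD d Dd; rewrite amulDl amulDr amulZl amulZr xD ?yD.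
Qed.
Let commM x y : comm_set x -> comm_set y -> comm_set (x ** y).
Proof. by move=> xD yD d Dd; rewrite -amulA yD // amulA xD // amulA. Qed.
Let commS x : comm_set x -> comm_set (star x).
Proof.
move=> xD d Dd; rewrite -(starK d) Ainf_const_star -!starM xD //.
exact: ssaS.
Qed.

Definition commutant_subalg : starSubalg Ainf :=
  StarSubalg comm0 commP commM commS.

Definition commutant := subalg_type commutant_subalg.

Let ann_set : set commutant :=
  [set x | forall d, ssa_set D d ->
     val x ** Ainf_const d = 0 /\ Ainf_const d ** val x = 0].

Let ann0 : ann_set 0.
Proof. by move=> d _; rewrite raddf0 amul0l amul0r. Qed.
Let annP (c : R[i]) x y : ann_set x -> ann_set y -> ann_set (c *: x + y).
Proof.
move=> xD yD d Dd; have [x1 x2] := xD d Dd; have [y1 y2] := yD d Dd.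
have -> : val (c *: x + y) = c *: val x + val y by [].
by rewrite amulDl amulDr amulZl amulZr x1 x2 y1 y2 scaler0 addr0.
Qed.
Let annMl x y : ann_set y -> ann_set (x ** y).
Proof.
move=> yD d Dd; have [y1 y2] := yD d Dd; rewrite /=; split.
  by rewrite -amulA y1 amul0r.
by rewrite amulA -(subalgP x) // -amulA y2 amul0r.
Qed.
Let annMr x y : ann_set x -> ann_set (x ** y).
Proof.
move=> xD d Dd; have [x1 x2] := xD d Dd; rewrite /=; split.
  by rewrite -amulA (subalgP y) // amulA x1 amul0l.
by rewrite amulA x2 amul0l.
Qed.
Let annS x : ann_set x -> ann_set (star x).
Proof.
move=> xD d Dd; have [x1 x2] := xD (star d) (ssaS Dd).
by rewrite /= -(starK d) Ainf_const_star -!starM x1 x2 star0.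
Qed.

Definition ann_ideal : starIdeal commutant :=
  StarIdeal ann0 annP annMl annMr annS.

Definition Fcentral := starquot ann_ideal.
Definition kappa (x : commutant) : Fcentral := qpi ann_ideal x.

End CentralSequences.
End SequenceAlgebras.

(* phi is only constrained on the subalgebra S of B. *)
Definition star_hom_on (R : realType) (B E : starAlgType R) (S : set B)
    (phi : B -> E) :=
  [/\ forall (c : R[i]) x y, S x -> S y -> phi (c *: x + y) = c *: phi x + phi y,
      forall x y, S x -> S y -> phi (x ** y) = phi x ** phi y
    & forall x, S x -> phi (star x) = star (phi x)].

Definition star_hom (R : realType) (B E : starAlgType R) (phi : B -> E) :=
  star_hom_on [set: B] phi.

(* Closed two-sided ideals of the C*-subalgebra S of A. *)
Definition cstar_ideal_of (R : realType) (A : cstarAlgType R) (S I : set A) :=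
  [/\ I `<=` S /\ I 0,
      forall (c : R[i]) x y, I x -> I y -> I (c *: x + y),
      forall s x, S s -> I x -> I (s ** x) /\ I (x ** s)
    & closed I].

Definition cstar_ideal (R : realType) (A : cstarAlgType R) (I : set A) :=
  cstar_ideal_of [set: A] I.

Definition cstar_positive (R : realType) (A : cstarAlgType R) (x : A) :=
  exists y : A, x = star y ** y.

Definition sigma_unital (R : realType) (A : cstarAlgType R) :=
  exists e : nat -> A,
    [/\ forall n, cstar_positive (e n) /\ `|e n| <= 1,
        forall n, cstar_positive (e n.+1 - e n),
        forall a, e n ** a @[n --> \oo] --> a
      & forall a, a ** e n @[n --> \oo] --> a].

Definition separable_set (T : topologicalType) (D : set T) :=
  exists S : set T, [/\ countable S, S `<=` D & D `<=` closure S].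

HB.mixin Record isTopologicalGroup G of Group G & PointedTopological G := {
  mulg_continuous : continuous (fun x : G * G => (x.1 * x.2)%g);
  invg_continuous : continuous (fun x : G => x^-1%g)
}.

(* The point carries no meaning: measurableType requires one. *)
#[short(type="topGroupType")]
HB.structure Definition TopologicalGroup :=
  {G of Group G & PointedTopological G & isTopologicalGroup G}.

Definition second_countable_compact (G : topGroupType) :=
  [/\ hausdorff_space G, compact [set: G] & @second_countable G].

Section Actions.
Context (R : realType) (G : topGroupType) (A : cstarAlgType R).

Record cstar_action := CStarAction {
  act :> G -> A -> A;
  act_hom : forall g, star_hom (act g);
  act1 : forall a, act 1%g a = a;
  actM : forall g h a, act (g * h)%g a = act g (act h a);
  act_continuous : forall a, continuous (act ^~ a)
}.

Variable alpha : cstar_action.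

Definition invariant_set (S : set A) := forall g a, S a -> S (alpha g a).

Definition fixed_points : set A := [set a | forall g, alpha g a = a].

Definition linf_alpha : set (linf A) :=
  [set a | forall g0 (e : R), 0 < e ->
    \forall g \near g0, forall n,
      `|alpha g (val a n) - alpha g0 (val a n)| <= (e%:C)%C].

Definition Ainf_alpha : set (Ainf A) := [set eta a | a in linf_alpha].

(* The graph of the entrywise action on A_oo. Defining it as a function would
   need automatic continuity of *-automorphisms to know that bounded and null
   sequences are preserved; the same holds for F_act below. *)
Definition Ainf_act (g : G) (x y : Ainf A) :=
  exists a b : linf A,
    [/\ x = eta a, y = eta b & forall n, val b n = alpha g (val a n)].

Variable D : starSubalg A.

Definition F_act (g : G) (x y : Fcentral D) :=
  exists a b : commutant D,
    [/\ x = kappa a, y = kappa b & Ainf_act g (val a) (val b)].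

Definition F_alpha : set (Fcentral D) :=
  [set kappa a | a in [set a : commutant D | Ainf_alpha (val a)]].

End Actions.

Section Rokhlin.
Context (R : realType) (G : topGroupType).

Definition CG : set (G -> R[i]^o) := [set f | continuous f].

Definition left_translation (g : G) (f : G -> R[i]^o) : G -> R[i]^o :=
  fun h => f (g^-1 * h)%g.

Definition Rokhlin_property (A : cstarAlgType R) (alpha : cstar_action G A) :=
  forall D : starSubalg A,
    closed (ssa_set D) -> separable_set (ssa_set D) ->
    invariant_set alpha (ssa_set D) ->
  exists phi : (G -> R[i]^o) -> Fcentral D,
    [/\ star_hom_on CG phi,
        forall f, CG f -> F_alpha alpha (phi f),
        forall x, F_alpha alpha x ->
          phi (cst 1) ** x = x /\ x ** phi (cst 1) = x
      & forall g f, CG f -> F_act alpha g (phi f) (phi (left_translation g f))].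

End Rokhlin.

Definition borel (T : ptopologicalType) := g_sigma_algebraType (@open T).

Section CrossedProduct.
Context (R : realType) (G : topGroupType).

Definition normalized_haar (mu : probability (borel G) R) :=
  forall (g : G) (B : set (borel G)), measurable B ->
    mu [set (g * x)%g | x in (B : set G)] = mu B.

Variable mu : probability (borel G) R.

Definition cintegral (f : G -> R[i]) : R[i] :=
  Complex (Rintegral mu [set: borel G] (fun x => complex.Re (f x)))
          (Rintegral mu [set: borel G] (fun x => complex.Im (f x))).

Context (A : cstarAlgType R).

(* The weak (Pettis) integral: the integral of a continuous A-valued function is the vector on which each
   bounded linear functional takes the integral of its values. *)
Definition is_vintegral (f : G -> A) (v : A) :=
  forall phi : {linear A -> R[i]^o}, continuous phi ->
    (phi v : R[i]) = cintegral (fun x => phi (f x)).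

(* Continuous functions on a compact group always have an integral, so the
   default 0 is not used on them. *)
Definition vintegral (f : G -> A) : A := xget 0 [set v | is_vintegral f v].

Definition L1norm (f : G -> A) : R[i] := cintegral (fun x => `|f x|).

Variable alpha : cstar_action G A.

Definition CGA : set (G -> A) := [set f | continuous f].

Definition convolution (f h : G -> A) : G -> A :=
  fun s => vintegral (fun r => f r ** alpha r (h (r^-1 * s)%g)).

(* A compact group is unimodular, so no modular function occurs. *)
Definition convolution_star (f : G -> A) : G -> A :=
  fun s => alpha s (star (f s^-1%g)).

Definition L1_rep (E : cstarAlgType R) (pi : (G -> A) -> E) :=
  [/\ forall (c : R[i]) f h, CGA f -> CGA h ->
        pi (c *: f + h) = c *: pi f + pi h,
      forall f h, CGA f -> CGA h -> pi (convolution f h) = pi f ** pi h,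
      forall f, CGA f -> pi (convolution_star f) = star (pi f)
    & forall f, CGA f -> `|pi f| <= L1norm f].

(* (B, iota) is the enveloping C*-algebra of the Banach *-algebra
   L^1(G, A, alpha), in which C(G, A) is dense. *)
Definition is_crossed_product (B : cstarAlgType R) (iota : (G -> A) -> B) :=
  [/\ L1_rep iota,
      closure [set iota f | f in CGA] = [set: B]
    & forall (E : cstarAlgType R) (pi : (G -> A) -> E), L1_rep pi ->
        exists2 psi : B -> E, star_hom psi &
          forall f, CGA f -> psi (iota f) = pi f].

(* J x| G inside A x| G, for an invariant ideal J: the closure of C(G, J). *)
Definition crossed_ideal (B : cstarAlgType R) (iota : (G -> A) -> B)
    (J : set A) : set B :=
  closure [set iota f | f in [set f | CGA f /\ forall s, J (f s)]].

End CrossedProduct.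

(* Main.v *)
(* Let f |-> X f be sequences representing the Rokhlin homomorphism on a separable
   invariant subalgebra D. The central estimate is that sum_i X (f_i) d_i is
   asymptotically bounded by twice the supremum over t of |sum_i f_i(t) d_i|. It is
   first shown for partitions of unity, where a high power is expanded over words and
   the words are grouped by their letter counts: each group carries a nonnegative
   function bounded by the inverse of its number of words, and there are only
   polynomially many groups. Applied to a partition of unity (g_p) of G, the averages
   psi(a) = sum_p X (g_p) alpha_p(a) are almost multiplicative, almost invariant and
   close to a when a is almost invariant, so almost invariant elements are close to
   fixed ones.

   (1) Take J = closed span of A I A. If x in J is fixed and close to
   sum_k a_k c_k b_k with c_k in I, then averaging gives
   x ~ sum_k psi(a_k) c_k psi(b_k), and psi(a_k), psi(b_k) are close to fixed elements.

   (2) Let [a,b] be the image in the crossed product of s |-> a alpha_s(b), so that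
   [a,b][c,d] = [a E(bc), d] with E the mean over G. The Rokhlin property makes every
   continuous J-valued function a uniform limit of sums of functions
   s |-> a c alpha_s(b), c ranging over fixed generators of J; in particular the
   brackets span a dense subspace. Let I_0 be the set of fixed c with [xc,y] in I for
   all x, y, and J = closed span of A I_0 A. For z in I, approximating z by brackets
   gives [a,b] z [a',b'] ~ [am,b'] with m fixed and [xm,y] close to I. Functional
   calculus moves such an m a little so that it lands in I_0. *)
Require Import Defs.
From HB Require Import structures.
From mathcomp Require Import all_boot all_order all_algebra.
From mathcomp Require Import ring_quotient complex.
From mathcomp Require Import all_classical all_reals all_analysis.
From mathcomp Require Import measurable_realfun.
From mathcomp Require Import ring lra zify.
Set Implicit Arguments.
Unset Strict Implicit.
Unset Printing Implicit Defensive.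
Import Order.TTheory GRing.Theory Num.Theory numFieldNormedType.Exports.
Local Open Scope classical_set_scope.
Local Open Scope ring_scope.

(** * Norm estimates and functional calculus in C*-algebras *)

(** The Rokhlin homomorphism goes into [Fcentral D], which carries no norm, and its relations hold
    for representing sequences only after multiplication by elements of [D]. Contractivity on
    continuous functions is recovered through unimodular functions, but the arguments need sums of
    terms [X f_i ** d_i], where the triangle inequality loses a factor that grows with the partition
    of unity. The key estimate removes this dependence; its constant 2 is harmless, since all
    quantities it bounds are either made small or only have to be bounded uniformly. Part (1)
    supposes no Haar measure, so averaging is done there by the Rokhlin homomorphism, and the almost
    invariant approximate unit is a finite convex combination. As [A] has no unit, statements about
    [1 - u] are estimates of [b - u ** b] for all [b]. Functional calculus is reduced to two
    iterations, for [1 - sqrt(1 - y)] and for [k^2 / (k^2 + eta)]. Commutation, selfadjointness or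
    membership in an ideal pass to the limits because these lie in every suitable closed set stable
    under the iteration. *)

Section RealNorm.
Context {R : realType} {V : normedModType R[i]}.
Implicit Types (x y : V) (t : R).

(** The norm of a module over [R[i]] takes its values in [R[i]]; the real part loses nothing ([rnE])
    and makes real order lemmas, [lra] and [nra] applicable. *)
Definition rn x : R := complex.Re `|x|.

Lemma rnE x : `|x| = (rn x)%:C%C.
Proof.
have : 0 <= `|x| by [].
by rewrite lecE /= => /andP[/eqP xi _]; rewrite [LHS]complexE xi mulr0 addr0.
Qed.

Lemma rn_leE x t : (`|x| <= t%:C%C) = (rn x <= t).
Proof. by rewrite rnE lecR. Qed.

Lemma rn_ge0 x : 0 <= rn x.
Proof. by have := normr_ge0 x; rewrite rnE lecR. Qed.

Lemma rn0 : rn (0 : V) = 0.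
Proof. by rewrite /rn normr0. Qed.

Lemma rn_eq0 x : rn x = 0 -> x = 0.
Proof. by move=> x0; apply/normr0_eq0; rewrite rnE x0. Qed.

Lemma rn_le0 x : rn x <= 0 -> x = 0.
Proof. by move=> x0; apply: rn_eq0; apply/eqP; rewrite eq_le x0 rn_ge0. Qed.

Lemma rnN x : rn (- x) = rn x.
Proof. by rewrite /rn normrN. Qed.

Lemma rnBC x y : rn (x - y) = rn (y - x).
Proof. by rewrite -rnN opprB. Qed.

Lemma rnD x y : rn (x + y) <= rn x + rn y.
Proof. by have := ler_normD x y; rewrite !rnE -rmorphD lecR. Qed.

Lemma rnB x y : rn (x - y) <= rn x + rn y.
Proof. by rewrite (le_trans (rnD _ _))// rnN. Qed.

Lemma rn_tri z x y : rn (x - y) <= rn (x - z) + rn (z - y).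
Proof. by rewrite (le_trans _ (rnD _ _))// subrKA. Qed.

Lemma rn_le_dist x y : rn x <= rn y + rn (x - y).
Proof. by rewrite addrC (le_trans _ (rnD _ _))// subrK. Qed.

Lemma rnZ (c : R[i]) x : rn (c *: x) = complex.Re `|c| * rn x.
Proof.
by rewrite /rn normrZ [`|x|]rnE normc_def /= mul0r subr0.
Qed.

Lemma rnZr t x : rn (t%:C%C *: x) = `|t| * rn x.
Proof. by rewrite rnZ normc_def /= expr0n /= addr0 sqrtr_sqr. Qed.

Lemma rnZi x : rn ('i%C *: x) = rn x.
Proof. by rewrite rnZ normc_def /= expr0n /= expr1n add0r sqrtr1 mul1r. Qed.

Lemma rn_sum (I : Type) (r : seq I) (P : pred I) (F : I -> V) :
  rn (\sum_(i <- r | P i) F i) <= \sum_(i <- r | P i) rn (F i).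
Proof.
elim/big_ind2 : _ => //; first by rewrite rn0.
by move=> x t y s xt ys; rewrite (le_trans (rnD _ _))// lerD.
Qed.

Lemma rn_sum_le_size (I : eqType) (r : seq I) (F : I -> V) (c : R) :
  (forall i, i \in r -> rn (F i) <= c) ->
  rn (\sum_(i <- r) F i) <= (size r)%:R * c.
Proof.
elim: r => [_|i r IH h]; first by rewrite big_nil rn0 mul0r.
rewrite big_cons (le_trans (rnD _ _))//= -natr1 mulrDl mul1r addrC lerD//.
  by apply: IH => j jr; apply: h; rewrite in_cons jr orbT.
by apply: h; rewrite mem_head.
Qed.

Lemma rn_cvgP (T : Type) (F : set_system T) (FF : Filter F) (f : T -> V) (l : V) :
  f @ F --> l <-> (forall e : R, 0 < e -> \forall x \near F, rn (f x - l) < e).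
Proof.
split=> [/cvgrPdist_lt fl e e0|fl].
  have := fl e%:C%C; rewrite ltcR => /(_ e0); apply: filterS => x.
  by rewrite distrC rnE ltcR.
apply/cvgrPdist_lt => e; rewrite ltcE /= => /andP[/eqP ei e0].
have := fl _ e0; apply: filterS => x xe.
by rewrite distrC rnE ltcE /= ei eqxx xe.
Qed.

Lemma rn_nbhsP (x : V) (P : set V) :
  nbhs x P <-> (exists2 e : R, 0 < e & forall y, rn (y - x) < e -> P y).
Proof.
split=> [/nbhs_normP[e]|[e e0 eP]].
  rewrite /= ltcE /= => /andP[/eqP ei e0] eP; exists (complex.Re e) => // y yx.
  by apply: eP; rewrite /= distrC rnE ltcE /= ei eqxx yx.
apply/nbhs_normP; exists e%:C%C; first by rewrite /= ltcR.
by move=> y /=; rewrite distrC rnE ltcR; exact: eP.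
Qed.

Lemma rn_closureP (S : set V) (x : V) :
  closure S x <-> (forall e : R, 0 < e -> exists2 y, S y & rn (x - y) < e).
Proof.
split=> [Sx e e0|Sx B /rn_nbhsP[e e0 eB]].
  have [|y [Sy By]] := Sx [set y | rn (y - x) < e].
    by apply/rn_nbhsP; exists e.
  by exists y => //; rewrite rnBC.
by have [y Sy xy] := Sx e e0; exists y; split => //; apply: eB; rewrite rnBC.
Qed.

Lemma rn_closed (S : set V) (x : V) : closed S ->
  (forall e : R, 0 < e -> exists2 y, S y & rn (x - y) < e) -> S x.
Proof. by move=> Sc Sx; apply: Sc; apply/rn_closureP. Qed.

Lemma closed_rnP (S : set V) :
  (forall x, (forall e : R, 0 < e -> exists2 y, S y & rn (x - y) < e) -> S x) ->
  closed S.
Proof. by move=> h x /rn_closureP; exact: h. Qed.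

End RealNorm.

(** A real majorant gives both convergence and rate. Applied with [v n] of the form [- C * e n],
    [e n] geometric and [M = 0], it bounds the distance from [u n] to the limit by [C * e n]. *)
Lemma telescoping_cvg (R : realType) (V : completeNormedModType R[i])
    (u : nat -> V) (v : nat -> R) (M : R) :
  (forall n, rn (u n.+1 - u n) <= v n.+1 - v n) -> (forall n, v n <= M) ->
  exists l : V, u n @[n --> \oo] --> l /\ forall n, rn (l - u n) <= M - v n.
Proof.
move=> uv vM.
have ud n k : rn (u (n + k)%N - u n) <= v (n + k)%N - v n.
  elim: k => [|k IH]; first by rewrite addn0 !subrr rn0.
  rewrite addnS (le_trans (rn_tri (u (n + k)%N) _ _))//.
  by rewrite (le_trans (lerD (uv _) IH))// subrKA.
have vnd : nondecreasing_seq v.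
  by apply/nondecreasing_seqP => n; rewrite -subr_ge0 (le_trans (rn_ge0 _) (uv n)).
have vc : cvgn v by apply: nondecreasing_is_cvgn => //; exists M => _ [n _ <-].
have ul : cvgn u.
  apply/cauchy_cvgP/cauchy_exP => e; rewrite ltcE /= => /andP[/eqP ei e0].
  have /cvgrPdist_lt/(_ _ e0)[N _ NP] := vc.
  exists (u N); exists N => // n /= Nn.
  rewrite -ball_normE /ball_ /= distrC rnE ltcE /= ei eqxx /=.
  rewrite -(subnKC Nn) (le_lt_trans (ud _ _))//.
  have vl k : v k <= limn v by exact: nondecreasing_cvgn_le.
  have := NP N (leqnn _); rewrite ger0_norm ?subr_ge0//.
  by apply: le_lt_trans; rewrite lerD2r.
exists (limn u); split => // n; apply/ler_addgt0Pl => e e0.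
have /(rn_cvgP _)/(_ _ e0)[N _ NP] := ul.
have /= := NP (n + N)%N (leq_addl _ _) => ulN.
rewrite (le_trans (rn_tri (u (n + N)%N) _ _))// rnBC lerD//; first exact: ltW.
by rewrite (le_trans (ud _ _))// lerD2r.
Qed.

Section CStarNorm.
Context {R : realType} {A : cstarAlgType R}.
Implicit Types x y a b : A.

Lemma rnM x y : rn (x ** y) <= rn x * rn y.
Proof. by have := normM x y; rewrite !rnE -rmorphM lecR. Qed.

Lemma rn_star x : rn (star x) = rn x.
Proof. by rewrite /rn norm_star. Qed.

Lemma rnC x : rn (star x ** x) = rn x ^+ 2.
Proof.
by have := normCstar x; rewrite !rnE -rmorphXn => -[].
Qed.

Lemma rnC' x : rn (x ** star x) = rn x ^+ 2.
Proof. by rewrite -{1}(starK x) rnC rn_star. Qed.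

Lemma rnM_le x y (s t : R) : rn x <= s -> rn y <= t -> rn (x ** y) <= s * t.
Proof. by move=> xs yt; rewrite (le_trans (rnM _ _))// ler_pM// rn_ge0. Qed.

Lemma rnM_leLHS x y (s : R) : rn x <= s -> rn (x ** y) <= s * rn y.
Proof. by move=> xs; exact: rnM_le. Qed.

Lemma amulBl x y b : (x - y) ** b = x ** b - y ** b.
Proof. by rewrite amulDl amulNl. Qed.

Lemma amulBr x y b : b ** (x - y) = b ** x - b ** y.
Proof. by rewrite amulDr amulNr. Qed.

Lemma amul_suml (I : Type) (r : seq I) (P : pred I) (F : I -> A) y :
  (\sum_(i <- r | P i) F i) ** y = \sum_(i <- r | P i) F i ** y.
Proof. exact: (big_morph (fun z => z ** y) (fun u v => amulDl u v y) (amul0l y)). Qed.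

Lemma amul_sumr (I : Type) (r : seq I) (P : pred I) (F : I -> A) x :
  x ** (\sum_(i <- r | P i) F i) = \sum_(i <- r | P i) x ** F i.
Proof. exact: (big_morph (amul x) (amulDr x) (amul0r x)). Qed.

Lemma star_sum (I : Type) (r : seq I) (P : pred I) (F : I -> A) :
  star (\sum_(i <- r | P i) F i) = \sum_(i <- r | P i) star (F i).
Proof. exact: (big_morph star (@starD R A) (@star0 R A)). Qed.

Lemma starB x y : star (x - y) = star x - star y.
Proof. by rewrite starD starN. Qed.

Lemma starZr (t : R) x : star (t%:C%C *: x) = t%:C%C *: star x.
Proof. by rewrite starZ; congr (_ *: _); exact: conjc_real. Qed.

(* [p + iq] and [p - iq] both have norm [rn b]. *)
Lemma unitary_pair p q b : star p ** p + star q ** q = star b ** b ->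
  star p ** q = star q ** p -> rn p <= rn b /\ rn q <= rn b.
Proof.
move=> pqb pq.
have sqr_le (s t : R) : 0 <= s -> 0 <= t -> s ^+ 2 = t ^+ 2 -> s <= t.
  by move=> s0 t0 /eqP; rewrite eqrXn2// => /eqP ->.
have h (e : R[i]) : e^* = - e -> e * e = -1 -> rn (p + e *: q) <= rn b.
  move=> ec ee; apply: sqr_le; rewrite ?rn_ge0//; rewrite -!rnC; congr rn.
  rewrite -pqb starD starZ ec amulDl !amulDr !amulZl !amulZr scalerA mulNr ee opprK scale1r.
  by rewrite scaleNr pq addrA addrK.
have ic : ('i%C : R[i])^* = - 'i%C by apply/eqP; rewrite eq_complex /= oppr0 !eqxx.
have h1 := h _ ic (sqr_i _).
have h2 : rn (p + (- 'i%C) *: q) <= rn b.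
  by apply: h; [apply/eqP; rewrite eq_complex /= ?oppr0 ?opprK !eqxx|rewrite mulrNN -expr2 sqr_i].
have two x : rn (2%:R%:C%C *: x) = 2 * rn x by rewrite rnZr ger0_norm.
split.
  rewrite -(ler_pM2l (ltr0n _ 2)) -two mulr2n mulrDl !mul1r.
  have -> : 2%:R%:C%C *: p = (p + 'i%C *: q) + (p + (- 'i%C) *: q).
    by rewrite scaleNr addrACA subrr addr0 rmorphD/= scalerDl scale1r.
  by rewrite (le_trans (rnD _ _))// lerD.
rewrite -(ler_pM2l (ltr0n _ 2)) -two mulr2n mulrDl !mul1r.
have -> : rn (2%:R%:C%C *: q) = rn ((p + 'i%C *: q) - (p + (- 'i%C) *: q)).
  by rewrite scaleNr opprD opprK addrACA subrr add0r -scalerDr rnZi rmorphD/= scalerDl scale1r.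
by rewrite (le_trans (rnB _ _))// lerD.
Qed.

End CStarNorm.

(** Syntax of a reflexive procedure for additive identities. The noncommutative product is opaque to
    it: products expanded beforehand by distributivity become atoms. *)
Inductive zterm := ZVar of nat | ZZero | ZAdd of zterm & zterm | ZOpp of zterm.

Fixpoint zeval (V : zmodType) (env : seq V) (t : zterm) : V :=
  match t with
  | ZVar i => nth 0 env i
  | ZZero => 0
  | ZAdd t1 t2 => zeval env t1 + zeval env t2
  | ZOpp t1 => - zeval env t1
  end.

Fixpoint zcoef (t : zterm) (i : nat) : int :=
  match t with
  | ZVar j => if eqn i j then 1 else 0
  | ZZero => 0
  | ZAdd t1 t2 => zcoef t1 i + zcoef t2 i
  | ZOpp t1 => - zcoef t1 i
  end.

Lemma zevalE (V : zmodType) (env : seq V) (t : zterm) :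
  zeval env t = \sum_(i < size env) env`_i *~ zcoef t i.
Proof.
elim: t => [j||t1 IH1 t2 IH2|t IH] /=.
- have [jn|nj] := ltnP j (size env).
    rewrite (bigD1 (Ordinal jn))//= eqnE eqxx mulr1z big1 ?addr0// => i ij.
    by rewrite ifN ?mulr0z//; apply: contra ij => /eqP ij; apply/eqP/val_inj.
  rewrite nth_default// big1// => i _; rewrite ?eqnE ifN ?mulr0z//.
  by apply: contraTN (ltn_ord i) => /eqP ->; rewrite -leqNgt.
- by rewrite big1.
- by rewrite IH1 IH2 -big_split; apply: eq_bigr => i _; rewrite mulrzDr.
- by rewrite IH -sumrN; apply: eq_bigr => i _; rewrite mulrNz.
Qed.

Lemma zeval_eq (V : zmodType) (env : seq V) (t1 t2 : zterm) :
  all (fun i => zcoef t1 i == zcoef t2 i) (iota 0 (size env)) ->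
  zeval env t1 = zeval env t2.
Proof.
move=> /allP h; rewrite !zevalE; apply: eq_bigr => i _.
by rewrite (eqP (h i _))// mem_iota ltn_ord.
Qed.

(** Atoms are identified up to conversion: the type ascription of [erefl x] succeeds exactly when
    [x] and [y] unify. *)
Ltac z_find x env :=
  match env with
  | cons ?y _ => let _ := constr:(erefl x : x = y) in constr:(0%N)
  | cons _ ?e => let n := z_find x e in constr:(S n)
  end.

Ltac z_env t env :=
  lazymatch t with
  | GRing.zero => env
  | (?a + ?b)%R => let e := z_env a env in z_env b e
  | (- ?a)%R => z_env a env
  | ?x => let ok := match constr:(tt) with
          | _ => let n := z_find x env in constr:(true)
          | _ => constr:(false) end in
          lazymatch ok with true => env | false => constr:(cons x env) end
  end.

Ltac z_term t env :=
  lazymatch t with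
  | GRing.zero => constr:(ZZero)
  | (?a + ?b)%R => let a' := z_term a env in let b' := z_term b env in constr:(ZAdd a' b')
  | (- ?a)%R => let a' := z_term a env in constr:(ZOpp a')
  | ?x => let n := z_find x env in constr:(ZVar n)
  end.

(* Decides equalities that hold in every abelian group. *)
Ltac zmod :=
  lazymatch goal with
  | |- @eq ?T ?a ?b =>
    let e0 := constr:(@nil T) in
    let e1 := z_env a e0 in
    let env := z_env b e1 in
    let ta := z_term a env in
    let tb := z_term b env in
    apply: (@zeval_eq _ env ta tb); by vm_compute
  end.

Section CStarCalculus.
Context {R : realType} {A : cstarAlgType R}.
Implicit Types x y a b k s u : A.

Lemma amul_continuousl a : continuous (fun x => a ** x).
Proof.
move=> x; apply/rn_cvgP => e e0.
have a0 : 0 < rn a + 1 by rewrite ltr_wpDl// rn_ge0.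
apply/rn_nbhsP; exists (e / (rn a + 1)); first by rewrite divr_gt0.
move=> y yx; rewrite -amulBr (le_lt_trans (rnM _ _))//.
move: yx; rewrite ltr_pdivlMr// => /(le_lt_trans _); apply.
by rewrite mulrC ler_wpM2l ?rn_ge0// lerDl.
Qed.

Lemma amul_continuousr a : continuous (fun x => x ** a).
Proof.
move=> x; apply/rn_cvgP => e e0.
have a0 : 0 < rn a + 1 by rewrite ltr_wpDl// rn_ge0.
apply/rn_nbhsP; exists (e / (rn a + 1)); first by rewrite divr_gt0.
move=> y yx; rewrite -amulBl (le_lt_trans (rnM _ _))//.
move: yx; rewrite ltr_pdivlMr// => /(le_lt_trans _); apply.
by rewrite ler_wpM2l ?rn_ge0// lerDl.
Qed.

Lemma star_continuous : continuous (@star R A).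
Proof.
move=> x; apply/rn_cvgP => e e0; apply/rn_nbhsP; exists e => // y yx.
by rewrite -starB rn_star.
Qed.

Lemma closed_eq (f g : A -> A) : continuous f -> continuous g ->
  closed [set x | f x = g x].
Proof.
move=> fc gc; apply: closed_rnP => x fgx /=.
apply/eqP; rewrite -subr_eq0; apply/eqP/rn_le0/ler_addgt0Pl => e e0; rewrite addr0.
have e2 : 0 < e / 2 by rewrite divr_gt0.
have /rn_cvgP/(_ _ e2)/rn_nbhsP[d1 d10 fP] := fc x.
have /rn_cvgP/(_ _ e2)/rn_nbhsP[d2 d20 gP] := gc x.
have [|y /= fgy xy] := fgx (Num.min d1 d2); first by rewrite lt_min d10.
have yx : rn (y - x) < Num.min d1 d2 by rewrite rnBC.
move: yx; rewrite lt_min => /andP[yx1 yx2].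
rewrite (le_trans (rn_tri (f y) _ _))// [e]splitr lerD//.
  by rewrite rnBC ltW// fP.
by rewrite fgy ltW// gP.
Qed.

Lemma closed_comm a : closed [set x | x ** a = a ** x].
Proof. exact: closed_eq (@amul_continuousr a) (@amul_continuousl a). Qed.

Lemma closed_selfadj : closed [set x : A | star x = x].
Proof. by apply: closed_eq; [exact: star_continuous | move=> x; exact: cvg_id]. Qed.

Lemma cvg_unique_rn (T : Type) (F : set_system T) (FF : ProperFilter F)
  (f : T -> A) (x y : A) : f @ F --> x -> f @ F --> y -> x = y.
Proof. by move=> fx fy; apply: (cvg_unique _ fx fy). Qed.

Definition half : R[i] := (2%:R^-1)%:C%C.

Lemma halfD x : half *: x + half *: x = x.
Proof.
rewrite -scalerDl -[RHS]scale1r; congr (_ *: _); rewrite -rmorphD.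
by congr (_%:C)%C; lra.
Qed.

Lemma rn_half x : rn (half *: x) = rn x / 2.
Proof. by rewrite rnZr ger0_norm ?invr_ge0 ?ler0n// mulrC. Qed.

(* [1 - s] is the square root of [1 - y], obtained by iterating
   [s |-> (y + s^2) / 2]; the real sequence for [y = 1] is a majorant. *)
Lemma sqrt_one_minus y : star y = y -> rn y <= 1 ->
  exists s, [/\ star s = s, s + s - s ** s = y &
    forall S : set A, closed S -> S 0 ->
      (forall x, S x -> S (half *: (y + x ** x))) -> S s].
Proof.
move=> ys y1.
pose step s := half *: (y + s ** s).
pose u := fix u n := if n is n'.+1 then step (u n') else 0.
pose v := fix v n : R := if n is n'.+1 then (1 + v n' ^+ 2) / 2 else 0.
have v01 n : 0 <= v n <= 1.
  elim: n => [|n /andP[v0 v1]] /=; first by rewrite lexx ler01.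
  by rewrite divr_ge0 ?addr_ge0 ?sqr_ge0//= ler_pdivrMr// mul1r lerD// expr_le1.
have uv n : rn (u n) <= v n.
  elim: n => [|n IH] /=; first by rewrite rn0.
  rewrite /step rn_half ler_pM2r ?invr_gt0// (le_trans (rnD _ _))// lerD//.
  by rewrite expr2 rnM_le.
have duv n : rn (u n.+1 - u n) <= v n.+1 - v n.
  elim: n => [|n IH].
    rewrite /= /step amul0l addr0 subr0 rn_half subr0 expr0n addr0.
    by rewrite ler_pM2r ?invr_gt0.
  have -> : v n.+2 - v n.+1 = (v n.+1 ^+ 2 - v n ^+ 2) / 2 by rewrite /=; lra.
  have -> : u n.+2 - u n.+1 = half *: (u n.+1 ** u n.+1 - u n ** u n).
    by rewrite /= /step -scalerBr; congr (_ *: _); zmod.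
  rewrite rn_half ler_pM2r ?invr_gt0// subr_sqr.
  have -> : u n.+1 ** u n.+1 - u n ** u n =
      (u n.+1 - u n) ** u n.+1 + u n ** (u n.+1 - u n).
    by rewrite amulBl amulBr; zmod.
  have dv0 : 0 <= v n.+1 - v n := le_trans (rn_ge0 _) IH.
  rewrite mulrDr (le_trans (rnD _ _))// lerD//.
    exact: rnM_le.
  by rewrite mulrC; exact: rnM_le.
have [//|s [us _]] := telescoping_cvg duv (M := 1).
  by move=> n; case/andP: (v01 n).
(* Induction principle for the limit: a closed property that holds at 0 and survives one step of the
   iteration holds at [s]. It yields selfadjointness here and commutation in later uses. *)
have inS (S : set A) : closed S -> S 0 ->
    (forall x, S x -> S (half *: (y + x ** x))) -> S s.
  move=> Sc S0 Sh; apply: (closed_cvg S Sc _ s us); apply: nearW.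
  by elim=> [//|n IH]; exact: Sh.
exists s; split => //.
  apply: (inS [set x | star x = x]); [exact: closed_selfadj|exact: star0|].
  by move=> x /= xs; rewrite starZr starD starM xs ys.
have /= us1 : u n.+1 @[n --> \oo] --> s by rewrite cvg_shiftS.
have us2 : u n.+1 @[n --> \oo] --> half *: (y + s ** s).
  apply/rn_cvgP => e e0.
  have s0 : 0 < 1 + rn s by rewrite ltr_pwDl// rn_ge0.
  have [|N _ NP] := (iffLR (rn_cvgP _ _ _) us) (e / (1 + rn s)); first by rewrite divr_gt0.
  exists N => // n /= Nn; rewrite /step -scalerBr rn_half.
  have -> : y + u n ** u n - (y + s ** s) = u n ** (u n - s) + (u n - s) ** s.
    rewrite amulBl amulBr. zmod.
  have uns : rn (u n - s) * (1 + rn s) < e by rewrite -ltr_pdivlMr//; exact: NP.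
  rewrite (le_lt_trans _ uns)// ler_pdivrMr// (le_trans (rnD _ _))//.
  have un1 : rn (u n) <= 1 by rewrite (le_trans (uv n))//; case/andP: (v01 n).
  have a1 : rn (u n ** (u n - s)) <= rn (u n - s) by rewrite -[leRHS]mul1r rnM_leLHS.
  have a2 : rn ((u n - s) ** s) <= rn (u n - s) * rn s by exact: rnM.
  have := rn_ge0 (u n - s); have := rn_ge0 s; nra.
have ss := cvg_unique_rn _ us1 us2.
have -> : s + s = y + s ** s by rewrite -[RHS]halfD -ss.
by rewrite addrK.
Qed.

(** The C*-identity at [b = star x]. This is how an estimate on left multiplication becomes a norm
    estimate without a unit. *)
Lemma rn_le_mul x (c : R) : 0 <= c -> (forall b, rn (x ** b) <= c * rn b) ->
  rn x <= c.
Proof.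
move=> c0 xb; have := xb (star x); rewrite rnC' rn_star expr2.
have [->//|x0] := eqVneq (rn x) 0.
by rewrite ler_pM2r// lt_def x0 rn_ge0.
Qed.

(** The hypothesis reads [(1 - s)^2 + k^2 = 1], with commuting selfadjoint [1 - s] and [k];
    [unitary_pair] is applied to their products with [b]. *)
Lemma sqrt_pair k s b : star k = k -> star s = s -> s ** k = k ** s ->
  s + s - s ** s = k ** k -> rn (b - s ** b) <= rn b /\ rn (k ** b) <= rn b.
Proof.
move=> ks ss sk e; apply: unitary_pair.
  rewrite starB !starM ss ks !(amulBl, amulBr) -!amulA (amulA k) -e.
  rewrite !(amulDl, amulDr, amulBl, amulBr, amulNl, amulNr) -!amulA; zmod.
rewrite starB !starM ss ks !(amulBl, amulBr) -!amulA.
by rewrite (amulA s) sk !amulA.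
Qed.

(** With [s = 1 - sqrt(1 - k^2)] one has [1 - k^2 = (1 - s)^2], a contraction applied twice. *)
Lemma sub_sqr_contractive k b : star k = k -> rn k <= 1 ->
  rn (b - k ** (k ** b)) <= rn b.
Proof.
move=> ks k1; have [||s [ss e inS]] := @sqrt_one_minus (k ** k).
- by rewrite starM ks.
- by rewrite -(mulr1 1) rnM_le.
have sk : s ** k = k ** s.
  apply: (inS [set x | x ** k = k ** x]); first exact: closed_comm.
    by rewrite /= amul0l amul0r.
  by move=> x /= xk; rewrite amulZl amulZr amulDl amulDr -!amulA xk !amulA xk.
have h c := (sqrt_pair c ks ss sk e).1.
rewrite amulA -e; apply: le_trans (h b); apply: le_trans (h (b - s ** b)).
suff -> : b - (s + s - s ** s) ** b = b - s ** b - s ** (b - s ** b) by [].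
by rewrite !(amulDl, amulBr, amulNl) -!amulA; zmod.
Qed.

End CStarCalculus.

Section StarHom.
Context {R : realType} {A E : cstarAlgType R} (h : A -> E).
Hypothesis hom : star_hom h.

Lemma star_hom0 : h 0 = 0.
Proof.
have [lin _ _] := hom; have := lin 1 0 0 I I.
by rewrite !scale1r addr0 => /esym/eqP; rewrite -subr_eq0 addrK => /eqP.
Qed.

Lemma star_homZ (c : R[i]) x : h (c *: x) = c *: h x.
Proof. by have [lin _ _] := hom; have := lin c x 0 I I; rewrite !addr0 star_hom0 addr0. Qed.

Lemma star_homD x y : h (x + y) = h x + h y.
Proof. by have [lin _ _] := hom; have := lin 1 x y I I; rewrite !scale1r. Qed.

Lemma star_homB x y : h (x - y) = h x - h y.
Proof. by rewrite star_homD -scaleN1r star_homZ scaleN1r. Qed.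

Lemma star_homM x y : h (x ** y) = h x ** h y.
Proof. by have [_ hM _] := hom; rewrite hM. Qed.

Lemma star_homS x : h (star x) = star (h x).
Proof. by have [_ _ hS] := hom; rewrite hS. Qed.

(** No continuity of [h] is supposed: for selfadjoint [k] of norm at most 1 the relation
    [(1 - s)^2 + k^2 = 1] is algebraic, so [h] carries it over and [sqrt_pair] bounds [h k]. Scaling
    gives all selfadjoint elements, the C*-identity all elements. *)
Lemma star_hom_contractive x : rn (h x) <= rn x.
Proof.
have unit k : star k = k -> rn k <= 1 -> rn (h k) <= 1.
  move=> ks k1; have [||s [ss e inS]] := @sqrt_one_minus _ _ (k ** k).
  - by rewrite starM ks.
  - by rewrite -(mulr1 1) rnM_le.
  have sk : s ** k = k ** s.
    apply: (inS [set x | x ** k = k ** x]); first exact: closed_comm.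
      by rewrite /= amul0l amul0r.
    by move=> z /= xk; rewrite amulZl amulZr amulDl amulDr -!amulA xk !amulA xk.
  apply: rn_le_mul => // b; rewrite mul1r.
  apply: (@sqrt_pair _ _ (h k) (h s) b _ _ _ _).2.
  - by rewrite -star_homS ks.
  - by rewrite -star_homS ss.
  - by rewrite -!star_homM sk.
  - by rewrite -!star_homM -star_homD -star_homB e.
have sadj k : star k = k -> rn (h k) <= rn k.
  move=> ks; have [k0|k0] := eqVneq (rn k) 0.
    by rewrite (rn_eq0 k0) star_hom0 !rn0.
  have kp : 0 < rn k by rewrite lt_def k0 rn_ge0.
  have := unit ((rn k)^-1%:C%C *: k); rewrite starZr ks star_homZ !rnZr.
  rewrite ger0_norm ?invr_ge0 ?rn_ge0// mulVf// mulrC ler_pdivrMr// mul1r.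
  exact.
have := sadj (star x ** x); rewrite starM starK => /(_ erefl).
rewrite star_homM star_homS !rnC.
by rewrite ler_pXn2r// nnegrE rn_ge0.
Qed.

Lemma star_hom_continuous : continuous h.
Proof.
move=> x; apply/rn_cvgP => e e0; apply/rn_nbhsP; exists e => // y.
by apply: le_lt_trans; rewrite -star_homB star_hom_contractive.
Qed.

Lemma star_hom_sum (I : Type) (r : seq I) (P : pred I) (F : I -> A) :
  h (\sum_(i <- r | P i) F i) = \sum_(i <- r | P i) h (F i).
Proof. by apply: big_morph; [exact: star_homD | exact: star_hom0]. Qed.

End StarHom.

Section Resolvent.
Context {R : realType} {A : cstarAlgType R}.
Implicit Types x y b k u : A.

(** Closure under [star] is left out on purpose: the notion is applied to closed two-sided ideals in
    order to prove that they are selfadjoint ([cstar_ideal_star]). *)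
Definition closed_subalg (S : set A) :=
  [/\ closed S, S 0, forall (c : R[i]) x y, S x -> S y -> S (c *: x + y)
    & forall x y, S x -> S y -> S (x ** y)].

(** The fixed point equation is [eta u = k^2 - k^2 u]. The step contracts by [(1 + eta)^-1] because
    [1 - k^2] does not increase norms. *)
Let resolvent_step (eta : R) k u := (1 + eta)^-1%:C%C *: (k ** k + (u - k ** (k ** u))).

Lemma closed_subalg_resolvent_step (eta : R) k u (S : set A) :
  closed_subalg S -> S k -> S u -> S (resolvent_step eta k u).
Proof.
move=> [_ S0 SP SM] Sk Su.
have SD x y : S x -> S y -> S (x + y) by rewrite -{2}[x]scale1r; exact: SP.
have SZ (c : R[i]) x : S x -> S (c *: x) by rewrite -[c *: x]addr0 => Sx; exact: SP.
have SN x : S x -> S (- x) by rewrite -scaleN1r; exact: SZ.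
by apply/SZ/SD; [exact: SM | apply/SD => //; apply/SN/SM => //; exact: SM].
Qed.

(* [u = k^2 (k^2 + eta)^-1], the fixed point of a contraction. *)
Lemma resolvent_exists (eta : R) k : 0 < eta -> star k = k -> rn k <= 1 ->
  exists u, [/\ star u = u, u ** k = k ** u,
    eta%:C%C *: u = k ** k - k ** (k ** u)
  & forall S, closed_subalg S -> S k -> S u].
Proof.
move=> e0 ks k1; pose F := resolvent_step eta k.
have lp : 0 < 1 + eta by rewrite addr_gt0.
pose l := (1 + eta)^-1.
have l0 : 0 < l by rewrite invr_gt0.
have l1 : l < 1 by rewrite invf_lt1// ltrDl.
have Fl x y : rn (F x - F y) <= l * rn (x - y).
  rewrite /F /resolvent_step -scalerBr rnZr gtr0_norm// ler_pM2l//.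
  apply: le_trans (sub_sqr_contractive (x - y) ks k1).
  suff -> : k ** k + (x - k ** (k ** x)) - (k ** k + (y - k ** (k ** y))) =
     x - y - k ** (k ** (x - y)) by [].
  by rewrite !amulBr; zmod.
pose u n := iter n F 0.
pose v n : R := (1 - l ^+ n) / (1 - l).
have lN : 0 < 1 - l by rewrite subr_gt0.
have dv n : v n.+1 - v n = l ^+ n.
  rewrite /v exprS; field; exact: lt0r_neq0.
have duv n : rn (u n.+1 - u n) <= v n.+1 - v n.
  rewrite dv; elim: n => [|n IH]; last first.
    by rewrite exprS (le_trans (Fl _ _))// ler_pM2l.
  rewrite /= subr0 expr0 /F /resolvent_step !amul0r subrr addr0 rnZr gtr0_norm//.
  rewrite -[leRHS](mulr1 1) ler_pM ?rn_ge0 ?(ltW l0) ?(ltW l1)//.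
  by rewrite -[leRHS](mulr1 1) rnM_le.
have [|s [us _]] := telescoping_cvg duv (M := (1 - l)^-1).
  move=> n; rewrite ler_pdivrMr// mulVf ?lt0r_neq0// lerBlDr lerDl.
  by rewrite exprn_ge0// ltW.
have us1 : u n.+1 @[n --> \oo] --> s by rewrite cvg_shiftS.
have us2 : u n.+1 @[n --> \oo] --> F s.
  apply/rn_cvgP => e ep; have /(rn_cvgP _)/(_ e ep) := us; apply: filterS => n.
  apply: le_lt_trans; rewrite (le_trans (Fl _ _))// -[leRHS]mul1r.
  by rewrite ler_wpM2r ?rn_ge0 ?(ltW l1).
have sF : s = F s := cvg_unique_rn _ us1 us2.
have inS (S : set A) : closed S -> S 0 -> (forall x, S x -> S (F x)) -> S s.
  move=> Sc S0 Sh; apply: (closed_cvg S Sc _ s us); apply: nearW.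
  by elim=> [//|n IH]; exact: Sh.
have sk : s ** k = k ** s.
  apply: (inS [set x | x ** k = k ** x]); first exact: closed_comm.
    by rewrite /= amul0l amul0r.
  move=> x /= xk; rewrite amulZl amulZr !(amulDl, amulDr, amulNl, amulNr).
  by rewrite -!amulA xk.
exists s; split => //.
- suff [] : ([set x : A | star x = x] `&` [set x | x ** k = k ** x]) s by [].
  apply: inS; first by apply: closedI; [exact: closed_selfadj|exact: closed_comm].
    by split; rewrite /= ?star0// amul0l amul0r.
  move=> x [/= xs xk]; split => /=.
    by rewrite /F /resolvent_step starZr starD starB !starM ks xs -xk amulA xk -!amulA xk.
  rewrite /F /resolvent_step amulZl amulZr !(amulDl, amulDr, amulNl, amulNr).
  by rewrite -!amulA xk.
- have : (1 + eta)%:C%C *: s = k ** k + (s - k ** (k ** s)).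
    rewrite {1}sF /F /resolvent_step scalerA -rmorphM divff ?scale1r//.
    exact: lt0r_neq0.
  rewrite rmorphD scalerDl scale1r => /eqP; rewrite addrC -subr_eq0 => /eqP e.
  apply/eqP; rewrite -subr_eq0; apply/eqP; rewrite -[RHS]e; zmod.
- move=> S Sa Sk; have [Sc S0 _ _] := Sa; apply: inS => // x Sx.
  exact: closed_subalg_resolvent_step.
Qed.

(** Here [u = k^2 / (k^2 + rho^2)], after rescaling [k] into the unit ball. The pair [1 - 2u] and
    [(2 / rho) k (1 - u)] is the rational parametrization of the circle, so its squares add up to 1
    and both members are contractions; [1 - u] is then the mean of 1 and [1 - 2u]. *)
Lemma regularization (rho : R) k : 0 < rho -> star k = k ->
  exists u, [/\ [/\ star u = u, u ** k = k ** u,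
      (rho ^+ 2)%:C%C *: u = k ** k - k ** (k ** u)
    & forall S, closed_subalg S -> S k -> S u],
    forall b, rn (b - u ** b) <= rn b, forall b, rn (b - b ** u) <= rn b
  & rn (k - k ** u) <= rho / 2].
Proof.
move=> r0 ks; pose t := rn k + 1; have t0 : 0 < t by rewrite ltr_wpDl// rn_ge0.
have [|||u [us uk eu uS]] := @resolvent_exists ((rho / t) ^+ 2) (t^-1%:C%C *: k).
- by rewrite exprn_gt0// divr_gt0.
- by rewrite starZr ks.
- rewrite rnZr gtr0_norm ?invr_gt0// mulrC ler_pdivrMr// mul1r /t.
  by rewrite lerDl.
have tS (x y : A) : t^-1%:C%C *: x = t^-1%:C%C *: y -> x = y.
  move=> /(congr1 (fun z => t%:C%C *: z)); rewrite !scalerA -!rmorphM divff ?scale1r//.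
  exact: lt0r_neq0.
have {}uk : u ** k = k ** u by apply: tS; rewrite -amulZr -amulZl.
have {}eu : (rho ^+ 2)%:C%C *: u = k ** k - k ** (k ** u).
  apply: (tS); apply: tS; move: eu; rewrite !(amulZl, amulZr) -!scalerBr => <-.
  rewrite !scalerA -!rmorphM; congr (_%:C%C *: _); field; exact: lt0r_neq0.
have mul2 b : half *: b + half *: b = b := halfD b.
have h b : rn (b - (u ** b + u ** b)) <= rn b /\
    rn ((2 / rho)%:C%C *: (k ** b - k ** (u ** b))) <= rn b.
  apply: unitary_pair.
    rewrite starZr amulZl amulZr scalerA -rmorphM.
    have -> : star (k ** b - k ** (u ** b)) ** (k ** b - k ** (u ** b)) =
        star b ** ((rho ^+ 2)%:C%C *: u) ** (b - u ** b).
      rewrite eu starB !starM ks us !(amulBl, amulBr) -!amulA.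
      have uk' c : u ** (k ** c) = k ** (u ** c) by rewrite !amulA uk.
      by rewrite !uk'.
    rewrite amulZr amulZl scalerA -rmorphM.
    have -> : 2 / rho * (2 / rho) * rho ^+ 2 = 4 by field; exact: lt0r_neq0.
    rewrite starB starD !starM us.
    rewrite (_ : 4 = 1 + 1 + 1 + 1); last by ring.
    rewrite !rmorphD !scalerDl !scale1r !(amulDl, amulDr, amulNl, amulNr) -!amulA.
    zmod.
  rewrite starZr amulZl amulZr; congr (_ *: _).
  have uk' c : u ** (k ** c) = k ** (u ** c) by rewrite !amulA uk.
  rewrite !(starB, starD, starM) ks us !(amulDl, amulDr, amulNl, amulNr) -!amulA !uk'.
  zmod.
have hl b : rn (b - u ** b) <= rn b.
  have -> : b - u ** b = half *: (b + (b - (u ** b + u ** b))).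
    by rewrite -[LHS]mul2 -scalerDr; congr (_ *: _); zmod.
  rewrite rn_half ler_pdivrMr// (le_trans (rnD _ _))//.
  by have := (h b).1; lra.
exists u; split => //.
- split => // S Sa Sk; apply: uS => //.
  have [_ S0 SP _] := Sa; rewrite -[_ *: _]addr0; exact: SP.
- by move=> b; rewrite -rn_star starB starM us -(rn_star b) hl.
- apply: rn_le_mul; first by rewrite divr_ge0// ltW.
  move=> b; have := (h b).2; rewrite rnZr gtr0_norm ?divr_gt0// amulBl -amulA.
  by rewrite mulrC -ler_pdivlMr ?divr_gt0// invf_div mulrC.
Qed.

End Resolvent.

Lemma continuous_bigsum (T : topologicalType) (K : numFieldType) (V : normedModType K)
    (I : Type) (r : seq I) (F : I -> T -> V) :
  (forall i, continuous (F i)) -> continuous (fun x => \sum_(i <- r) F i x).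
Proof.
move=> Fc x; elim: r => [|i r IH].
  rewrite (_ : (fun x => _) = cst 0); first exact: cst_continuous.
  by apply/funext => y; rewrite big_nil.
rewrite (_ : (fun x => _) = fun x => F i x + \sum_(j <- r) F j x).
  by apply: continuousD; [exact: Fc|exact: IH].
by apply/funext => y; rewrite big_cons.
Qed.

(** * Partitions of unity and the Hahn-Banach theorem *)

Section PartitionOfUnity.
Context {R : realType} {T : ptopologicalType}.
Hypotheses (Thaus : hausdorff_space T) (Tcompact : compact [set: T]).

Lemma bump_function (t : T) (U : set T) : nbhs t U ->
  exists b : T -> R, [/\ continuous b, forall x, 0 <= b x, 0 < b t
    & forall x, 0 < b x -> U x].
Proof.
move=> Ut; have /uniform_separatorP : uniform_separator (~` U^°) [set t].
  apply: normal_uniform_separator; first exact: compact_normal.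
  - by apply: open_closedC; exact: open_interior.
  - exact: accessible_closed_set1 (hausdorff_accessible Thaus) t.
  - by rewrite -subset0 => x [+ xt]; rewrite xt; apply; exact: nbhs_singleton (nbhs_interior Ut).
move=> /(_ R)[b [bc b01 b0 b1]].
exists b; split => //.
- by move=> x; have := b01 (b x) (ex_intro2 _ _ x I erefl); rewrite /= in_itv /= => /andP[].
- have -> : b t = 1 by apply: b1; exists t.
  exact: ltr01.
- move=> x bx; apply: contrapT => nUx.
  have : b x = 0 by apply: b0; exists x => // /interior_subset.
  by move=> b0'; rewrite b0' ltxx in bx.
Qed.

(** The functions are indexed by points of the space, so that [p] can also serve as the sample point
    for the piece [f p] in Riemann sums and orbit averages. *)
Lemma partition_of_unity (P : T -> set T) : (forall t, nbhs t (P t)) ->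
  exists (s : seq T) (f : T -> T -> R),
    [/\ forall p, continuous (f p), forall p t, 0 <= f p t,
        forall t, \sum_(p <- s) f p t = 1
      & forall p t, f p t != 0 -> P p t].
Proof.
move=> Pn; have [b bP] := choice (fun t => bump_function (Pn t)).
have bc t : continuous (b t) by have [] := bP t.
have b0 t x : 0 <= b t x by have [_ + _ _] := bP t; exact.
have := Tcompact; rewrite compact_cover => /(_ T setT (fun t => [set x | 0 < b t x])) [].
- move=> t _; apply: (@open_comp _ _ (b t) [set x | 0 < x]); last exact: open_gt.
  by move=> x _; exact: bc.
- by move=> x _; exists x => //=; have [] := bP x.
move=> D _ cov; pose s : seq T := finmap.enum_fset D.
pose S x := \sum_(p <- s) b p x.
have S0 x : 0 < S x.
  have [t /= tD tx] := cov x I; rewrite /S (big_rem t)//=.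
  by rewrite ltr_pwDl// sumr_ge0.
have Sc : continuous S.
  exact: continuous_bigsum.
exists s, (fun p x => b p x / S x); split.
- move=> p x; apply: cvgM; first exact: bc.
  by apply: cvgV; [exact: lt0r_neq0|exact: Sc].
- by move=> p t; rewrite divr_ge0// ltW.
- by move=> t; rewrite -mulr_suml -/(S t) divff// lt0r_neq0.
- move=> p t; have [->|bp _] := eqVneq (b p t) 0; first by rewrite mul0r eqxx.
  by have [_ _ _] := bP p; apply; rewrite lt_def bp b0.
Qed.

End PartitionOfUnity.

Section HahnBanach.
Context {R : realType} {V : normedModType R[i]}.
Implicit Types (p q : V -> R) (x y : V).

Definition sublinear p :=
  (forall x y, p (x + y) <= p x + p y) /\
  (forall (t : R) x, 0 <= t -> p (t%:C%C *: x) = t * p x).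

Lemma sublinear0 p : sublinear p -> p 0 = 0.
Proof. by move=> [_ pZ]; have := pZ 0 0 (lexx _); rewrite scale0r mul0r. Qed.

Lemma sublinear_oppr p x : sublinear p -> - p (- x) <= p x.
Proof.
move=> sp; have [pD _] := sp; have := pD x (- x).
by rewrite subrr (sublinear0 sp) => h; rewrite lerNl -subr_ge0 opprK addrC.
Qed.

(** The infimum of this set is a sublinear minorant of [p] that is pushed down as far as possible in
    the direction [-y]: its value at [-y] is at most [- p y]. *)
Definition shift_set p y x : set R :=
  [set p (x + t%:C%C *: y) - t * p y | t in [set t : R | 0 <= t]].

Definition sublinear_shift p y x : R := inf (shift_set p y x).

Section Shift.
Variables (p : V -> R) (y : V).
Hypothesis sp : sublinear p.

Lemma shift_has_inf x : has_inf (shift_set p y x).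
Proof.
have [pD pZ] := sp; split.
  by exists (p (x + 0%:C%C *: y) - 0 * p y); exists 0 => //=.
exists (- p (- x)) => _ [t /= t0 <-].
have := pD (x + t%:C%C *: y) (- x); rewrite addrAC subrr add0r pZ//; lra.
Qed.

Lemma shift_le t x : 0 <= t ->
  sublinear_shift p y x <= p (x + t%:C%C *: y) - t * p y.
Proof. by move=> t0; apply: ge_inf; [have [] := shift_has_inf x|exists t]. Qed.

Lemma shift_lel x : sublinear_shift p y x <= p x.
Proof. by have := shift_le x (lexx 0); rewrite scale0r addr0 mul0r subr0. Qed.

Lemma sublinear_shiftP : sublinear (sublinear_shift p y).
Proof.
have [pD pZ] := sp; split => [x z|t x].
  apply/ler_addgt0Pl => e e0; have e2 : 0 < e / 2 by rewrite divr_gt0.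
  have [_ [t /= t0 <-] ht] := inf_adherent e2 (shift_has_inf x).
  have [_ [s /= s0 <-] hs] := inf_adherent e2 (shift_has_inf z).
  rewrite (le_trans (shift_le _ (addr_ge0 t0 s0)))// rmorphD scalerDl addrACA.
  have := pD (x + t%:C%C *: y) (z + s%:C%C *: y).
  move: ht hs; rewrite -/(sublinear_shift p y x) -/(sublinear_shift p y z).
  by rewrite mulrDl; lra.
rewrite le_eqVlt => /predU1P[<-|t0].
  rewrite scale0r mul0r; apply/eqP; rewrite eq_le; apply/andP; split.
    by rewrite -(sublinear0 sp) shift_lel.
  apply: lb_le_inf; first by have [] := shift_has_inf 0.
  by move=> _ [s /= s0 <-]; rewrite add0r pZ// subrr.
have half_ (a : R) w : 0 < a -> sublinear_shift p y (a%:C%C *: w) <= a * sublinear_shift p y w.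
  move=> a0; rewrite -ler_pdivrMl//; apply: lb_le_inf; first by have [] := shift_has_inf w.
  move=> _ [s /= s0 <-]; rewrite ler_pdivrMl// mulrBr mulrA -pZ ?(ltW a0)//.
  by rewrite scalerDr scalerA -rmorphM; apply: shift_le; rewrite mulr_ge0// ltW.
apply/eqP; rewrite eq_le half_//= -ler_pdivlMl//.
have := half_ t^-1 (t%:C%C *: x); rewrite scalerA -rmorphM mulVf ?lt0r_neq0// scale1r.
by apply; rewrite invr_gt0.
Qed.

End Shift.

(** Zorn for the reversed pointwise order. Infima over chains are finite since a sublinear minorant
    [q] of [p] satisfies [q x >= - q (- x) >= - p (- x)]. *)
Lemma minimal_sublinear p : sublinear p ->
  exists q, [/\ sublinear q, forall x, q x <= p x &
    forall r, sublinear r -> (forall x, r x <= q x) -> r = q].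
Proof.
move=> sp; pose T := {q : V -> R | sublinear q /\ forall x, q x <= p x}.
pose Rel (q r : T) := `[< forall x, sval r x <= sval q x >].
have inj (q r : T) : sval q = sval r -> q = r.
  by move: q r => [q hq] [r hr] /= qr; subst r; congr exist; exact: Prop_irrelevance.
have [||||q qP] := @Zorn T Rel.
- by move=> t; apply/asboolP.
- by move=> r s t /asboolP rs /asboolP st; apply/asboolP => x; exact: le_trans (rs x).
- move=> s t /asboolP st /asboolP ts; apply/inj/funext => x.
  by apply/eqP; rewrite eq_le st ts.
- move=> C Ctot; have [->|/set0P[c0 Cc0]] := eqVneq C set0.
    by exists (exist _ p (conj sp (fun=> lexx _))).
  pose W x : set R := [set sval c x | c in C].
  have Wi x : has_inf (W x).
    split; first by exists (sval c0 x); exists c0.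
    exists (- p (- x)) => _ [c _ <-]; have [sc cp] := svalP c.
    by rewrite (le_trans _ (sublinear_oppr x sc))// lerN2.
  pose r x := inf (W x).
  have rle c x : C c -> r x <= sval c x.
    by move=> Cc; apply: ge_inf; [have [] := Wi x|exists c].
  have sr : sublinear r.
    split => [x y|t x t0].
      apply/ler_addgt0Pl => e e0; have e2 : 0 < e / 2 by rewrite divr_gt0.
      have [_ [a Ca <-] ha] := inf_adherent e2 (Wi x).
      have [_ [b Cb <-] hb] := inf_adherent e2 (Wi y).
      have [c [Cc ca cb]] : exists c, [/\ C c, forall z, sval c z <= sval a z
          & forall z, sval c z <= sval b z].
        by have [/asboolP ab|/asboolP ba] := Ctot a b Ca Cb; [exists b|exists a].
      have [[cD _] _] := svalP c.
      rewrite (le_trans (rle c _ Cc))// (le_trans (cD _ _))//.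
      have := ca x; have := cb y; move: ha hb; rewrite -/(r x) -/(r y); lra.
    apply/eqP; rewrite eq_le; apply/andP; split.
      move: t0; rewrite [0 <= t]le_eqVlt => /predU1P[<-|t0].
        rewrite scale0r mul0r (le_trans (rle c0 _ Cc0))//.
        by have [/sublinear0 ->] := svalP c0.
      rewrite -ler_pdivrMl//; apply: lb_le_inf; first by have [] := Wi x.
      move=> _ [c Cc <-]; rewrite ler_pdivrMl//.
      by have [[_ cZ] _] := svalP c; rewrite -cZ ?(ltW t0)// rle.
    apply: lb_le_inf; first by have [] := Wi (t%:C%C *: x).
    move=> _ [c Cc <-]; have [[_ cZ] _] := svalP c; rewrite cZ//.
    by rewrite ler_wpM2l// rle.
  have rp x : r x <= p x.
    by rewrite (le_trans (rle c0 x Cc0))//; have [_ ] := svalP c0.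
  by exists (exist _ r (conj sr rp)) => c Cc; apply/asboolP => x; exact: rle.
exists (sval q); have [sq qp] := svalP q; split => // r sr rq.
have rp x : r x <= p x by exact: le_trans (qp x).
by have := qP (exist _ r (conj sr rp)) => /(_ _)/(congr1 sval)/= -> //; apply/asboolP.
Qed.

(* A minimal sublinear functional is linear, since it equals its shifts. *)
Lemma real_functional_norming (x0 : V) : exists f : V -> R,
  [/\ forall x y, f (x + y) = f x + f y, forall (t : R) x, f (t%:C%C *: x) = t * f x,
      forall x, f x <= rn x & f x0 = rn x0].
Proof.
have sn : sublinear (rn : V -> R).
  by split => [x y|t x t0]; [exact: rnD|rewrite rnZr ger0_norm].
(* Starting below the shift of the norm by [x0], and not below the norm itself, forces
   [q (- x0) <= - rn x0], which gives the norming property. *)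
have [q [sq qn qmin]] := minimal_sublinear (sublinear_shiftP x0 sn).
have qD x y : q (x + y) = q x + q y.
  apply/eqP; rewrite eq_le sq.1/= -lerBrDr.
  have e := qmin _ (sublinear_shiftP y sq) (shift_lel y sq).
  rewrite -{1}e; have := shift_le y sq x ler01.
  by rewrite scale1r mul1r.
have qN x : q (- x) = - q x.
  by apply/eqP; rewrite -addr_eq0 -qD addNr (sublinear0 sq).
exists q; split => //.
- move=> t x; have [t0|t0] := leP 0 t; first exact: sq.2.
  rewrite -[t]opprK rmorphN scaleNr qN sq.2 ?mulNr//.
  by rewrite oppr_ge0 ltW.
- by move=> x; rewrite (le_trans (qn x))// shift_lel.
- apply/eqP; rewrite eq_le (le_trans (qn x0)) ?shift_lel//=.
  rewrite -lerN2 -qN (le_trans (qn _))//.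
  have := shift_le x0 sn (- x0) ler01.
  by rewrite scale1r addNr rn0 sub0r mul1r.
Qed.

(** The complex-linear functional with real part [f]. *)
Let real_to_complex_functional (f : V -> R) (x : V) : R[i]^o :=
  Complex (f x) (- f ('i%C *: x)).

Lemma functionals_separate (v : V) :
  (forall phi : {linear V -> R[i]^o}, continuous phi -> phi v = 0) -> v = 0.
Proof.
move=> h; have [f [fD fZ fn fv]] := real_functional_norming v.
have f0 : f 0 = 0 by have := fZ 0 0; rewrite scale0r mul0r.
have fN x : f (- x) = - f x.
  by rewrite -[- x]scale1r scalerN -scaleNr -[-1](rmorphN (real_complex R) 1) fZ mulN1r.
have fB x y : f (x - y) = f x - f y by rewrite fD fN.
have fa x : `|f x| <= rn x by rewrite ler_norml fn andbT lerNl -fN -(rnN x) fn.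
pose F := real_to_complex_functional f.
have Flin : linear F.
  move=> [a b] x y; rewrite /F /real_to_complex_functional.
  have e1 : Complex a b *: x = a%:C%C *: x + b%:C%C *: ('i%C *: x).
    by rewrite scalerA -scalerDl; congr (_ *: _); rewrite [LHS]complexE mulrC.
  have e2 : 'i%C *: (Complex a b *: x) = a%:C%C *: ('i%C *: x) - b%:C%C *: x.
    rewrite e1 scalerDr !scalerA -scaleNr [_ * 'i%C in X in _ + X]mulrC.
    by rewrite mulrA -expr2 sqr_i mulN1r mulrC.
  rewrite scalerDr e2 e1 !fD fN !fZ.
  by apply/eqP; rewrite eq_complex /=; apply/andP; split; apply/eqP; ring.
pose FF : {linear V -> R[i]^o} := HB.pack_for {linear V -> R[i]^o} F
  (GRing.isLinear.Build R[i] V R[i]^o _ F Flin).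
have FC : continuous FF.
  move=> x; apply/(@rn_cvgP R R[i]^o) => e e0; apply/rn_nbhsP.
  exists (e / 2); first by rewrite divr_gt0.
  move=> y yx; rewrite -raddfB; set w := y - x.
  have : rn (FF w) <= rn w + rn w; last by move: yx; rewrite -/w; lra.
  rewrite /rn normc_def /= sqrrN.
  rewrite -[leRHS]ger0_norm ?addr_ge0 ?rn_ge0// -sqrtr_sqr ler_wsqrtr//.
  have := fa w; have := fa ('i%C *: w); rewrite rnZi.
  rewrite !ler_norml => /andP[a1 a2] /andP[b1 b2]; rewrite -/(rn w); nra.
have := h FF FC; rewrite /= /F /real_to_complex_functional => -[fv0 _].
by apply: rn_eq0; rewrite -fv.
Qed.

End HahnBanach.

(** * Integration over the group *)

Section HaarIntegral.
Context {R : realType} {G : topGroupType}.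
Hypothesis Gcompact : compact [set: G].
Variable mu : probability (borel G) R.
Implicit Types f g : G -> R.

Definition mint f : R := Rintegral mu [set: borel G] f.

Lemma continuous_borel_measurable f : continuous f ->
  measurable_fun [set: borel G] (f : borel G -> R).
Proof.
move=> fc mD; apply: (measurability _ (measurable_realfun.RGenOInfty.measurableE R)) => //.
move=> /= _ [_ [x ->] <-]; apply: measurableI => //.
apply: sub_sigma_algebra => /=.
rewrite (_ : _ @^-1` _ = f @^-1` [set y | x < y]); last first.
  by apply/seteqP; split => y /=; rewrite in_itv /= andbT.
by apply: open_comp => //; exact: open_gt.
Qed.

Lemma continuous_bounded f : continuous f -> exists M : R, forall x, `|f x| <= M.
Proof.
move=> fc; have cf : compact (f @` setT).
  by apply: continuous_compact => //; exact: continuous_subspaceT.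
have [M [_ MP]] := compact_bounded cf.
by exists (M + 1) => x; apply: (MP (M + 1)); rewrite ?ltrDl//; exists x.
Qed.

Lemma continuous_borel_integrable f : continuous f ->
  mu.-integrable [set: borel G] (EFin \o f).
Proof.
move=> fc; apply: measurable_bounded_integrable => //.
- have e : mu [set: borel G] = 1%E := probability_setT mu.
  by rewrite [ltLHS]e ltry.
- exact: continuous_borel_measurable.
- have [M fM] := continuous_bounded fc.
  by exists M; split; rewrite ?num_real// => x Mx y _; exact: le_trans (fM y) (ltW Mx).
Qed.

Lemma mintD f g : continuous f -> continuous g ->
  mint (fun x => f x + g x) = mint f + mint g.
Proof. by move=> fc gc; rewrite /mint RintegralD//; exact: continuous_borel_integrable. Qed.

Lemma mintZ (c : R) f : continuous f -> mint (fun x => c * f x) = c * mint f.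
Proof. by move=> fc; rewrite /mint RintegralZl//; exact: continuous_borel_integrable. Qed.

Lemma mint_cst (c : R) : mint (fun=> c) = c.
Proof.
have e : mu [set: borel G] = 1%E := probability_setT mu.
by rewrite /mint Rintegral_cst// [X in fine X]e mulr1.
Qed.

Lemma mint_le f g : continuous f -> continuous g -> (forall x, f x <= g x) ->
  mint f <= mint g.
Proof.
by move=> fc gc fg; apply: le_Rintegral => //; exact: continuous_borel_integrable.
Qed.

Lemma mint_sum (I : Type) (r : seq I) (F : I -> G -> R) :
  (forall i, continuous (F i)) ->
  mint (fun x => \sum_(i <- r) F i x) = \sum_(i <- r) mint (F i).
Proof.
move=> Fc; elim: r => [|i r IH].
  rewrite big_nil -[RHS](mint_cst 0); congr mint.
  by apply/funext => x; rewrite big_nil.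
rewrite big_cons -IH -mintD//; last exact: continuous_bigsum.
by congr mint; apply/funext => x; rewrite big_cons.
Qed.

Lemma mint_norm_le f (c : R) : continuous f -> (forall x, `|f x| <= c) ->
  `|mint f| <= c.
Proof.
move=> fc fle; have cc (d : R) : continuous (fun _ : G => d) by move=> x; exact: cvg_cst.
have h x : - c <= f x <= c by rewrite -ler_norml.
rewrite ler_norml; apply/andP; split.
  by rewrite -(mint_cst (- c)); apply: mint_le => // x; have /andP[] := h x.
by rewrite -[leRHS](mint_cst c); apply: mint_le => // x; have /andP[] := h x.
Qed.

Lemma mulg_continuousl (g : G) : continuous (fun x : G => (g * x)%g).
Proof.
move=> x; have c1 : (g, y) @[y --> x] --> (g, x).
  by apply: cvg_pair; [exact: cvg_cst|exact: cvg_id].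
exact: (cvg_comp _ _ c1 (@mulg_continuous G (g, x))).
Qed.

Lemma mint_translate (g : G) f : normalized_haar mu -> continuous f ->
  mint (fun x => f (g * x)%g) = mint f.
Proof.
move=> haar fc; pose phi (x : borel G) : borel G := (g * x : G)%g.
have mphi : measurable_fun [set: borel G] phi.
  apply: (@measurability _ _ (borel G) (borel G) _ phi (@open G)) => //.
  move=> _ [U Uo <-]; rewrite setTI; apply: sub_sigma_algebra.
  by apply: open_comp => // x _; exact: mulg_continuousl.
(* The preimage of [B] under left multiplication by [g] is the translate of [B] by [g^-1], to which
   invariance applies. *)
have muE (B : set (borel G)) : measurable B -> pushforward mu phi B = mu B.
  move=> mB; rewrite /pushforward -(haar g^-1%g _ mB); congr (mu _).
  apply/seteqP; split => x /=.
    by move=> Bx; exists (g * x : G)%g => //; rewrite mulKg.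
  by move=> [y By <-]; rewrite /phi mulVKg.
rewrite /mint /Rintegral; congr fine.
have fm : measurable_fun [set: borel G] (fun x : borel G => (f x)%:E).
  by apply/measurable_EFinP; exact: continuous_borel_measurable.
have fphi : mu.-integrable (phi @^-1` setT) ((fun x : borel G => (f x)%:E) \o phi).
  rewrite preimage_setT; apply: (@continuous_borel_integrable (fun x => f (g * x)%g)).
  by move=> x; apply: continuous_comp; [exact: mulg_continuousl|exact: fc].
have := integral_pushforward mphi fm fphi measurableT.
rewrite preimage_setT => <-.
by apply: eq_measure_integral => B mB _; exact: muE.
Qed.

End HaarIntegral.

Section VectorIntegral.
Context {R : realType} {G : topGroupType}.
Hypotheses (Ghaus : hausdorff_space G) (Gcompact : compact [set: G]).
Variable mu : probability (borel G) R.

(** Both terms are integrals, of [sum_p f_p h(p)] and of [h = sum_p f_p h]; at each point the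
    integrands differ by a convex combination of differences [h p - h t] with [f p t] nonzero. *)
Lemma riemann_approximation (s : seq G) (f : G -> G -> R) (h : G -> R) (c : R) :
  (forall p, continuous (f p)) -> (forall p t, 0 <= f p t) ->
  (forall t, \sum_(p <- s) f p t = 1) -> continuous h ->
  (forall p t, f p t != 0 -> `|h p - h t| <= c) ->
  `|\sum_(p <- s) mint mu (f p) * h p - mint mu h| <= c.
Proof.
move=> fc f0 f1 hc hp.
have e1 : \sum_(p <- s) mint mu (f p) * h p =
    mint mu (fun x => \sum_(p <- s) h p * f p x).
  rewrite (mint_sum Gcompact)//; last first.
    by move=> p x; apply: cvgM; [exact: cvg_cst|exact: fc].
  by apply: eq_bigr => p _; rewrite mintZ// mulrC.
have sc : continuous (fun x => \sum_(p <- s) h p * f p x).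
  by apply: continuous_bigsum => p x; apply: cvgM; [exact: cvg_cst|exact: fc].
have hN : continuous (fun x => -1 * h x).
  by move=> x; apply: cvgM; [exact: cvg_cst|exact: hc].
have -> : - mint mu h = mint mu (fun x => -1 * h x) by rewrite mintZ// mulN1r.
rewrite e1 -mintD//; apply: mint_norm_le => //.
  by move=> x; apply: cvgD; [exact: sc|exact: hN].
move=> x; rewrite mulN1r -[h x]mulr1 -(f1 x) mulr_sumr -sumrB.
have -> : c = \sum_(p <- s) c * f p x by rewrite -mulr_sumr f1 mulr1.
rewrite (le_trans (ler_norm_sum _ _ _))//; apply: ler_sum => p _.
rewrite -mulrBl normrM (ger0_norm (f0 p x)).
by have [->|/hp] := eqVneq (f p x) 0; [rewrite !mulr0|exact: ler_wpM2r].
Qed.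

Lemma continuous_real_dominated (V : normedModType R[i]) (F : G -> V) (f : V -> R) (K : R) :
  0 <= K -> (forall x y, `|f x - f y| <= K * rn (x - y)) -> continuous F ->
  continuous (fun t => f (F t)).
Proof.
move=> K0 fK Fc t; apply/cvgrPdist_lt => e e0.
have K1 : 0 < K + 1 by rewrite ltr_wpDl.
have /rn_cvgP/(_ (e / (K + 1))) := Fc t; rewrite divr_gt0// => /(_ isT).
apply: filterS => x; rewrite ltr_pdivlMr// => xe.
rewrite (le_lt_trans (fK _ _))// rnBC (le_lt_trans _ xe)// mulrC.
by rewrite ler_wpM2l ?rn_ge0// lerDl.
Qed.

Lemma linear_functional_bounded (V W : normedModType R[i]) (phi : {linear V -> W}) :
  continuous phi -> exists2 K : R, 0 <= K & forall x, rn (phi x) <= K * rn x.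
Proof.
move=> pc; have /rn_cvgP/(_ 1 ltr01)/rn_nbhsP[d d0 dP] := pc 0.
exists (2 / d) => [|x]; first by rewrite divr_ge0// ltW.
have [x0|x0] := eqVneq (rn x) 0.
  by rewrite (rn_eq0 x0) raddf0 !rn0 mulr0.
have xp : 0 < rn x by rewrite lt_def x0 rn_ge0.
have := dP ((d / 2 / rn x)%:C%C *: x); rewrite subr0 raddf0 subr0 linearZ !rnZr.
rewrite gtr0_norm ?divr_gt0// divfK// => /(_ _)/ltW h.
have : d / 2 / rn x * rn (phi x) <= 1 by apply: h; lra.
rewrite mulrAC ler_pdivrMr// mul1r -ler_pdivlMl ?divr_gt0//.
by rewrite invf_div.
Qed.

Variable A : cstarAlgType R.
Implicit Types F : G -> A.

Lemma rn_near_point (T : topologicalType) (V : normedModType R[i]) (F : T -> V)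
    (t : T) (e : R) : continuous F -> 0 < e -> nbhs t [set x | rn (F x - F t) < e].
Proof. by move=> Fc e0; have /rn_cvgP/(_ e e0) := Fc t. Qed.

Lemma dyadic_gt0 n : 0 < (2 : R) ^- n.
Proof. by rewrite invr_gt0 exprn_gt0. Qed.

(** The integral is the limit of Riemann sums over partitions of unity of fineness [2^-n]. All
    comparisons are reduced to scalar integrals by functionals, so no vector-valued measure theory
    enters. *)
Lemma vintegral_exists F : continuous F -> exists v, is_vintegral mu F v.
Proof.
move=> Fc; pose e n := (2 : R) ^- n.
have en n : 0 < e n := dyadic_gt0 n.
have part n := @partition_of_unity R G Ghaus Gcompact
  (fun t => [set x | rn (F x - F t) < e n])
  (fun t => rn_near_point t Fc (en n)).
have {part}[s sP] := choice part; have {sP}[f fP] := choice sP.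
pose S n := \sum_(p <- s n) (mint mu (f n p))%:C%C *: F p.
have approx n (h : A -> R) (K : R) : 0 <= K -> (forall x y, `|h x - h y| <= K * rn (x - y)) ->
    `|\sum_(p <- s n) mint mu (f n p) * h (F p) - mint mu (fun t => h (F t))| <= K * e n.
  move=> K0 hK; have [f1 f2 f3 f4] := fP n.
  apply: (riemann_approximation (h := fun t => h (F t))) => //.
    exact: continuous_real_dominated hK Fc.
  by move=> p t /f4 /= tp; rewrite (le_trans (hK _ _))// ler_wpM2l// rnBC ltW.
(* The difference of two Riemann sums is tested on a functional norming it; both values are then
   close to the same scalar integral. *)
have S_dist n m : rn (S n - S m) <= e n + e m.
  have [h [hD hZ hn hv]] := real_functional_norming (S n - S m).
  have h0 : h 0 = 0 by have := hZ 0 0; rewrite scale0r mul0r.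
  have hN x : h (- x) = - h x by apply/eqP; rewrite -addr_eq0 -hD addNr h0.
  have hK x y : `|h x - h y| <= 1 * rn (x - y).
    by rewrite -hN -hD mul1r ler_norml hn andbT lerNl -hN -(rnN (x - y)) hn.
  have hS k : h (S k) = \sum_(p <- s k) mint mu (f k p) * h (F p).
    by rewrite (big_morph h hD h0); apply: eq_bigr => p _; rewrite hZ.
  have := approx n h 1 ler01 hK; have := approx m h 1 ler01 hK.
  by rewrite -!hS -hv hD hN !mul1r !ler_norml; lra.
(* [e n + e n.+1] is [3/2 * e n], below the decrement [2 * e n] of [4 * e n]. *)
have [||v [_ vS]] := @telescoping_cvg R A S (fun n => - (4 * e n)) 0.
- move=> n; rewrite (le_trans (S_dist _ _))// /e exprS invfM.
  by have := en n; rewrite /e; lra.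
- by move=> n; rewrite oppr_le0 mulr_ge0// ltW.
exists v => phi phic; have [K K0 phiK] := linear_functional_bounded phic.
have real_eq (h : R[i]^o -> R) : (forall x y, `|h x - h y| <= rn (x - y)) ->
    (forall x y, h (x + y) = h x + h y) -> (forall (t : R) x, h (t%:C%C *: x) = t * h x) ->
    h (phi v) = mint mu (fun t => h (phi (F t))).
  move=> hK hD hZ; have h0 : h 0 = 0 by have := hZ 0 0; rewrite scale0r mul0r.
  apply/eqP; rewrite -subr_eq0 -normr_le0; apply/ler_addgt0Pl => d d0; rewrite addr0.
  (* 5 = 4 + 1: the distance from [v] to [S n], and the Riemann error of [S n]. *)
  have [n nd] : exists n, 5 * K * e n <= d.
    have c0 : (fun n => 5 * K * (2^-1 : R) ^+ n) @ \oo --> 5 * K * 0.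
      apply: cvgM; first exact: cvg_cst.
      by apply: cvg_expr; rewrite ger0_norm// invf_lt1// ltr1n.
    rewrite mulr0 in c0; have /cvgr0Pnorm_le/(_ d d0)[N _ NP] := c0.
    exists N; have := NP N (leqnn _); apply: le_trans.
    by rewrite /= exprVn ler_norm.
  have hpK x y : `|h (phi x) - h (phi y)| <= K * rn (x - y).
    by rewrite (le_trans (hK _ _))// -raddfB phiK.
  have hS : h (phi (S n)) = \sum_(p <- s n) mint mu (f n p) * h (phi (F p)).
    have hpD x y : h (phi (x + y)) = h (phi x) + h (phi y) by rewrite raddfD hD.
    have hp0 : h (phi 0) = 0 by rewrite raddf0 h0.
    rewrite (big_morph (fun x => h (phi x)) hpD hp0); apply: eq_bigr => p _.
    by rewrite linearZ hZ.
  have := approx n (fun x => h (phi x)) K K0 hpK; rewrite -hS.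
  have := hpK v (S n); have := vS n; rewrite sub0r opprK => v1 v2 v3.
  have v4 : K * rn (v - S n) <= K * (4 * e n) by rewrite ler_wpM2l.
  move: v2 v3; rewrite !ler_norml => /andP[? ?] /andP[? ?].
  by apply/andP; split; lra.
apply/eqP; rewrite eq_complex /=; apply/andP; split; apply/eqP.
- apply: (real_eq (@complex.Re R)).
  + move=> x y; rewrite -lecR -rnE -raddfB; exact: normc_ge_Re.
  + by case=> a b [c d].
  + by move=> t [a b] /=; rewrite mul0r subr0.
- apply: (real_eq (@complex.Im R)).
  + by move=> x y; rewrite -raddfB /rn normc_def /= -sqrtr_sqr ler_wsqrtr// lerDr sqr_ge0.
  + by case=> a b [c d].
  + by move=> t [a b] /=; rewrite mul0r addr0.
Qed.

Lemma vintegralE F v : is_vintegral mu F v -> vintegral mu F = v.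
Proof.
move=> Fv; have Fi : is_vintegral mu F (vintegral mu F).
  by apply: (@xgetPex _ 0 [set v | is_vintegral mu F v]); exists v.
apply/eqP; rewrite -subr_eq0; apply/eqP/functionals_separate => phi phic.
rewrite raddfB; apply/eqP; rewrite subr_eq0; apply/eqP.
exact: etrans (Fi phi phic) (esym (Fv phi phic)).
Qed.

Lemma vintegral_map (T : A -> A) F v : linear T -> continuous T ->
  is_vintegral mu F v -> is_vintegral mu (fun x => T (F x)) (T v).
Proof.
move=> Tlin Tc Fv phi phic.
have Clin : linear (fun x => phi (T x) : R[i]^o).
  by move=> c x y; rewrite Tlin linearP.
pose psi : {linear A -> R[i]^o} := HB.pack_for {linear A -> R[i]^o} (fun x => phi (T x))
  (GRing.isLinear.Build R[i] A R[i]^o _ (fun x => phi (T x)) Clin).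
apply: (Fv psi) => x; apply: continuous_comp; [exact: Tc|exact: phic].
Qed.

End VectorIntegral.

Lemma compact_eventually (T : topologicalType) (P : nat -> T -> Prop) :
  compact [set: T] ->
  (forall t : T, exists2 U : set T, nbhs t U &
     \forall n \near \oo, forall x, U x -> P n x) ->
  \forall n \near \oo, forall x, P n x.
Proof.
move=> /compact_near_coveringP cT loc.
have := cT nat \oo (fun n x => P n x) _ => /(_ _)[].
  move=> x _; have [U Ux [N _ NP]] := loc x.
  exists (U, [set n | (N <= n)%N]); first by split => //=; exists N.
  by move=> [y n] [/= Uy Nn]; exact: NP.
by move=> N _ NP; exists N => // n Nn x; exact: NP.
Qed.

Lemma near_all_seq (I : eqType) (T : Type) (F : set_system T) (FF : Filter F)
    (s : seq I) (P : I -> T -> Prop) :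
  (forall i, i \in s -> \forall x \near F, P i x) ->
  \forall x \near F, forall i, i \in s -> P i x.
Proof.
elim: s => [|i s IH] h; first exact: filterE.
have h1 := h i (mem_head _ _).
have h2 : \forall x \near F, forall j, j \in s -> P j x.
  by apply: IH => j js; apply: h; rewrite in_cons js orbT.
by apply: filterS2 h1 h2 => x xi xs j; rewrite in_cons => /predU1P[->|/xs].
Qed.

(** * Actions and lifts of the Rokhlin homomorphism *)

Section ActionNorm.
Context {R : realType} {A : cstarAlgType R} {G : topGroupType}.
Variable alpha : cstar_action G A.
Implicit Types (a b x y : A) (g : G).

Lemma alphaK g a : alpha g (alpha g^-1%g a) = a.
Proof. by rewrite -actM mulgV act1. Qed.

Lemma alphaVK g a : alpha g^-1%g (alpha g a) = a.
Proof. by rewrite -actM mulVg act1. Qed.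

Lemma alphaM g a b : alpha g (a ** b) = alpha g a ** alpha g b.
Proof. exact: (star_homM (act_hom alpha g)). Qed.

Lemma alphaD g a b : alpha g (a + b) = alpha g a + alpha g b.
Proof. exact: (star_homD (act_hom alpha g)). Qed.

Lemma alphaB g a b : alpha g (a - b) = alpha g a - alpha g b.
Proof. exact: (star_homB (act_hom alpha g)). Qed.

Lemma alphaZ g (c : R[i]) a : alpha g (c *: a) = c *: alpha g a.
Proof. exact: (star_homZ (act_hom alpha g)). Qed.

Lemma alphaS g a : alpha g (star a) = star (alpha g a).
Proof. exact: (star_homS (act_hom alpha g)). Qed.

Lemma alpha0 g : alpha g 0 = 0.
Proof. exact: (star_hom0 (act_hom alpha g)). Qed.

Lemma alpha_sum g (I : Type) (r : seq I) (F : I -> A) :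
  alpha g (\sum_(i <- r) F i) = \sum_(i <- r) alpha g (F i).
Proof. exact: (star_hom_sum (act_hom alpha g)). Qed.

Lemma rn_alpha g a : rn (alpha g a) = rn a.
Proof.
apply/eqP; rewrite eq_le (star_hom_contractive (act_hom alpha g))/=.
by rewrite -{1}(alphaVK g a) (star_hom_contractive (act_hom alpha g^-1%g)).
Qed.

Lemma alpha_continuous g : continuous (alpha g).
Proof. exact: star_hom_continuous (act_hom alpha g). Qed.

Lemma alpha_near g0 a (e : R) : 0 < e ->
  nbhs g0 [set g | rn (alpha g a - alpha g0 a) < e].
Proof. by move=> e0; exact: (rn_near_point g0 (@act_continuous _ _ _ alpha a) e0). Qed.

Hypothesis Gcompact : compact [set: G].
Variable e : nat -> A.
Hypotheses (e_star : forall n, star (e n) = e n) (e_le1 : forall n, rn (e n) <= 1)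
  (e_unit : forall a, e n ** a @[n --> \oo] --> a).

Lemma unit_uniform a (d : R) : 0 < d ->
  \forall n \near \oo, forall g, rn (e n ** alpha g a - alpha g a) <= d.
Proof.
move=> d0; apply: compact_eventually => // g0.
have d3 : 0 < d / 3 by rewrite divr_gt0.
exists [set g | rn (alpha g a - alpha g0 a) < d / 3]; first exact: alpha_near.
have /(rn_cvgP _)/(_ _ d3) := @e_unit (alpha g0 a).
apply: filterS => n h g /= gg0.
have -> : e n ** alpha g a - alpha g a = e n ** (alpha g a - alpha g0 a) +
   ((e n ** alpha g0 a - alpha g0 a) - (alpha g a - alpha g0 a)).
  by rewrite amulBr; zmod.
have h1 : rn (e n ** (alpha g a - alpha g0 a)) <= 1 * rn (alpha g a - alpha g0 a).
  exact: rnM_leLHS.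
rewrite (le_trans (rnD _ _))//.
have := rnB (e n ** alpha g0 a - alpha g0 a) (alpha g a - alpha g0 a); lra.
Qed.

(** Each member acts almost as a unit on the orbits of all members after it. The differences
    [x - alpha g x] are then almost orthogonal, so a sum of [N] of them grows only like [sqrt N] and
    the mean of the chain is almost invariant, with no integration over the group. *)
Fixpoint unit_chain (d : R) (m : nat) (s : seq A) : Prop :=
  if s is x :: s' then
    [/\ exists2 n, (m <= n)%N & x = e n,
        forall y, y \in s' -> forall g, rn (x ** alpha g y - alpha g y) <= d
      & unit_chain d m s']
  else True.

Lemma unit_chain_exists (d : R) (m N : nat) : 0 < d ->
  exists2 s, size s = N & unit_chain d m s.
Proof.
move=> d0; elim: N => [|N [s sN sc]]; first by exists [::].
have [n0 _ n0P] : \forall n \near \oo, forall y, y \in s ->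
    forall g, rn (e n ** alpha g y - alpha g y) <= d.
  by apply: near_all_seq => y _; exact: unit_uniform.
exists (e (n0 + m)%N :: s); first by rewrite /= sN.
split => //; first by exists (n0 + m)%N => //; exact: leq_addl.
by apply: n0P => /=; exact: leq_addr.
Qed.

Lemma unit_chain_mem d m s x : unit_chain d m s -> x \in s ->
  exists2 n, (m <= n)%N & x = e n.
Proof.
by elim: s => //= y s IH [yn _ sc]; rewrite in_cons => /predU1P[->|/(IH sc)].
Qed.

Let w g x := x - alpha g x.

(** Expanding the product, [x] and [alpha g x] both act as approximate units on [y] and on
    [alpha g y], whence [(y - alpha g y) - (y - alpha g y) = 0] up to four errors. *)
Lemma unit_chain_orthogonal (d : R) g x y :
  (forall g, rn (x ** alpha g y - alpha g y) <= d) -> rn (w g x ** w g y) <= 4 * d.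
Proof.
move=> xy; have -> : w g x ** w g y =
    (x ** alpha 1%g y - alpha 1%g y) - (x ** alpha g y - alpha g y)
    - alpha g (x ** alpha g^-1%g y - alpha g^-1%g y)
    + alpha g (x ** alpha 1%g y - alpha 1%g y).
  rewrite /w !alphaB !alphaM !alphaK !act1 amulBl !amulBr; zmod.
have h1 := xy 1%g; have h2 := xy g.
have h3 := xy g^-1%g; rewrite -(rn_alpha g) in h3.
have h4 := h1; rewrite -(rn_alpha g) in h4.
rewrite (le_trans (rnD _ _))// (le_trans (lerD (le_trans (rnB _ _) (lerD (rnB _ _) (lexx _))) (lexx _)))//.
by rewrite (_ : 4 * d = d + d + d + d); [rewrite !lerD|ring].
Qed.

Lemma unit_chain_sum_le (d : R) m s g : 0 <= d -> unit_chain d m s ->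
  rn (\sum_(x <- s) w g x) ^+ 2 <= (size s)%:R * (4 + 8 * d * (size s)%:R).
Proof.
move=> d0; elim: s => [_|x s IH [[n _ xn] xs sc]].
  by rewrite big_nil rn0 expr0n mul0r.
have {}IH := IH sc; rewrite big_cons; set T := \sum_(y <- s) w g y.
rewrite -/T in IH.
have ws n' : star (w g (e n')) = w g (e n') by rewrite /w starB -alphaS e_star.
have Ts : star T = T.
  rewrite /T star_sum !big_seq.
  apply: eq_bigr => y /(unit_chain_mem sc)[n' _ ->]; exact: ws.
have xs' : star x = x by rewrite xn.
have wx : star (w g x) = w g x by rewrite xn.
have w2 : rn (w g x) <= 2.
  by rewrite /w (le_trans (rnB _ _))// rn_alpha xn; have := e_le1 n; lra.
rewrite -rnC starD wx Ts amulDl !(amulDr _ (w g x)).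
have ww : rn (w g x ** w g x) <= 4.
  by rewrite (le_trans (rnM _ _))//; have := rn_ge0 (w g x); nra.
have wT : rn (w g x ** T) <= (size s)%:R * (4 * d).
  rewrite amul_sumr.
  by apply: rn_sum_le_size => y ys; apply: unit_chain_orthogonal; exact: xs.
have Tw : rn (T ** w g x) <= (size s)%:R * (4 * d).
  by rewrite -rn_star starM wx Ts.
have TT : rn (T ** T) = rn T ^+ 2 by rewrite -{1}Ts rnC.
have h1 := rnD (w g x ** w g x + w g x ** T) (T ** w g x + T ** T).
have h2 := rnD (w g x ** w g x) (w g x ** T).
have h3 := rnD (T ** w g x) (T ** T).
rewrite /= -natr1 (le_trans h1)//.
have s0 : 0 <= (size s)%:R :> R by [].
nra.
Qed.

Lemma averaged_unit (eps : R) (m : nat) : 0 < eps ->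
  exists x, [/\ star x = x, rn x <= 1, forall g, rn (alpha g x - x) <= eps
    & forall a c, (forall n, (m <= n)%N -> rn (e n ** a - a) <= c) -> rn (x ** a - a) <= c].
Proof.
(* With [d = 1 / (2 N)] the square of the summed differences is at most [8 N], and [8 <= N * eps^2]
   makes this at most [(N * eps)^2]. *)
move=> e0; pose N := (Num.bound (8 / eps ^+ 2)).+1.
have N0 : 0 < N%:R :> R by rewrite ltr0n.
have Ne : 8 <= N%:R * eps ^+ 2.
  rewrite -ler_pdivrMr ?exprn_gt0// ltW//.
  rewrite (lt_trans (archi_boundP (divr_ge0 (ler0n R 8) (sqr_ge0 eps))))//.
  by rewrite ltr_nat.
pose d : R := (2 * N%:R)^-1; have d0 : 0 < d by rewrite invr_gt0 mulr_gt0.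
have [s sN sc] := unit_chain_exists m N d0.
have norm1 (z : A) : rn (N%:R^-1%:C%C *: z) = rn z / N%:R.
  by rewrite rnZr ger0_norm ?invr_ge0 ?ltW// mulrC.
have scaleN (z : A) : N%:R^-1%:C%C *: \sum_(y <- s) z = z.
  rewrite big_const_seq count_predT sN iter_addr_0 -[z *+ N]scaler_nat scalerA.
  rewrite -[RHS]scale1r; congr (_ *: _).
  by rewrite -(rmorph_nat (real_complex R)) -rmorphM mulVf ?lt0r_neq0.
exists (N%:R^-1%:C%C *: \sum_(y <- s) y); split.
- rewrite starZr star_sum !big_seq.
  by congr (_ *: _); apply: eq_bigr => y /(unit_chain_mem sc)[n _ ->]; exact: e_star.
- rewrite norm1 ler_pdivrMr// mul1r -sN -[X in _ <= X]mulr1.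
  by apply: rn_sum_le_size => y /(unit_chain_mem sc)[n _ ->]; exact: e_le1.
- move=> g; rewrite alphaZ alpha_sum -scalerBr -sumrB norm1 ler_pdivrMr//.
  rewrite -rnN -sumrN.
  have -> : \sum_(y <- s) - (alpha g y - y) = \sum_(y <- s) w g y.
    by apply: eq_bigr => y _; rewrite opprB.
  rewrite -(@ler_pXn2r _ 2) ?nnegrE ?rn_ge0 ?mulr_ge0 ?(ltW e0) ?(ltW N0)//.
  rewrite (le_trans (unit_chain_sum_le _ (ltW d0) sc))// sN /d.
  have -> : 8 * (2 * N%:R)^-1 * N%:R = 4 :> R by field; exact: lt0r_neq0.
  by rewrite exprMn; nra.
- move=> a c ac; rewrite -{2}(scaleN a) amulZl -scalerBr.
  rewrite amul_suml.
  rewrite -sumrB norm1 ler_pdivrMr// mulrC -sN.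
  by apply: rn_sum_le_size => y /(unit_chain_mem sc)[n mn ->]; exact: ac.
Qed.

End ActionNorm.

Section NullSequences.
Context {R : realType} {A : cstarAlgType R}.
Implicit Types (u v : nat -> A).

Definition nul u := forall e : R, 0 < e -> \forall n \near \oo, rn (u n) < e.

Lemma nulE u : u n @[n --> \oo] --> (0 : A) <-> nul u.
Proof.
by split=> [/(rn_cvgP _) h e /h|h]; [|apply/rn_cvgP => e /h]; apply: filterS => n;
  rewrite subr0.
Qed.

Lemma eq_nul u v : (forall n, u n = v n) -> nul u -> nul v.
Proof. by move=> uv un e /un; apply: filterS => n; rewrite uv. Qed.

Lemma nul0 : nul (fun=> 0).
Proof. by move=> e e0; apply: nearW => n; rewrite rn0. Qed.

Lemma nul_le u v (M : R) : 0 <= M -> (forall n, rn (v n) <= M * rn (u n)) ->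
  nul u -> nul v.
Proof.
move=> M0 vu un e e0; have M1 : 0 < M + 1 by rewrite ltr_wpDl.
have := un (e / (M + 1)); rewrite divr_gt0// => /(_ isT); apply: filterS => n.
rewrite ltr_pdivlMr// => h; rewrite (le_lt_trans (vu n))// (le_lt_trans _ h)//.
by rewrite mulrC ler_wpM2l ?rn_ge0// lerDl.
Qed.

Lemma nulD u v : nul u -> nul v -> nul (fun n => u n + v n).
Proof.
move=> un vn e e0; have e2 : 0 < e / 2 by rewrite divr_gt0.
near=> n; rewrite (le_lt_trans (rnD _ _))// [e]splitr ltrD//.
  by near: n; exact: un.
by near: n; exact: vn.
Unshelve. all: by end_near. Qed.

Lemma nulN u : nul u -> nul (fun n => - u n).
Proof. by move=> un e /un; apply: filterS => n; rewrite rnN. Qed.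

Lemma nulB u v : nul u -> nul v -> nul (fun n => u n - v n).
Proof. by move=> un vn; apply: nulD => //; exact: nulN. Qed.

Lemma nulBC u v : nul (fun n => u n - v n) -> nul (fun n => v n - u n).
Proof. by move=> /nulN; apply: eq_nul => n; rewrite opprB. Qed.

Lemma nul_trans v u w : nul (fun n => u n - v n) -> nul (fun n => v n - w n) ->
  nul (fun n => u n - w n).
Proof. by move=> h1 h2; apply: eq_nul (nulD h1 h2) => n; rewrite subrKA. Qed.

Lemma nulZ (c : R[i]) u : nul u -> nul (fun n => c *: u n).
Proof.
apply: (@nul_le _ _ (complex.Re `|c|)); last by move=> n; rewrite rnZ.
by have := normr_ge0 c; rewrite lecE => /andP[].
Qed.

Lemma nul_star u : nul u -> nul (fun n => star (u n)).
Proof. by move=> un e /un; apply: filterS => n; rewrite rn_star. Qed.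

Definition bnd u := exists2 M : R, 0 <= M & forall n, rn (u n) <= M.

Lemma nulMl v u : bnd v -> nul u -> nul (fun n => v n ** u n).
Proof. by move=> [M M0 vM]; apply: nul_le M0 _ => n; exact: rnM_leLHS. Qed.

Lemma nulMr v u : bnd v -> nul u -> nul (fun n => u n ** v n).
Proof. by move=> [M M0 vM]; apply: nul_le M0 _ => n; rewrite mulrC; exact: rnM_le. Qed.

Lemma bnd_cst (a : A) : bnd (fun=> a).
Proof. by exists (rn a) => //; exact: rn_ge0. Qed.

Lemma bndM u v : bnd u -> bnd v -> bnd (fun n => u n ** v n).
Proof.
move=> [M M0 uM] [N N0 vN]; exists (M * N); first exact: mulr_ge0.
by move=> n; exact: rnM_le.
Qed.

Lemma bnd_star u : bnd u -> bnd (fun n => star (u n)).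
Proof. by move=> [M M0 uM]; exists M => // n; rewrite rn_star. Qed.

Lemma nulM u v a b : bnd u -> bnd b -> nul (fun n => u n - v n) ->
  nul (fun n => a n - b n) -> nul (fun n => u n ** a n - v n ** b n).
Proof.
move=> ub bb uv ab.
apply: eq_nul (nulD (nulMl ub ab) (nulMr bb uv)) => n.
by rewrite amulBl amulBr subrKA.
Qed.

Lemma nul_sum (I : eqType) (r : seq I) (F : I -> nat -> A) :
  (forall i, i \in r -> nul (F i)) -> nul (fun n => \sum_(i <- r) F i n).
Proof.
elim: r => [_|i r IH h].
  by apply: eq_nul nul0 => n; rewrite big_nil.
have h1 : nul (F i) by apply: h; rewrite mem_head.
have h2 : nul (fun n => \sum_(j <- r) F j n).
  by apply: IH => j jr; apply: h; rewrite in_cons jr orbT.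
by apply: eq_nul (nulD h1 h2) => n; rewrite big_cons.
Qed.

Lemma bnd_sum (I : eqType) (r : seq I) (F : I -> nat -> A) :
  (forall i, i \in r -> bnd (F i)) -> bnd (fun n => \sum_(i <- r) F i n).
Proof.
elim: r => [_|i r IH h].
  by exists 0 => // n; rewrite big_nil rn0.
have [M M0 h1] : bnd (F i) by apply: h; rewrite mem_head.
have [N N0 h2] : bnd (fun n => \sum_(j <- r) F j n).
  by apply: IH => j jr; apply: h; rewrite in_cons jr orbT.
exists (M + N); first exact: addr_ge0.
by move=> n; rewrite big_cons (le_trans (rnD _ _))// lerD.
Qed.

Lemma nul_eventually_le u v (c e : R) : nul (fun n => u n - v n) -> 0 < e ->
  (\forall n \near \oo, rn (v n) <= c) -> \forall n \near \oo, rn (u n) <= c + e.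
Proof.
move=> uv e0 vc; near=> n; rewrite (le_trans (rn_le_dist _ (v n)))// lerD//.
  by near: n.
by apply: ltW; near: n; exact: uv.
Unshelve. all: by end_near. Qed.

End NullSequences.

(** * Separable invariant subalgebras *)

Section SeparableSubalgebra.
Context {R : realType} {A : cstarAlgType R} {G : topGroupType}.
Variable alpha : cstar_action G A.

Lemma dense_sequence (T : ptopologicalType) : @second_countable T ->
  exists q : nat -> T, forall (x : T) (U : set T), nbhs x U -> exists n, U (q n).
Proof.
move=> [B Bc [Bo Bb]]; have /countable_injP[f finj] := Bc.
exists (fun n => xget point [set x | exists b, [/\ B b, f b = n & b x]]) => x U Ux.
have [b [Bb' bx] bU] := Bb x U Ux; exists (f b).
have : [set x | exists c, [/\ B c, f c = f b & c x]] !=set0 by exists x; exists b.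
case=> y yP; apply: bU; have [c [Bc' cb cx]] := xgetPex point (ex_intro _ y yP).
have cb' : c = b by apply: finj; rewrite ?inE.
by rewrite cb' in cx.
Qed.

Definition rat_complex (p : rat * rat) : R[i] := Complex (ratr p.1) (ratr p.2).

Lemma rat_complex_dense (c : R[i]) (e : R) : 0 < e ->
  exists p, complex.Re `|c - rat_complex p| < e.
Proof.
move=> e0; have e2 : 0 < e / 2 by rewrite divr_gt0.
case: c => a b.
have h (x : R) : exists p : rat, `|x - ratr p| < e / 2.
  have [p] := @rat_in_itvoo R (x - e / 2) (x + e / 2) (ltac:(lra)).
  by rewrite in_itv /= => /andP[h1 h2]; exists p; rewrite ltr_norml; lra.
have [p ap] := h a; have [q bq] := h b; exists (p, q).
rewrite normc_def /= -[ltRHS]ger0_norm ?ltW// -[ltRHS]sqrtr_sqr ltr_sqrt ?exprn_gt0//.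
by move: ap bq; rewrite !ltr_norml => /andP[? ?] /andP[? ?]; nra.
Qed.

(** [D] is the closure of the countable set of polynomials, with rational complex coefficients, in
    the elements [alpha (q i) (s j)] and their adjoints, [q] being dense in [G]. Strong continuity
    puts the whole orbits of the [s j] into [D], hence [D] is invariant. *)
Lemma separable_invariant_subalgebra (s : nat -> A) : @second_countable G ->
  exists D : starSubalg A, [/\ closed (ssa_set D), separable_set (ssa_set D),
    invariant_set alpha (ssa_set D) & forall n, ssa_set D (s n)].
Proof.
move=> /dense_sequence[q qdense].
pose init m : A := if (unpickle m : option (nat * nat)) is Some (i, j) then alpha (q i) (s j) else 0.
(* Stage [n + 1] enumerates the results of one operation on stage [n]. The tag 0 copies, so stages
   increase and two elements can be brought to a common stage. *)
pose next (f : nat -> A) m : A :=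
  if (unpickle m : option (nat * nat * nat * (rat * rat))) is Some (t, i, j, p) then
    match t with
    | 0%N => f i
    | 1%N => rat_complex p *: f i + f j
    | 2%N => f i ** f j
    | _ => star (f i)
    end
  else 0.
pose code (t i j : nat) (p : rat * rat) : nat := pickle (t, i, j, p).
pose e n := iter n next init.
pose C : set A := range (fun z : nat * nat => e z.1 z.2).
have eS n i : exists m, e n.+1 m = e n i.
  by exists (code 0%N i 0%N (0, 0)); rewrite /= /next /code pickleK.
have e_add n k i : exists m, e (n + k)%N m = e n i.
  elim: k => [|k [m em]]; first by exists i; rewrite addn0.
  by rewrite addnS -em; exact: eS.
have CP x y : C x -> C y -> exists n i j, x = e n i /\ y = e n j.
  move=> [[n1 i] _ <-] [[n2 j] _ <-] /=.
  have [i' ei] := e_add n1 n2 i; have [j' ej] := e_add n2 n1 j.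
  by exists (n1 + n2)%N, i', j'; rewrite ei addnC ej.
have CD p x y : C x -> C y -> C (rat_complex p *: x + y).
  move=> /CP/[apply] -[n [i [j [-> ->]]]].
  by exists (n.+1, code 1%N i j p) => //=; rewrite /next /code pickleK.
have CM x y : C x -> C y -> C (x ** y).
  move=> /CP/[apply] -[n [i [j [-> ->]]]].
  by exists (n.+1, code 2%N i j (0, 0)) => //=; rewrite /next /code pickleK.
have CS x : C x -> C (star x).
  move=> [[n i] _ <-] /=.
  by exists (n.+1, code 3%N i 0%N (0, 0)) => //=; rewrite /next /code pickleK.
have Cinit i j : C (alpha (q i) (s j)).
  by exists (0%N, pickle (i, j)) => //=; rewrite /init pickleK.
have C0 : C 0.
  have := CD (-1, 0) _ _ (Cinit 0%N 0%N) (Cinit 0%N 0%N).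
  have -> : rat_complex (-1, 0) = -1 :> R[i].
    by apply/eqP; rewrite eq_complex /= rmorphN1 raddf0 oppr0 !eqxx.
  by rewrite scaleN1r addNr.
pose D := closure C.
have D0 : D 0 by apply: subset_closure.
have DP (c : R[i]) x y : D x -> D y -> D (c *: x + y).
  move=> /rn_closureP Dx /rn_closureP Dy; apply/rn_closureP => d d0.
  have d3 : 0 < d / 3 by rewrite divr_gt0.
  have x1 : 0 < rn x + 1 by rewrite ltr_wpDl// rn_ge0.
  have [p cp] := rat_complex_dense c (divr_gt0 d3 x1).
  pose r := complex.Re `|rat_complex p|.
  have r0 : 0 <= r by have := normr_ge0 (rat_complex p); rewrite lecE => /andP[].
  have r1 : 0 < r + 1 by rewrite ltr_wpDl.
  have [x' Cx xx] := Dx (d / 3 / (r + 1)) (divr_gt0 d3 r1).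
  have [y' Cy yy] := Dy (d / 3) d3.
  exists (rat_complex p *: x' + y'); first exact: CD.
  have -> : c *: x + y - (rat_complex p *: x' + y') =
     (c - rat_complex p) *: x + (rat_complex p *: (x - x') + (y - y')).
    by rewrite scalerBl scalerBr; zmod.
  have h1 : rn ((c - rat_complex p) *: x) <= d / 3.
    move: cp; rewrite ltr_pdivlMr// rnZ => /ltW; apply: le_trans.
    by rewrite ler_wpM2l ?lerDl//; have := normr_ge0 (c - rat_complex p); rewrite lecE => /andP[].
  have h2 : rn (rat_complex p *: (x - x')) <= d / 3.
    move: xx; rewrite ltr_pdivlMr// rnZ => /ltW; apply: le_trans.
    by rewrite mulrC ler_wpM2l ?rn_ge0// lerDl.
  rewrite (le_lt_trans (rnD _ _))//.
  have := rnD (rat_complex p *: (x - x')) (y - y'); lra.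
have DM x y : D x -> D y -> D (x ** y).
  move=> /rn_closureP Dx /rn_closureP Dy; apply/rn_closureP => d d0.
  have d2 : 0 < d / 2 by rewrite divr_gt0.
  have x1 : 0 < rn x + 1 by rewrite ltr_wpDl// rn_ge0.
  have [y' Cy yy] := Dy (d / 2 / (rn x + 1)) (divr_gt0 d2 x1).
  have y1 : 0 < rn y' + 1 by rewrite ltr_wpDl// rn_ge0.
  have [x' Cx xx] := Dx (d / 2 / (rn y' + 1)) (divr_gt0 d2 y1).
  exists (x' ** y'); first exact: CM.
  have -> : x ** y - x' ** y' = x ** (y - y') + (x - x') ** y'.
    by rewrite amulBl amulBr; zmod.
  move: xx yy; rewrite !ltr_pdivlMr// => xx yy.
  rewrite (le_lt_trans (rnD _ _))//.
  have := rnM x (y - y'); have := rnM (x - x') y'.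
  have := rn_ge0 (x - x'); have := rn_ge0 (y - y'); lra.
have DS x : D x -> D (star x).
  move=> /rn_closureP Dx; apply/rn_closureP => d /Dx[x' Cx xx].
  by exists (star x'); [exact: CS|rewrite -starB rn_star].
have Dc : closed D by exact: closed_closure.
have Dgen g j : D (alpha g (s j)).
  apply/rn_closureP => d d0; have [n nP] := qdense g _ (alpha_near alpha g (s j) d0).
  by exists (alpha (q n) (s j)); rewrite // rnBC.
exists (StarSubalg D0 DP DM DS); split => //=.
- exists C; split => //; last exact: subset_closure.
  by apply: card_le_trans (card_image_le _ _) _; exact: countableP.
- move=> h; pose E := [set a | D (alpha h a)].
  suff CE : C `<=` E.
    move=> a /rn_closureP Da; apply: rn_closed Dc _ => d /Da[x Cx ax].
    by exists (alpha h x); [exact: CE|rewrite -alphaB rn_alpha].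
  move=> _ [[n m] _ <-] /=; elim: n m => [|n IH] m; rewrite /E /=.
    rewrite /init; case: (unpickle m) => [[i j]|]; last by rewrite alpha0.
    by rewrite -actM.
  rewrite /next; case: (unpickle m) => [[[[t i] j] p]|]; last by rewrite alpha0.
  case: t => [|[|[|_]]].
  + exact: IH.
  + by rewrite alphaD alphaZ; apply: DP; exact: IH.
  + by rewrite alphaM; apply: DM; exact: IH.
  + by rewrite alphaS; apply: DS; exact: IH.
- by move=> n; rewrite -(act1 alpha (s n)).
Qed.

End SeparableSubalgebra.

(** * Representing sequences of the Rokhlin homomorphism *)

Section RokhlinLift.
Context {R : realType} {A : cstarAlgType R} {G : topGroupType}.
Variable alpha : cstar_action G A.
Hypotheses (Gcompact : compact [set: G]).

Definition equi (u : nat -> A) := forall (g0 : G) (e : R), 0 < e ->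
  nbhs g0 [set g | forall n, rn (alpha g (u n) - alpha g0 (u n)) <= e].

Lemma equi_cst a : equi (fun=> a).
Proof.
move=> g0 e e0; apply: filterS (alpha_near alpha g0 a e0) => g /= h n.
exact: ltW.
Qed.

Lemma equiD u v : equi u -> equi v -> equi (fun n => u n + v n).
Proof.
move=> ue ve g0 e e0; have e2 : 0 < e / 2 by rewrite divr_gt0.
apply: filterS2 (ue g0 _ e2) (ve g0 _ e2) => g /= h1 h2 n.
rewrite !alphaD opprD addrACA (le_trans (rnD _ _))//.
by have := h1 n; have := h2 n; lra.
Qed.

Lemma equiM u v : bnd u -> bnd v -> equi u -> equi v -> equi (fun n => u n ** v n).
Proof.
move=> [M M0 uM] [N N0 vN] ue ve g0 e e0.
have M1 : 0 < M + 1 by rewrite ltr_wpDl.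
have N1 : 0 < N + 1 by rewrite ltr_wpDl.
have e2 : 0 < e / 2 by rewrite divr_gt0.
apply: filterS2 (ue g0 _ (divr_gt0 e2 N1)) (ve g0 _ (divr_gt0 e2 M1)) => g /= h1 h2 n.
have {}h1 := h1 n; have {}h2 := h2 n; have {}h1 : rn (alpha g (u n) - alpha g0 (u n)) * (N + 1) <= e / 2 by rewrite -ler_pdivlMr.
have {}h2 : rn (alpha g (v n) - alpha g0 (v n)) * (M + 1) <= e / 2 by rewrite -ler_pdivlMr.
have -> : alpha g (u n ** v n) - alpha g0 (u n ** v n) =
    alpha g (u n) ** (alpha g (v n) - alpha g0 (v n)) +
    (alpha g (u n) - alpha g0 (u n)) ** alpha g0 (v n).
  by rewrite !alphaM amulBl amulBr; zmod.
rewrite (le_trans (rnD _ _))// [e]splitr lerD//.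
  apply: le_trans h2; rewrite mulrC; apply: rnM_le => //.
  by rewrite rn_alpha (le_trans (uM n))// lerDl.
apply: le_trans h1; apply: rnM_le => //.
by rewrite rn_alpha (le_trans (vN n))// lerDl.
Qed.

Lemma equi_sum (I : Type) (r : seq I) (F : I -> nat -> A) :
  (forall i, equi (F i)) -> equi (fun n => \sum_(i <- r) F i n).
Proof.
move=> Fe; elim: r => [|i r IH].
  by move=> g0 e e0; apply: filterS (equi_cst 0 g0 e0) => g h n; rewrite !big_nil; exact: h.
move=> g0 e e0; apply: filterS (equiD (Fe i) IH g0 e0) => g h n.
by rewrite !big_cons; exact: h.
Qed.

(* Representing sequences of the images of continuous functions under the
   Rokhlin homomorphism: its relations hold modulo null sequences after
   multiplication by elements of [D]. *)
Record rokhlin_lift (D : set A) (X : (G -> R[i]^o) -> nat -> A) : Prop := {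
  rl_bnd : forall f, CG f -> bnd (X f);
  rl_equi : forall f, CG f -> equi (X f);
  rl_comm : forall f d, CG f -> D d -> nul (fun n => X f n ** d - d ** X f n);
  rl_lin : forall c f h d, CG f -> CG h -> D d ->
    nul (fun n => X (c *: f + h) n ** d - (c *: X f n + X h n) ** d);
  rl_mul : forall f h d, CG f -> CG h -> D d ->
    nul (fun n => X (f ** h) n ** d - X f n ** X h n ** d);
  rl_star : forall f d, CG f -> D d ->
    nul (fun n => X (star f) n ** d - star (X f n) ** d);
  rl_act : forall g f d, CG f -> D d ->
    nul (fun n => alpha g (X f n) ** d - X (left_translation g f) n ** d);
  rl_one : forall d, D d -> nul (fun n => X (cst 1) n ** d - d)
}.

Lemma CGP (c : R[i]) f h : CG f -> CG h -> CG (c *: f + h : G -> R[i]^o).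
Proof.
move=> fc hc x; apply: cvgD; last exact: hc.
exact: (cvgZl_tmp (k := c) (fc x)).
Qed.

Lemma CGM f h : CG f -> CG h -> CG (f ** h : G -> R[i]^o).
Proof.
by move=> fc hc x; apply: (@cvgM R[i] _ _ _ f h); [exact: fc|exact: hc].
Qed.

Lemma CGS f : CG f -> CG (star f : G -> R[i]^o).
Proof.
move=> fc x; apply/(@rn_cvgP R R[i]^o) => e e0.
have /(@rn_cvgP R R[i]^o)/(_ e e0) := fc x; apply: filterS => y.
have -> : star f y - star f x = ((f y - f x : R[i])^* : R[i]^o) by rewrite rmorphB.
have e2 : rn ((f y - f x : R[i])^* : R[i]^o) = rn (f y - f x) :=
  congr1 (@complex.Re R) (norm_conjC (f y - f x : R[i])).
by rewrite e2.
Qed.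

Lemma CG_cst (c : R[i]) : CG (cst c : G -> R[i]^o).
Proof. by move=> x; exact: cvg_cst. Qed.

Lemma CG_left_translation g f : CG f -> CG (@left_translation R G g f).
Proof.
move=> fc x; apply: (@continuous_comp _ _ _ (fun h => (g^-1 * h)%g) f).
  exact: mulg_continuousl.
exact: fc.
Qed.

Lemma eta_eqP (x y : linf A) :
  Defs.eta x = Defs.eta y <-> nul (fun n => val x n - val y n).
Proof.
split=> [/(iffLR (qpiE (c0_ideal A) x y)) h|h].
  apply/nulE; have e : val (x - y) = val x - val y by exact: raddfB.
  rewrite (_ : (fun n => _) = val (x - y)); [exact: h|by rewrite e].
apply: (iffRL (qpiE (c0_ideal A) x y)).
have e : val (x - y) = val x - val y by exact: raddfB.
have {h} := iffRL (nulE _) h.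
by rewrite (_ : (fun n => _) = val (x - y)) //; rewrite e.
Qed.

Lemma kappa_eq (D : starSubalg A) (a b : commutant D) (u v : linf A) :
  kappa a = kappa b -> val a = Defs.eta u -> val b = Defs.eta v ->
  forall d, ssa_set D d ->
    nul (fun n => val u n ** d - val v n ** d).
Proof.
move=> /(iffLR (qpiE (ann_ideal D) a b)) ab au bv d Dd; have [+ _] := ab d Dd.
have -> : val (a - b) = val a - val b by exact: raddfB.
rewrite au bv amulDl amulNl => /eqP; rewrite subr_eq0 => /eqP.
rewrite /Ainf_const /Defs.eta -!qpiM => e.
exact: (iffLR (eta_eqP _ _) e).
Qed.

(** Almost invariance is essential: it makes the sequence equicontinuous under the action, so that
    its class lies in [F_alpha], the only place where [phi (cst 1)] is known to act as a unit. *)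
Lemma invariant_unit : sigma_unital A -> exists x : nat -> A,
  [/\ forall n, star (x n) = x n, forall n, rn (x n) <= 1,
    forall e : R, 0 < e -> \forall n \near \oo, forall g, rn (alpha g (x n) - x n) <= e
  & forall a, nul (fun n => x n ** a - a)].
Proof.
move=> [e [e1 _ eu _]].
have e_star n : star (e n) = e n by have [[y ->] _] := e1 n; rewrite starM starK.
have e_le n : rn (e n) <= 1 by have [_] := e1 n; rewrite -rn_leE rmorph1.
have step n := @averaged_unit R A G alpha Gcompact e e_star e_le eu n.+1%:R^-1 n (ltac:(by [])).
have [x xP] := choice step; exists x; split.
- by move=> n; have [] := xP n.
- by move=> n; have [] := xP n.
- move=> d d0; have [N _ NP] := near_infty_natSinv_lt (PosNum d0).
  exists N => // n /NP /= nd g; have [_ _ h _] := xP n.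
  by rewrite (le_trans (h g))// ltW.
- move=> a d d0; have /(rn_cvgP _)/(_ _ (divr_gt0 d0 (ltr0n R 2)))[N _ NP] := eu a.
  exists N => // n /= Nn; have [_ _ _ h] := xP n.
  rewrite (@le_lt_trans _ _ (d / 2))//; last by lra.
  by apply: h => m nm; apply/ltW/NP; exact: leq_trans Nn nm.
Qed.

Lemma invariant_unit_equi (x : nat -> A) :
  (forall e : R, 0 < e -> \forall n \near \oo, forall g, rn (alpha g (x n) - x n) <= e) ->
  equi x.
Proof.
move=> xi g0 e e0; have [N _ NP] := xi (e / 2) (divr_gt0 e0 (ltr0n R 2)).
have fin : nbhs g0 [set g | forall n, (n < N)%N -> rn (alpha g (x n) - alpha g0 (x n)) <= e].
  elim: (N) => [|M IH]; first by apply: filterE.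
  apply: filterS2 IH (alpha_near alpha g0 (x M) e0) => g /= h1 h2 n.
  by rewrite ltnS leq_eqVlt => /predU1P[->|]; [exact: ltW|exact: h1].
apply: filterS fin => g /= h n; have [nN|Nn] := ltnP n N; first exact: h.
have h1 := NP n Nn g; have h2 := NP n Nn g0.
rewrite (le_trans (rn_tri (x n) _ _))// (rnBC (x n)); lra.
Qed.

Lemma rokhlin_lift_exists (D : starSubalg A) :
  sigma_unital A -> Rokhlin_property alpha ->
  closed (ssa_set D) -> separable_set (ssa_set D) -> invariant_set alpha (ssa_set D) ->
  exists X, rokhlin_lift (ssa_set D) X.
Proof.
move=> Asu rok Dc Ds Di.
have [phi [[philin phiM phiS] phiF phi1 phiact]] := rok D Dc Ds Di.
(* Choice runs over all functions; discontinuous ones receive the dummy value 0. *)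
have lift f : exists wa : linf A * commutant D, CG f ->
    [/\ linf_alpha alpha wa.1, val wa.2 = Defs.eta wa.1 & kappa wa.2 = phi f].
  have [fc|nfc] := pselect (CG f); last by exists (0, 0).
  by have [a [w wl wa] ka] := phiF f fc; exists (w, a).
have [L LP] := choice lift; pose X f n := val (L f).1 n.
have Xbnd f : CG f -> bnd (X f).
  move=> _; have [M wM] := subalgP (L f).1; exists (complex.Re M).
    by rewrite (le_trans (rn_ge0 (X f 0%N)))//; have := wM 0%N; rewrite lecE => /andP[].
  by move=> n; have := wM n; rewrite lecE => /andP[].
have Xequi f : CG f -> equi (X f).
  move=> /LP[wl _ _] g0 e e0; apply: filterS (wl g0 e e0) => g h n.
  by have := h n; rewrite rn_leE.
have comm (a : commutant D) (w : linf A) : val a = Defs.eta w ->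
    forall d, ssa_set D d -> nul (fun n => val w n ** d - d ** val w n).
  move=> aw d Dd; have := subalgP a; rewrite /= => /(_ d Dd); rewrite aw.
  rewrite /Ainf_const /Defs.eta -!qpiM => e.
  exact: (iffLR (eta_eqP _ _) e).
have rel f (a : commutant D) (w : linf A) : CG f -> phi f = kappa a -> val a = Defs.eta w ->
    forall d, ssa_set D d -> nul (fun n => X f n ** d - val w n ** d).
  move=> /LP[_ h2 h3] fa aw d Dd.
  by apply: (kappa_eq _ h2 aw) => //; rewrite h3.
exists X; constructor => //.
- by move=> f d /LP[_ h2 _] Dd; exact: comm h2 d Dd.
- move=> c f h d fc hc Dd; have [_ f2 f3] := LP f fc; have [_ h2 h3] := LP h hc.
  apply: (rel _ (c *: (L f).2 + (L h).2) (c *: (L f).1 + (L h).1) (CGP fc hc)) => //.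
    by rewrite philin// -f3 -h3 /kappa qpiD qpiZ.
  have -> : val (c *: (L f).2 + (L h).2) = c *: val (L f).2 + val (L h).2 by [].
  by rewrite f2 h2 /Defs.eta qpiD qpiZ.
- move=> f h d fc hc Dd; have [_ f2 f3] := LP f fc; have [_ h2 h3] := LP h hc.
  apply: (rel _ ((L f).2 ** (L h).2) ((L f).1 ** (L h).1) (CGM fc hc)) => //.
    by rewrite phiM// -f3 -h3 /kappa qpiM.
  by rewrite /= f2 h2 /Defs.eta qpiM.
- move=> f d fc Dd; have [_ f2 f3] := LP f fc.
  apply: (rel _ (star (L f).2) (star (L f).1) (CGS fc)) => //.
    by rewrite phiS// -f3 /kappa qpi_star.
  by rewrite /= f2 /Defs.eta qpi_star.
- move=> g f d fc Dd; have [a [b [fa gb [u [v [au bv uv]]]]]] := phiact g f fc.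
  have h1 := rel _ _ _ fc fa au.
  have h2 := rel _ _ _ (CG_left_translation fc) gb bv d Dd.
  apply: (@nul_trans _ _ (fun n => val v n ** d)); last exact: nulBC.
  (* [alpha g] applied to [(X f n - u n) ** alpha g^-1 d] gives the required difference, so the test
     element must be moved inside [D] by [g^-1]. *)
  have := h1 (alpha g^-1%g d) (Di _ _ Dd).
  apply: (@nul_le _ _ _ _ 1) => // n.
  by rewrite mul1r uv -[leRHS](rn_alpha alpha g) alphaB !alphaM alphaK.
(* The class [a] of the invariant approximate unit satisfies [phi (cst 1) ** a = a]. Multiplied by
   [d], on which [x n] acts as a unit, this becomes the claim. *)
- move=> d Dd; have [x [xs x1 xi xu]] := invariant_unit Asu.
  have xb : ssa_set (linf_subalg A) x.
    by exists 1 => n; have := x1 n; rewrite -rn_leE rmorph1.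
  pose w : linf A := to_subalg xb.
  have xur a : nul (fun n => a ** x n - a).
    have := nul_star (xu (star a)); apply: eq_nul => n.
    by rewrite starB starM starK xs.
  have wc : ssa_set (commutant_subalg D) (Defs.eta w).
    move=> a Da; rewrite /Ainf_const /Defs.eta -!qpiM.
    apply: (iffRL (eta_eqP _ _)) => /=.
    by apply: (nul_trans (xu a)); exact/nulBC/xur.
  pose a : commutant D := to_subalg wc.
  have wF : F_alpha alpha (kappa a).
    exists a => //; exists w => // g0 e e0.
    apply: filterS (invariant_unit_equi xi g0 e0) => g h n; by rewrite rn_leE; exact: h.
  have [_ f2 f3] := LP _ (@CG_cst 1).
  have [+ _] := phi1 _ wF; rewrite -f3 /kappa -qpiM => e.
  have e2 : val ((L (cst 1)).2 ** a) = Defs.eta ((L (cst 1)).1 ** w).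
    by rewrite /= f2 /Defs.eta qpiM.
  have := kappa_eq e e2 erefl Dd => /= h.
  apply: (@nul_trans _ _ (fun n => X (cst 1) n ** x n ** d)).
    apply: nulBC; have := nulMl (Xbnd _ (@CG_cst 1)) (xu d); apply: eq_nul => n.
    by rewrite amulBr amulA.
  exact: nul_trans h (xu d).
Qed.

End RokhlinLift.

(** * Boundedness of the Rokhlin homomorphism on tensors *)

Section AsymptoticBound.
Context {R : realType} {A : cstarAlgType R}.
Implicit Types (u v : nat -> A) (c e : R).

(** Encodes [limsup rn (u n) <= c]. *)
Definition le_lim u c := forall e, 0 < e -> \forall n \near \oo, rn (u n) <= c + e.

Lemma le_lim_cst (a : A) c : rn a <= c -> le_lim (fun=> a) c.
Proof. by move=> ac e e0; apply: nearW => n; rewrite (le_trans ac)// lerDl ltW. Qed.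

Lemma le_lim_le u c c' : c <= c' -> le_lim u c -> le_lim u c'.
Proof. by move=> cc uc e /uc; apply: filterS => n; move/le_trans; apply; rewrite lerD2r. Qed.

Lemma le_lim_nul v u c : nul (fun n => u n - v n) -> le_lim v c -> le_lim u c.
Proof.
move=> uv vc e e0; have e2 : 0 < e / 2 by rewrite divr_gt0.
apply: filterS (nul_eventually_le uv e2 (vc _ e2)) => n.
by rewrite -addrA -splitr.
Qed.

Lemma le_limD u v c c' : le_lim u c -> le_lim v c' -> le_lim (fun n => u n + v n) (c + c').
Proof.
move=> uc vc e e0; have e2 : 0 < e / 2 by rewrite divr_gt0.
apply: filterS2 (uc _ e2) (vc _ e2) => n h1 h2.
by rewrite (le_trans (rnD _ _))//; lra.
Qed.

Lemma le_limMl (a : A) u c : le_lim u c -> le_lim (fun n => a ** u n) (rn a * c).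
Proof.
move=> uc e e0; have a1 : 0 < rn a + 1 by rewrite ltr_wpDl// rn_ge0.
apply: filterS (uc _ (divr_gt0 e0 a1)) => n h.
rewrite (le_trans (rnM _ _))// (le_trans (ler_wpM2l (rn_ge0 a) h))// mulrDr lerD2l.
by rewrite mulrA ler_pdivrMr// mulrC ler_pM2l// lerDl.
Qed.

Lemma le_limZ (z : R[i]) u c : le_lim u c -> le_lim (fun n => z *: u n) (complex.Re `|z| * c).
Proof.
move=> uc e e0.
have z0 : 0 <= complex.Re `|z| by have := normr_ge0 z; rewrite lecE => /andP[].
have z1 : 0 < complex.Re `|z| + 1 by rewrite ltr_wpDl.
apply: filterS (uc _ (divr_gt0 e0 z1)) => n h.
rewrite rnZ (le_trans (ler_wpM2l z0 h))// mulrDr lerD2l.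
by rewrite mulrA ler_pdivrMr// mulrC ler_pM2l// lerDl.
Qed.

Lemma le_limC u c : 0 <= c -> le_lim (fun n => star (u n) ** u n) (c ^+ 2) -> le_lim u c.
Proof.
move=> c0 h e e0; apply: filterS (h _ (exprn_gt0 2 e0)) => n; rewrite rnC => hn.
rewrite -(@ler_pXn2r _ 2) ?nnegrE ?rn_ge0 ?addr_ge0 ?(ltW e0)//.
by rewrite (le_trans hn)// sqrrD; have := mulr_ge0 c0 (ltW e0); lra.
Qed.

Lemma le_lim_sum (I : Type) (r : seq I) (F : I -> nat -> A) (c : I -> R) :
  (forall i, le_lim (F i) (c i)) ->
  le_lim (fun n => \sum_(i <- r) F i n) (\sum_(i <- r) c i).
Proof.
move=> h; elim: r => [|i r IH].
  rewrite big_nil => e e0; apply: nearW => n.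
  by rewrite big_nil rn0 add0r ltW.
move=> e e0; have := le_limD (h i) IH e0; apply: filterS => n.
by rewrite !big_cons.
Qed.

Lemma le_lim_closed u c : (forall e, 0 < e -> le_lim u (c + e)) -> le_lim u c.
Proof.
move=> h e e0; have e2 : 0 < e / 2 by rewrite divr_gt0.
by apply: filterS (h _ e2 _ e2) => n; rewrite -addrA -splitr.
Qed.

(** The power with exponent [2 ^ j]. With repeated squaring the C*-identity computes norms of powers
    of selfadjoint elements exactly. *)
Fixpoint sqpow j (y : A) : A := if j is j'.+1 then sqpow j' y ** sqpow j' y else y.

Lemma sqpow_norm j y : star y = y ->
  star (sqpow j y) = sqpow j y /\ rn (sqpow j y) = rn y ^+ (2 ^ j).
Proof.
move=> ys; elim: j => [|j [IH1 IH2]]; first by rewrite /= expr1.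
split; first by rewrite /= starM IH1.
by rewrite /= -{1}IH1 rnC IH2 -exprM expnS mulnC.
Qed.

Lemma bnd_sqpow j u : bnd u -> bnd (fun n => sqpow j (u n)).
Proof. by move=> ub; elim: j => //= j IH; exact: bndM. Qed.

End AsymptoticBound.

(** Origin of the factor 2 in the key estimate: with [K] letters, words of length [L = 2 ^ j] have
    at most [(L + 1)^K <= 2^L] letter counts. *)
Lemma exp_dominates (K : nat) : exists j, ((2 ^ j).+1 ^ K <= 2 ^ (2 ^ j))%N.
Proof.
exists (3 * K)%N; set j := (3 * K)%N.
have h1 : ((2 ^ j).+1 <= 2 ^ j.+1)%N.
  by rewrite expnS mul2n -addnn -addn1 leq_add2l expn_gt0.
have h2 : (j.+1 * K <= 2 ^ j)%N.
  rewrite /j [in (2 ^ _)%N]mulnC expnM !expnS expn0 muln1.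
  have Ky := ltn_expl K (ltnSn 1).
  by apply: leq_trans (leq_mul Ky (leq_mul Ky Ky)); nia.
apply: leq_trans (_ : ((2 ^ j.+1) ^ K <= _)%N); last by rewrite -expnM leq_pexp2l.
by case: (K) => // k; rewrite leq_exp2r.
Qed.

Section KeyEstimate.
Context {R : realType} {A : cstarAlgType R} {G : topGroupType}.
Variable alpha : cstar_action G A.
Hypotheses (Ghaus : hausdorff_space G) (Gcompact : compact [set: G]).
Variables (D : starSubalg A) (X : (G -> R[i]^o) -> nat -> A).
Hypothesis HX : rokhlin_lift alpha (ssa_set D) X.
Implicit Types f h : G -> R[i]^o.

Definition real_fun (f : G -> R) : G -> R[i]^o := fun t => (f t)%:C%C.

Lemma CG_real (f : G -> R) : continuous f -> CG (real_fun f).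
Proof.
move=> fc x; apply/(@rn_cvgP R R[i]^o) => e e0.
have /cvgrPdist_lt/(_ e e0) := fc x; apply: filterS => y.
rewrite distrC /real_fun -rmorphB /rn normc_def /= expr0n addr0 sqrtr_sqr.
exact.
Qed.

Let Dmul a b : ssa_set D a -> ssa_set D b -> ssa_set D (a ** b).
Proof. exact: ssaM. Qed.
Let Dstar a : ssa_set D a -> ssa_set D (star a).
Proof. exact: ssaS. Qed.
Let DZ (c : R[i]) a : ssa_set D a -> ssa_set D (c *: a).
Proof. by move=> Da; rewrite -[_ *: _]addr0; apply: ssaP => //; exact: ssa0. Qed.

Lemma ssa_sum (I : Type) (r : seq I) (P : pred I) (F : I -> A) : (forall i, ssa_set D (F i)) ->
  ssa_set D (\sum_(i <- r | P i) F i).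
Proof.
move=> DF; elim/big_rec: _ => [|i a _ Da]; first exact: ssa0.
by rewrite -[F i]scale1r; exact: ssaP.
Qed.

(** The relations of a lift need an element of [D] immediately on the right, so [X h n] is commuted
    past [d] before the adjoint relation is used, and back afterwards. *)
Lemma lift_star_mul f h d : CG f -> CG h -> ssa_set D d ->
  nul (fun n => star (X f n) ** X h n ** d - X (star f ** h) n ** d).
Proof.
move=> fc hc Dd; have bf := rl_bnd HX fc; have bh := rl_bnd HX hc.
have bf' := rl_bnd HX (CGS fc).
apply: (@nul_trans _ _ (fun n => X (star f) n ** X h n ** d)); last first.
  exact: nulBC (rl_mul HX (CGS fc) hc Dd).
apply: (@nul_trans _ _ (fun n => star (X f n) ** d ** X h n)).
  apply: eq_nul (nulMl (bnd_star bf) (rl_comm HX hc Dd)) => n.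
  by rewrite amulBr !amulA.
apply: (@nul_trans _ _ (fun n => X (star f) n ** d ** X h n)).
  apply: eq_nul (nulMr bh (nulBC (rl_star HX fc Dd))) => n.
  by rewrite amulBl.
apply: eq_nul (nulMl bf' (nulBC (rl_comm HX hc Dd))) => n.
by rewrite amulBr !amulA.
Qed.

Lemma CGZ (c : R[i]) f : CG f -> CG (c *: f).
Proof. by move=> fc x; exact: (cvgZl_tmp (k := c) (fc x)). Qed.

(** Since [star f ** f = 1], the square [star (X f n ** d) ** (X f n ** d)] tends to [star d ** d].
    This replaces contractivity of the homomorphism, its target having no norm. *)
Lemma lift_unimodular f d : CG f -> (forall t, `|f t| = 1) -> ssa_set D d ->
  le_lim (fun n => X f n ** d) (rn d).
Proof.
move=> fc f1 Dd; apply: le_limC; first exact: rn_ge0.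
apply: (@le_lim_nul _ _ (fun=> star d ** d)); last by apply: le_lim_cst; rewrite rnC.
have ff : star f ** f = cst 1.
  by apply/funext => t; rewrite -[LHS]/((f t : R[i])^* * f t) mulrC -normCK f1 expr1n.
have h := nulMl (bnd_cst (star d)) (lift_star_mul fc fc Dd).
rewrite ff in h; have h2 := nulMl (bnd_cst (star d)) (rl_one HX Dd).
by apply: eq_nul (nulD h h2) => n; rewrite starM !amulBr subrKA !amulA.
Qed.

Lemma lift_scaled_sum f h (c : R[i]) d : CG f -> CG h -> ssa_set D d ->
  nul (fun n => X (c *: f + h) n ** d - (c *: (X f n ** d) + X h n ** d)).
Proof.
by move=> fc hc Dd; apply: eq_nul (rl_lin HX c fc hc Dd) => n; rewrite amulDl amulZl.
Qed.

Lemma lift0 d : ssa_set D d -> nul (fun n => X 0 n ** d).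
Proof.
move=> Dd; have := lift_scaled_sum (-1) (@CG_cst R G 0) (@CG_cst R G 0) Dd.
rewrite (_ : -1 *: cst 0 + cst 0 = 0 :> (G -> R[i]^o)); last first.
  by apply/funext => t; rewrite -[LHS]/(-1 *: 0 + 0) scaler0 addr0.
by apply: eq_nul => n; rewrite scaleN1r addNr subr0.
Qed.

Lemma lift_scale f (c : R[i]) d : CG f -> ssa_set D d ->
  nul (fun n => X (c *: f) n ** d - c *: (X f n ** d)).
Proof.
move=> fc Dd; have := lift_scaled_sum c fc (@CG_cst R G 0) Dd.
rewrite (_ : c *: f + cst 0 = c *: f); last by rewrite -[cst 0]/(0 : G -> R[i]^o) addr0.
move=> h; apply: eq_nul (nulD h (lift0 Dd)) => n.
by rewrite -[cst 0]/(0 : G -> R[i]^o) opprD addrA subrK.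
Qed.

Lemma sqrt_complement (a : R) : 0 <= a <= 1 ->
  `|Complex a (Num.sqrt (1 - a ^+ 2))| = 1 :> R[i].
Proof.
move=> /andP[a0 a1]; rewrite normc_def /= sqr_sqrtr ?subr_ge0 ?expr_le1//.
by rewrite subrKC sqrtr1.
Qed.

(** [a] is the mean of the unimodular functions [a + i w] and [a - i w] with [w = sqrt(1 - a^2)]. *)
Lemma lift_real_contractive (a : G -> R) d : continuous a -> (forall t, 0 <= a t <= 1) ->
  ssa_set D d -> le_lim (fun n => X (real_fun a) n ** d) (rn d).
Proof.
move=> ac a01 Dd; pose w t := Num.sqrt (1 - a t ^+ 2).
have wc : continuous w.
  move=> t; apply: continuous_comp; last exact: sqrt_continuous.
  by apply: cvgB; [exact: cvg_cst|apply: cvgM; exact: ac].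
pose v : G -> R[i]^o := 'i%C *: real_fun w + real_fun a.
pose v' : G -> R[i]^o := (- 'i%C) *: real_fun w + real_fun a.
have vE t : v t = Complex (a t) (w t).
  by apply/eqP; rewrite eq_complex /=; apply/andP; split; apply/eqP; ring.
have vE' t : v' t = Complex (a t) (- w t).
  by apply/eqP; rewrite eq_complex /=; apply/andP; split; apply/eqP; ring.
have vc : CG v by apply: CGP; exact: CG_real.
have vc' : CG v' by apply: CGP; exact: CG_real.
have h1 : le_lim (fun n => X v n ** d) (rn d).
  by apply: lift_unimodular => // t; rewrite vE sqrt_complement.
have h2 : le_lim (fun n => X v' n ** d) (rn d).
  apply: lift_unimodular => // t; rewrite vE' -(sqrt_complement (a01 t)).
  by rewrite !normc_def /= sqrrN.
have e : real_fun a = half *: v + half *: v'.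
  apply/funext => t; rewrite -[RHS]/(half * v t + half * v' t) vE vE'.
  by apply/eqP; rewrite eq_complex /=; apply/andP; split; apply/eqP; lra.
have n1 := lift_scaled_sum half vc (@CGZ half _ vc') Dd.
have n2 := lift_scale half vc' Dd; rewrite -e in n1.
apply: (@le_lim_nul _ _ (fun n => half *: (X v n ** d) + half *: (X v' n ** d))).
  by apply: eq_nul (nulD n1 n2) => n; rewrite opprD opprD !addrA; zmod.
have hn : complex.Re `|half : R[i]| = 2^-1.
  by rewrite normc_def /= expr0n addr0 sqrtr_sqr ger0_norm.
have -> : rn d = complex.Re `|half : R[i]| * rn d + complex.Re `|half : R[i]| * rn d.
  by rewrite hn; lra.
by apply: le_limD; exact: le_limZ.
Qed.

(** By the C*-identity it suffices to treat [star f ** f], a real function with values in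
    [[0, 1]]. *)
Lemma lift_contractive1 f d : CG f -> (forall t, rn (f t) <= 1) ->
  ssa_set D d -> le_lim (fun n => X f n ** d) (rn d).
Proof.
move=> fc f1 Dd; pose a t := rn (f t) ^+ 2.
have ac : continuous a.
  move=> t; apply: cvgM; apply: (@continuous_real_dominated _ _ R[i]^o f (@rn R R[i]^o) 1) => //;
    move=> x y; rewrite mul1r ler_norml.
    by have := rn_le_dist x y; have := rn_le_dist y x; rewrite (rnBC y); lra.
  by have := rn_le_dist x y; have := rn_le_dist y x; rewrite (rnBC y); lra.
have a01 t : 0 <= a t <= 1 by rewrite sqr_ge0 expr_le1 ?rn_ge0 ?f1.
have fa : star f ** f = real_fun a.
  apply/funext => t; rewrite -[LHS]/((f t : R[i])^* * f t) mulrC -normCK /real_fun /a.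
  have e : `|f t : R[i]| = (rn (f t))%:C%C := rnE (f t : R[i]^o).
  by rewrite e -rmorphXn.
apply: le_limC; first exact: rn_ge0.
have h := nulMl (bnd_cst (star d)) (lift_star_mul fc fc Dd); rewrite fa in h.
apply: (@le_lim_nul _ _ (fun n => star d ** (X (real_fun a) n ** d))).
  by apply: eq_nul h => n; rewrite starM !amulBr !amulA.
have := le_limMl (star d) (lift_real_contractive ac a01 Dd).
by rewrite rn_star -expr2.
Qed.

Lemma lift_contractive f (c : R) d : CG f -> (forall t, rn (f t) <= c) ->
  ssa_set D d -> le_lim (fun n => X f n ** d) (c * rn d).
Proof.
move=> fc fle Dd; have c0 : 0 <= c := le_trans (rn_ge0 _) (fle point).
have pos (b : R) : 0 < b -> (forall t, rn (f t) <= b) ->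
    le_lim (fun n => X f n ** d) (b * rn d).
  move=> b0 fb; pose g : G -> R[i]^o := b^-1%:C%C *: f.
  have gc : CG g by exact: CGZ.
  have gE : f = b%:C%C *: g.
    rewrite /g scalerA -rmorphM divff ?lt0r_neq0// scale1r//.
  have := lift_scale b%:C%C gc Dd; rewrite -gE => h.
  apply: (le_lim_nul h).
  have -> : b * rn d = complex.Re `|b%:C%C| * rn d.
    by rewrite normc_def /= expr0n addr0 sqrtr_sqr gtr0_norm.
  apply: le_limZ; apply: lift_contractive1 => // t.
  have -> : g t = (b^-1)%:C%C *: (f t : R[i]^o) by [].
  by rewrite rnZr gtr0_norm ?invr_gt0// mulrC ler_pdivrMr// mul1r.
(* [c] may vanish, so [f] is normalized by a slightly larger positive constant. *)
apply: le_lim_closed => e e0.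
have d1 : 0 < rn d + 1 by rewrite ltr_wpDl// rn_ge0.
have ed : 0 < e / (rn d + 1) by rewrite divr_gt0.
apply: le_lim_le (pos (c + e / (rn d + 1)) _ _).
- by rewrite mulrDl lerD2l mulrAC ler_pdivrMr// ler_pM2l// lerDl.
- by rewrite ltr_wpDl.
- by move=> t; rewrite (le_trans (fle t))// lerDl ltW.
Qed.

Lemma lift_mul f h d d' : CG f -> CG h -> ssa_set D d -> ssa_set D d' ->
  nul (fun n => (X f n ** d) ** (X h n ** d') - X (f ** h) n ** (d ** d')).
Proof.
move=> fc hc Dd Dd'.
apply: (@nul_trans _ _ (fun n => X f n ** X h n ** (d ** d'))).
  have := nulMl (rl_bnd HX fc) (nulMr (bnd_cst d') (nulBC (rl_comm HX hc Dd))).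
  by apply: eq_nul => n; rewrite amulBl amulBr -!amulA.
apply: nulBC; have := rl_mul HX fc hc (Dmul Dd Dd').
by apply: eq_nul => n; rewrite !amulA.
Qed.

Lemma lift_star f d : CG f -> ssa_set D d ->
  nul (fun n => star (X f n ** d) - X (star f) n ** star d).
Proof.
move=> fc Dd; have Dd' := Dstar Dd.
apply: (@nul_trans _ _ (fun n => star (X f n) ** star d)); last first.
  exact: nulBC (rl_star HX fc Dd').
apply: eq_nul (nul_star (rl_comm HX fc Dd)) => n.
by rewrite starB !starM.
Qed.

Lemma bnd_lift f d : CG f -> bnd (fun n => X f n ** d).
Proof. by move=> fc; apply: bndM; [exact: (rl_bnd HX fc)|exact: bnd_cst]. Qed.

(* The index set of the words of length [2 ^ j], and the number of
   occurrences of a letter in a word. *)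
Fixpoint word (I : finType) j : finType :=
  if j is j'.+1 then (word I j' * word I j')%type else I.

Fixpoint wcount (I : finType) j : word I j -> I -> nat :=
  match j with
  | 0%N => fun w i => (w == i : bool) : nat
  | j'.+1 => fun w i => (wcount w.1 i + wcount w.2 i)%N
  end.

Fixpoint wfun (I : finType) (f : I -> G -> R) j : word I j -> G -> R :=
  match j with
  | 0%N => fun w => f w
  | j'.+1 => fun w t => wfun f w.1 t * wfun f w.2 t
  end.

Fixpoint walg (I : finType) (d : I -> A) j : word I j -> A :=
  match j with
  | 0%N => fun w => d w
  | j'.+1 => fun w => walg d w.1 ** walg d w.2
  end.

Lemma wcount_le (I : finType) j (w : word I j) i : (wcount w i <= 2 ^ j)%N.
Proof.
elim: j w => [|j IH] w /=; first by case: (_ == _).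
by rewrite expnS mul2n -addnn leq_add.
Qed.

Lemma wfunE (I : finType) (f : I -> G -> R) j (w : word I j) t :
  wfun f w t = \prod_i f i t ^+ wcount w i.
Proof.
elim: j w => [|j IH] w /=.
  rewrite (bigD1 w)//= eqxx expr1 big1 ?mulr1// => i iw.
  by rewrite eq_sym (negbTE iw) expr0.
by rewrite !IH -big_split; apply: eq_bigr => i _; rewrite exprD.
Qed.

Lemma wfun_sum (I : finType) (f : I -> G -> R) j t :
  \sum_w wfun f (w : word I j) t = (\sum_i f i t) ^+ (2 ^ j).
Proof.
elim: j => [|j IH] /=; first by rewrite expr1.
rewrite expnS mul2n -addnn exprD -IH big_distrlr /= pair_big /=.
by apply: eq_bigr => -[].
Qed.

Lemma wfun_continuous (I : finType) (f : I -> G -> R) j (w : word I j) :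
  (forall i, continuous (f i)) -> continuous (wfun f w).
Proof.
by move=> fc; elim: j w => [|j IH] w //= t; apply: cvgM; exact: IH.
Qed.

Lemma wfun_ge0 (I : finType) (f : I -> G -> R) j (w : word I j) t :
  (forall i t, 0 <= f i t) -> 0 <= wfun f w t.
Proof. by move=> f0; elim: j w => [|j IH] w //=; exact: mulr_ge0. Qed.

Lemma walg_in (I : finType) (d : I -> A) j (w : word I j) :
  (forall i, ssa_set D (d i)) -> ssa_set D (walg d w).
Proof. by move=> Dd; elim: j w => [|j IH] w //=; apply: Dmul. Qed.

Lemma walg_le (I : finType) (d : I -> A) (M : R) j (w : word I j) :
  (forall i, rn (d i) <= M) -> rn (walg d w) <= M ^+ (2 ^ j).
Proof.
move=> dM; elim: j w => [|j IH] w /=; first by rewrite expr1.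
by rewrite expnS mul2n -addnn exprD; exact: rnM_le.
Qed.

Lemma sqpow_lift (I : finType) (f : I -> G -> R) (d : I -> A) (y : nat -> A) j :
  (forall i, continuous (f i)) -> (forall i, ssa_set D (d i)) -> bnd y ->
  nul (fun n => y n - \sum_i X (real_fun (f i)) n ** d i) ->
  nul (fun n => sqpow j (y n) -
    \sum_(w : word I j) X (real_fun (wfun f w)) n ** walg d w).
Proof.
move=> fc Dd yb yn; elim: j => [//|j IH] /=.
have sb : bnd (fun n => \sum_(w : word I j) X (real_fun (wfun f w)) n ** walg d w).
  by apply: bnd_sum => w _; apply/bnd_lift/CG_real/wfun_continuous.
apply: (nul_trans (nulM (bnd_sqpow j yb) sb IH IH)).
have h : nul (fun n => \sum_(p : word I j * word I j)
   ((X (real_fun (wfun f p.1)) n ** walg d p.1) ** (X (real_fun (wfun f p.2)) n ** walg d p.2)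
    - X (real_fun (wfun f p.1) ** real_fun (wfun f p.2)) n ** (walg d p.1 ** walg d p.2))).
  apply: nul_sum => p _; apply: lift_mul; try exact: walg_in;
    by apply/CG_real/wfun_continuous.
apply: eq_nul h => n; rewrite sumrB; congr (_ - _).
  rewrite -(pair_bigA _ (fun v w => (X (real_fun (wfun f v)) n ** walg d v) **
     (X (real_fun (wfun f w)) n ** walg d w))) /=.
  rewrite amul_suml.
  apply: eq_bigr => v _.
  by rewrite amul_sumr.
apply: eq_bigr => p _; congr (X _ n ** _).
by apply/funext => t; rewrite /real_fun rmorphM.
Qed.

Lemma exprD_ge_sum (a b : R) n : 0 <= a -> 0 <= b -> a ^+ n.+1 + b ^+ n.+1 <= (a + b) ^+ n.+1.
Proof.
move=> a0 b0; elim: n => [|n IH]; first by rewrite !expr1.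
rewrite [leRHS]exprS; apply: le_trans (ler_wpM2l (addr_ge0 a0 b0) IH).
rewrite mulrDl !mulrDr -!exprS.
have := mulr_ge0 a0 (exprn_ge0 n.+1 b0); have := mulr_ge0 b0 (exprn_ge0 n.+1 a0); lra.
Qed.

(* All words with the same letter counts carry the same function, which is
   bounded by the inverse of their number; there are only polynomially many
   letter counts. *)
Lemma convex_lift_selfadj (I : finType) (f : I -> G -> R) (d : I -> A) (y : nat -> A) (M : R) :
  (forall i, continuous (f i)) -> (forall i t, 0 <= f i t) ->
  (forall t, \sum_i f i t = 1) -> (forall i, ssa_set D (d i)) ->
  0 <= M -> (forall i, rn (d i) <= M) -> (forall n, star (y n) = y n) -> bnd y ->
  nul (fun n => y n - \sum_i X (real_fun (f i)) n ** d i) -> le_lim y (2 * M).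
Proof.
move=> fc f0 f1 Dd M0 dM ys yb yn.
(* The exponent depends only on the number of letters; a single large power is enough, no limit is
   taken. *)
have [j jP] := exp_dominates #|I|; set L := (2 ^ j)%N in jP.
have sq := sqpow_lift j fc Dd yb yn.
pose T : finType := {ffun I -> 'I_L.+1}.
pose tau (w : word I j) : T := [ffun i => inord (wcount w i)].
have tauE w v t : tau w = tau v -> wfun f w t = wfun f v t.
  move=> wv; rewrite !wfunE; apply: eq_bigr => i _.
  have := congr1 (fun b : T => (b i : nat)) wv; rewrite !ffunE !inordK ?ltnS ?wcount_le//.
  by move=> ->.
have block (b : T) : le_lim (fun n => \sum_(w | tau w == b) X (real_fun (wfun f w)) n ** walg d w)
    (M ^+ L).
  have ML : 0 <= M ^+ L by exact: exprn_ge0.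
  have [w0 /eqP w0b|no] := pickP (fun w => tau w == b); last first.
    move=> e e0; apply: nearW => n; rewrite big_pred0// rn0.
    by rewrite addr_ge0// ltW.
  pose K := #|[pred w | tau w == b]|.
  have K0 : 0 < K%:R :> R by rewrite ltr0n; apply/card_gt0P; exists w0; rewrite inE w0b.
  (* The [K] words of the group contribute [K] equal nonnegative terms to the expansion of
     [(sum_i f_i t)^L = 1]. *)
  have wle t : wfun f w0 t <= K%:R^-1.
    rewrite -[leRHS]mul1r ler_pdivlMr// mulr_natr -(expr1n _ L) -(f1 t) -wfun_sum.
    rewrite (bigID (fun w => tau w == b))/= -[leLHS]addr0 lerD//; last first.
      by apply: sumr_ge0 => w _; exact: wfun_ge0.
    rewrite -sumr_const; apply: ler_sum => w; rewrite inE => /eqP wb.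
    by rewrite (tauE w w0)// wb.
  have h := lift_contractive (c := K%:R^-1) (CG_real (@wfun_continuous _ f j w0 fc)) _
    (ssa_sum (index_enum (word I j)) (fun w => tau w == b) (fun w => @walg_in _ d j w Dd)).
  apply: (@le_lim_nul _ _ (fun n => X (real_fun (wfun f w0)) n ** \sum_(w | tau w == b) walg d w)).
    apply: eq_nul (@nul0 R A) => n; apply/esym/eqP; rewrite subr_eq0; apply/eqP.
    rewrite amul_sumr.
    apply: eq_bigr => w /eqP wb; congr (X _ n ** _).
    by apply/funext => t; rewrite /real_fun (tauE w w0)// wb.
  apply: le_lim_le (h _) => [|t].
    rewrite mulrC ler_pdivrMr// mulr_natr -sumr_const (le_trans (rn_sum _ _ _))//.
    by apply: ler_sum => w _; exact: walg_le.
  rewrite /real_fun /rn normc_def /= expr0n addr0 sqrtr_sqr ger0_norm ?wle//.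
  exact: wfun_ge0.
have tot : le_lim (fun n => sqpow j (y n)) ((2 * M) ^+ L).
  apply: (le_lim_nul sq).
  have := le_lim_sum (index_enum T) block.
  rewrite sumr_const card_ffun card_ord => h.
  have h2 : le_lim (fun n => \sum_(w : word I j) X (real_fun (wfun f w)) n ** walg d w)
      (M ^+ L *+ L.+1 ^ #|I|).
    move=> e e0; apply: filterS (h e e0) => n.
    by rewrite [X in _ -> rn X <= _](partition_big tau xpredT).
  apply: le_lim_le h2; rewrite exprMn -mulr_natl ler_wpM2r ?exprn_ge0//.
  by rewrite -natrX ler_nat.
have L1 : L = L.-1.+1 by rewrite prednK// expn_gt0.
(* The root is extracted by means of [(2 M)^L + e^L <= (2 M + e)^L]. *)
move=> e e0; have eL : 0 < e ^+ L by exact: exprn_gt0.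
apply: filterS (tot _ eL) => n; rewrite (sqpow_norm j (ys n)).2 -/L => h.
rewrite -(@ler_pXn2r _ L) ?nnegrE ?rn_ge0 ?addr_ge0 ?mulr_ge0 ?(ltW e0)//; last first.
  by rewrite expn_gt0.
rewrite (le_trans h)// L1; apply: exprD_ge_sum; rewrite ?mulr_ge0//.
exact: ltW.
Qed.

(** The selfadjoint case is applied to [star z ** z]: it is again a convex lift, over pairs, with
    functions [f_i f_j] and coefficients [star d_i ** d_j] of norm at most [M^2]. This gives
    [2 M^2 <= (2 M)^2]. *)
Lemma convex_lift (I : finType) (f : I -> G -> R) (d : I -> A) (M : R) :
  (forall i, continuous (f i)) -> (forall i t, 0 <= f i t) ->
  (forall t, \sum_i f i t = 1) -> (forall i, ssa_set D (d i)) ->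
  0 <= M -> (forall i, rn (d i) <= M) ->
  le_lim (fun n => \sum_i X (real_fun (f i)) n ** d i) (2 * M).
Proof.
move=> fc f0 f1 Dd M0 dM; set z := fun n => _.
have zb : bnd z by apply: bnd_sum => i _; exact/bnd_lift/CG_real.
have zb' : bnd (fun n => \sum_i X (real_fun (f i)) n ** star (d i)).
  by apply: bnd_sum => i _; exact/bnd_lift/CG_real.
have zs : nul (fun n => star (z n) - \sum_i X (real_fun (f i)) n ** star (d i)).
  have h : nul (fun n => \sum_i (star (X (real_fun (f i)) n ** d i) -
      X (star (real_fun (f i))) n ** star (d i))).
    by apply: nul_sum => i _; apply: lift_star => //; exact: CG_real.
  apply: eq_nul h => n; rewrite sumrB /z star_sum.
  congr (_ - _); apply: eq_bigr => i _; congr (X _ n ** _).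
  by apply/funext => t; exact: conjc_real.
apply: le_limC; first by rewrite mulr_ge0.
apply: (@le_lim_le _ _ _ (2 * M ^+ 2)).
  by rewrite exprMn ler_wpM2r ?sqr_ge0// expr2 ler_peMr// ler1n.
apply: (@convex_lift_selfadj (I * I)%type (fun p t => f p.1 t * f p.2 t)
  (fun p => star (d p.1) ** d p.2)).
- by move=> p t; apply: cvgM; exact: fc.
- by move=> p t; exact: mulr_ge0.
- move=> t; rewrite -(pair_bigA _ (fun i j => f i t * f j t))/= -big_distrlr /= f1.
  by rewrite mulr1.
- by move=> p; apply: Dmul => //; exact: Dstar.
- exact: sqr_ge0.
- by move=> p; rewrite expr2; apply: rnM_le => //; rewrite rn_star.
- by move=> n; rewrite starM starK.
- by apply: bndM => //; exact: bnd_star.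
have h : nul (fun n => \sum_(p : I * I)
   ((X (real_fun (f p.1)) n ** star (d p.1)) ** (X (real_fun (f p.2)) n ** d p.2)
    - X (real_fun (f p.1) ** real_fun (f p.2)) n ** (star (d p.1) ** d p.2))).
  apply: nul_sum => p _; apply: lift_mul => //; try exact: CG_real; exact: Dstar.
have zz : nul (fun n => z n - z n) by apply: eq_nul (@nul0 R A) => n; rewrite subrr.
apply: (nul_trans (nulM (bnd_star zb) zb zs zz)).
apply: eq_nul h => n; rewrite sumrB; congr (_ - _).
  rewrite -(pair_bigA _ (fun v w => (X (real_fun (f v)) n ** star (d v)) **
     (X (real_fun (f w)) n ** d w))) /=.
  rewrite amul_suml.
  apply: eq_bigr => v _.
  by rewrite /z amul_sumr.
apply: eq_bigr => p _; congr (X _ n ** _).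
by apply/funext => t; rewrite /real_fun rmorphM.
Qed.

Lemma convex_lift_seq (s : seq G) (f : G -> G -> R) (d : G -> A) (M : R) :
  (forall p, continuous (f p)) -> (forall p t, 0 <= f p t) ->
  (forall t, \sum_(p <- s) f p t = 1) -> (forall p, ssa_set D (d p)) ->
  0 <= M -> (forall p, rn (d p) <= M) ->
  le_lim (fun n => \sum_(p <- s) X (real_fun (f p)) n ** d p) (2 * M).
Proof.
move=> fc f0 f1 Dd M0 dM e e0.
have := @convex_lift 'I_(size s) (fun i => f (tnth (in_tuple s) i))
  (fun i => d (tnth (in_tuple s) i)) M.
move=> /(_ _ _ _ _ _ _ e e0) h.
apply: filterS (h _ _ _ _ _ _) => // n; first by rewrite [X in _ -> rn X <= _]big_tnth.
by rewrite -[RHS](f1 n) [RHS]big_tnth.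
Qed.

Lemma lift_lincomb (I : eqType) (r : seq I) (c : I -> R[i]) (f : I -> G -> R[i]^o) d :
  (forall i, CG (f i)) -> ssa_set D d ->
  CG (\sum_(i <- r) c i *: f i) /\
  nul (fun n => X (\sum_(i <- r) c i *: f i) n ** d - \sum_(i <- r) c i *: (X (f i) n ** d)).
Proof.
move=> fc Dd; elim: r => [|i r [IHc IHn]].
  rewrite big_nil; split; first exact: (@CG_cst R G 0).
  by apply: eq_nul (lift0 Dd) => n; rewrite big_nil subr0.
rewrite big_cons; split; first exact: (CGP (c := c i) (fc i) IHc).
apply: (nul_trans (lift_scaled_sum _ (fc i) IHc Dd)).
by apply: eq_nul IHn => n; rewrite big_cons; zmod.
Qed.

(* The Rokhlin homomorphism is bounded on the algebraic tensor product of
   [C(G)] and [D] for the norm of [C(G, D)]. *)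
Lemma lift_tensor_bound (I : eqType) (r : seq I) (f : I -> G -> R[i]^o) (d : I -> A) (c : R) :
  (forall i, CG (f i)) -> (forall i, ssa_set D (d i)) -> 0 <= c ->
  (forall t, rn (\sum_(i <- r) f i t *: d i) <= c) ->
  le_lim (fun n => \sum_(i <- r) X (f i) n ** d i) (2 * c).
Proof.
move=> fc Dd c0 fdc; apply: le_lim_closed => e e0.
pose S := \sum_(i <- r) rn (d i).
have S0 : 0 <= S by apply: sumr_ge0 => i _; exact: rn_ge0.
have S1 : 0 < S + 1 by rewrite ltr_wpDl.
pose dl := e / (S + 1); have dl0 : 0 < dl by rewrite divr_gt0.
have [t0|s [g [g1 g2 g3 g4]]] := @partition_of_unity R G Ghaus Gcompact
  (fun p => [set t | forall i, i \in r -> rn (f i t - f i p) < dl]).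
  by apply: near_all_seq => i _; exact: (rn_near_point (V := R[i]^o) t0 (fc i) dl0).
have gc p : CG (real_fun (g p)) by exact: CG_real.
(* Sampling each [f i] at the points of a fine partition splits the sum in two. The sampled part is
   a convex lift with coefficients [sum_i f_i(p) d_i], bounded by [c] for every [p]; in the
   remainder, coarse termwise estimates suffice because each [f i - comb i] is at most [dl]. *)
pose comb i := \sum_(p <- s) f i p *: real_fun (g p).
have combc i : CG (comb i) by have [] := lift_lincomb s (f i) gc (Dd i).
pose h i := -1 *: comb i + f i.
have hc i : CG (h i) by exact: CGP.
have hdl i : i \in r -> forall t, rn (h i t) <= dl.
  move=> ir t; have g1C : \sum_(p <- s) (g p t)%:C%C = 1 :> R[i].
    by rewrite -(rmorph_sum (real_complex R)) g3.
  have -> : h i t = \sum_(p <- s) (g p t)%:C%C *: (f i t - f i p : R[i]^o).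
    have -> : h i t = - (comb i t) + f i t by rewrite -scaleN1r.
    rewrite /comb fct_sumE -sumrN -{1}[f i t]mul1r -g1C mulr_suml -big_split /=.
    apply: eq_bigr => p _; rewrite scalerBr addrC; congr (_ - _).
    exact: mulrC.
  rewrite (le_trans (rn_sum _ _ _))//.
  have -> : dl = \sum_(p <- s) g p t * dl by rewrite -mulr_suml g3 mul1r.
  apply: ler_sum => p _; rewrite rnZr (ger0_norm (g2 p t)).
  have [->|gp] := eqVneq (g p t) 0; first by rewrite !mul0r.
  by rewrite ler_wpM2l//; apply/ltW/(g4 p t gp).
pose d' p := \sum_(i <- r) f i p *: d i.
have Dd' p : ssa_set D (d' p) by apply: ssa_sum => i; exact: DZ.
have n1 : nul (fun n => \sum_(i <- r) X (f i) n ** d i -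
   (\sum_(i <- r) X (h i) n ** d i + \sum_(p <- s) X (real_fun (g p)) n ** d' p)).
  have n2 : nul (fun n => \sum_(i <- r) (X (f i) n ** d i -
     (X (h i) n ** d i + \sum_(p <- s) f i p *: (X (real_fun (g p)) n ** d i)))).
    apply: nul_sum => i _.
    have m1 := lift_scaled_sum (-1) (combc i) (fc i) (Dd i).
    have [_ m2] := lift_lincomb s (f i) gc (Dd i).
    apply: eq_nul (nulD (nulN m1) m2) => n; rewrite -/(comb i) -/(h i) scaleN1r.
    zmod.
  apply: eq_nul n2 => n; rewrite sumrB big_split /=; congr (_ - (_ + _)).
  rewrite exchange_big /=; apply: eq_bigr => p _.
  rewrite /d' amul_sumr.
  by apply: eq_bigr => i _; rewrite amulZr.
apply: (le_lim_nul n1); rewrite addrC; apply: le_limD; last first.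
  by apply: convex_lift_seq.
have h1 : le_lim (fun n => \sum_(i <- r) X (h i) n ** d i) (\sum_(i <- r) dl * rn (d i)).
  rewrite big_seq => e' e0'.
  have h2 i : le_lim (fun n => if i \in r then X (h i) n ** d i else 0)
      (if i \in r then dl * rn (d i) else 0).
    have [ir|_] := boolP (i \in r); last by apply: le_lim_cst; rewrite rn0.
    apply: lift_contractive => //; exact: hdl.
  have := le_lim_sum r h2 e0'; apply: filterS => n.
  by rewrite -!big_mkcond -!big_seq.
apply: le_lim_le h1; rewrite -mulr_sumr -/S /dl mulrAC ler_pdivrMr//.
by rewrite ler_pM2l// lerDl.
Qed.

End KeyEstimate.

(** * Averages along orbits and fixed elements near almost invariant ones *)

Section Averaging.
Context {R : realType} {A : cstarAlgType R} {G : topGroupType}.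
Variable alpha : cstar_action G A.
Hypotheses (Ghaus : hausdorff_space G) (Gcompact : compact [set: G]).

Section WithLift.
Variables (D : starSubalg A) (X : (G -> R[i]^o) -> nat -> A).
Hypotheses (HX : rokhlin_lift alpha (ssa_set D) X)
  (Dinv : invariant_set alpha (ssa_set D)).

Lemma lift_tensor_bound_in (I : eqType) (r : seq I) (f : I -> G -> R[i]^o) (d : I -> A) (c : R) :
  (forall i, CG (f i)) -> (forall i, i \in r -> ssa_set D (d i)) -> 0 <= c ->
  (forall t, rn (\sum_(i <- r) f i t *: d i) <= c) ->
  le_lim (fun n => \sum_(i <- r) X (f i) n ** d i) (2 * c).
Proof.
move=> fc Dd c0 h; pose d' i := if i \in r then d i else 0.
have dE (F : I -> A -> A) : \sum_(i <- r) F i (d i) = \sum_(i <- r) F i (d' i).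
  by rewrite !big_seq; apply: eq_bigr => i ir; rewrite /d' ir.
have := lift_tensor_bound Ghaus Gcompact HX (r := r) (d := d') fc _ c0.
move=> /(_ _ _ _ _) h' e e0; apply: filterS (h' _ _ e e0).
- by move=> n; rewrite (dE (fun i a => X (f i) n ** a)).
- by move=> i; rewrite /d'; case: ifP => [/Dd//|_]; exact: ssa0.
- by move=> t; rewrite -(dE (fun i a => f i t *: a)).
Qed.

Variables (s : seq G) (g : G -> G -> R).
Hypotheses (g_cont : forall p, continuous (g p)) (g_ge0 : forall p t, 0 <= g p t)
  (g_sum : forall t, \sum_(p <- s) g p t = 1).

Let rg p := real_fun (g p).
Let rgc p : CG (rg p). Proof. exact: CG_real. Qed.

(** The map [psi] of the overview: the [n]-th term of a lift of the function
    [t |-> sum_p g_p(t) alpha_p(a)], which is close to [t |-> alpha_t(a)]. *)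
Definition orbit_average n a := \sum_(p <- s) X (rg p) n ** alpha p a.

Lemma g_sumC t : \sum_(p <- s) (g p t)%:C%C = 1 :> R[i].
Proof. by rewrite -(rmorph_sum (real_complex R)) g_sum. Qed.

Lemma lift_partition d : ssa_set D d -> nul (fun n => \sum_(p <- s) X (rg p) n ** d - d).
Proof.
move=> Dd; have [_ h] := lift_lincomb HX s (fun=> 1) rgc Dd.
have e : \sum_(p <- s) 1 *: rg p = cst 1.
  apply/funext => t; rewrite fct_sumE -[RHS](g_sumC t); apply: eq_bigr => p _.
  by rewrite scale1r.
rewrite e in h; apply: eq_nul (nulB (rl_one HX Dd) h) => n.
have -> : \sum_(p <- s) X (rg p) n ** d = \sum_(p <- s) 1 *: (X (rg p) n ** d).
  by apply: eq_bigr => p _; rewrite scale1r.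
by zmod.
Qed.

Lemma orbit_average_le a : ssa_set D a -> le_lim (fun n => orbit_average n a) (2 * rn a).
Proof.
move=> Da; apply: (convex_lift_seq HX) => //.
- by move=> p; exact: Dinv.
- exact: rn_ge0.
- by move=> p; rewrite rn_alpha.
Qed.

Lemma orbit_average_near a (dl : R) : ssa_set D a -> (forall p, rn (alpha p a - a) <= dl) ->
  le_lim (fun n => orbit_average n a - a) (2 * dl).
Proof.
move=> Da adl.
have dl0 : 0 <= dl := le_trans (rn_ge0 _) (adl point).
apply: (@le_lim_nul _ _ (fun n => \sum_(p <- s) X (rg p) n ** (alpha p a - a))).
  apply: eq_nul (lift_partition Da) => n; rewrite /orbit_average.
  under [X in _ = _ - X]eq_bigr do rewrite amulBr.
  by rewrite sumrB; zmod.
apply: (convex_lift_seq HX) => // p.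
rewrite -[X in ssa_set D X]addrC -scaleN1r; apply: ssaP => //; exact: Dinv.
Qed.

Lemma equi_orbit_average a : equi alpha (fun n => orbit_average n a).
Proof.
apply: equi_sum => p; apply: equiM; [exact: (rl_bnd HX)|exact: bnd_cst| |exact: equi_cst].
exact: (rl_equi HX).
Qed.

Variables (a : A) (eps : R).
Hypotheses (Da : ssa_set D a) (eps0 : 0 < eps)
  (ga : forall p t, g p t != 0 -> rn (alpha t a - alpha p a) < eps).

Lemma orbit_partition_near t : rn (\sum_(p <- s) (g p t)%:C%C *: alpha p a - alpha t a) <= eps.
Proof.
have -> : \sum_(p <- s) (g p t)%:C%C *: alpha p a - alpha t a =
   \sum_(p <- s) (g p t)%:C%C *: (alpha p a - alpha t a).
  rewrite -{1}[alpha t a]scale1r -(g_sumC t) scaler_suml -sumrB.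
  by apply: eq_bigr => p _; rewrite scalerBr.
rewrite (le_trans (rn_sum _ _ _))//.
have -> : eps = \sum_(p <- s) g p t * eps by rewrite -mulr_suml g_sum mul1r.
apply: ler_sum => p _; rewrite rnZr (ger0_norm (g_ge0 p t)).
have [->|gp] := eqVneq (g p t) 0; first by rewrite !mul0r.
by rewrite ler_wpM2l// rnBC ltW// ga.
Qed.

(** Translation by [h] turns the approximation of [t |-> alpha_t(a)] into another one of the same
    function. The difference is a single tensor, indexed by tagged points, with pointwise norm at
    most [2 * eps]; the key estimate doubles this. *)
Lemma orbit_average_invariant_at h :
  le_lim (fun n => alpha h (orbit_average n a) - orbit_average n a) (4 * eps).
Proof.
pose r := [seq (true, p) | p <- s] ++ [seq (false, p) | p <- s].
pose f (i : bool * G) := if i.1 then left_translation h (rg i.2) else rg i.2.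
pose d (i : bool * G) := if i.1 then alpha (h * i.2)%g a else - alpha i.2 a.
have rE (V : zmodType) (F : bool * G -> V) : \sum_(i <- r) F i =
    \sum_(p <- s) F (true, p) + \sum_(p <- s) F (false, p).
  by rewrite big_cat !big_map.
have fc i : CG (f i) by rewrite /f; case: ifP => _; [exact: CG_left_translation|].
have n1 : nul (fun n => alpha h (orbit_average n a) - orbit_average n a -
    \sum_(i <- r) X (f i) n ** d i).
  have n2 : nul (fun n => \sum_(p <- s) (alpha h (X (rg p) n) ** alpha (h * p)%g a -
     X (left_translation h (rg p)) n ** alpha (h * p)%g a)).
    by apply: nul_sum => p _; apply: (rl_act HX) => //; exact: Dinv.
  apply: eq_nul n2 => n; rewrite rE /f /d /= sumrB /orbit_average alpha_sum.
  have -> : \sum_(p <- s) alpha h (X (rg p) n ** alpha p a) =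
      \sum_(p <- s) alpha h (X (rg p) n) ** alpha (h * p)%g a.
    by apply: eq_bigr => p _; rewrite alphaM -actM.
  have -> : \sum_(p <- s) X (rg p) n ** - alpha p a =
      - \sum_(p <- s) X (rg p) n ** alpha p a.
    by rewrite -sumrN; apply: eq_bigr => p _; rewrite amulNr.
  by zmod.
apply: (le_lim_nul n1).
rewrite (_ : 4 * eps = 2 * (2 * eps)); last by rewrite mulrA -natrM.
apply: lift_tensor_bound_in => //.
- move=> i _; rewrite /d; case: ifP => _; first exact: Dinv.
  by rewrite -scaleN1r -[_ *: _]addr0; apply: ssaP; [exact: Dinv|exact: ssa0].
- by rewrite mulr_ge0// ltW.
move=> t; rewrite rE /f /d /=.
have -> : \sum_(p <- s) left_translation h (rg p) t *: alpha (h * p)%g a =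
    alpha h (\sum_(p <- s) (g p (h^-1 * t)%g)%:C%C *: alpha p a).
  by rewrite alpha_sum; apply: eq_bigr => p _; rewrite alphaZ actM.
have -> : \sum_(p <- s) rg p t *: - alpha p a = - \sum_(p <- s) (g p t)%:C%C *: alpha p a.
  by rewrite -sumrN; apply: eq_bigr => p _; rewrite scalerN.
rewrite (le_trans (rn_tri (alpha t a) _ _))// mulr2n mulrDl mul1r lerD//; last first.
  by rewrite rnBC orbit_partition_near.
by rewrite -{2}(mulVKg h t) actM -alphaB rn_alpha orbit_partition_near.
Qed.

(** Equicontinuity and compactness make the estimate uniform in [h]: 6 = 4 + 1 + 1, the extra terms
    being the slack in the limit and the variation near [h0]. *)
Lemma orbit_average_invariant :
  \forall n \near \oo, forall h, rn (alpha h (orbit_average n a) - orbit_average n a) <= 6 * eps.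
Proof.
apply: compact_eventually => // h0.
exists [set h | forall n, rn (alpha h (orbit_average n a) - alpha h0 (orbit_average n a)) <= eps].
  exact: equi_orbit_average.
apply: filterS (orbit_average_invariant_at h0 eps0) => n hn h /= hh.
rewrite (le_trans (rn_tri (alpha h0 (orbit_average n a)) _ _))//.
by have := hh n; lra.
Qed.

End WithLift.

Hypotheses (G2 : @second_countable G) (Asu : sigma_unital A) (rok : Rokhlin_property alpha).

Lemma rokhlin_data (l : seq A) : exists (D : starSubalg A) X,
  [/\ rokhlin_lift alpha (ssa_set D) X, invariant_set alpha (ssa_set D)
    & forall x, x \in l -> ssa_set D x].
Proof.
have [D [Dc Ds Di Dl]] := separable_invariant_subalgebra alpha (nth 0 l) G2.
have [X HX] := rokhlin_lift_exists Gcompact Asu rok Dc Ds Di.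
exists D, X; split => // x xl; rewrite -(nth_index 0 xl); exact: Dl.
Qed.

Lemma orbit_partition (l : seq A) (eps : R) : 0 < eps -> exists (s : seq G) (g : G -> G -> R),
  [/\ forall p, continuous (g p), forall p t, 0 <= g p t,
      forall t, \sum_(p <- s) g p t = 1
    & forall a, a \in l -> forall p t, g p t != 0 -> rn (alpha t a - alpha p a) < eps].
Proof.
move=> e0; have [p|s [g [g1 g2 g3 g4]]] := @partition_of_unity R G Ghaus Gcompact
  (fun p => [set t | forall a, a \in l -> rn (alpha t a - alpha p a) < eps]).
  by apply: near_all_seq => a _; exact: alpha_near.
by exists s, g; split => // a al p t /g4; exact.
Qed.

Definition almost_fixed (dl : R) b := forall h, rn (alpha h b - b) <= dl.

(** The displacement is governed by the old tolerance [dl], while the new one [eps] is arbitrary;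
    this is what permits iteration. *)
Lemma improve_fixed (b : A) (dl eps : R) : almost_fixed dl b -> 0 < eps ->
  exists2 b', rn (b' - b) <= 2 * dl + eps & almost_fixed eps b'.
Proof.
move=> bdl e0; have [D [X [HX Di Dl]]] := rokhlin_data [:: b].
have Db : ssa_set D b by apply: Dl; rewrite mem_head.
have e6 : 0 < eps / 6 by rewrite divr_gt0.
have [s [g [g1 g2 g3 g4]]] := orbit_partition [:: b] e6.
have h1 := orbit_average_near HX Di g1 g2 g3 Db bdl e0.
have h2 := orbit_average_invariant HX Di g1 g2 g3 Db e6 (g4 b (mem_head _ _)).
have [n [n1 n2]] := filter_ex (filterI h1 h2).
exists (orbit_average X s g n b) => // h; rewrite (le_trans (n2 h))//; lra.
Qed.

(** Improvements with tolerances [e k = dl * 2^-k] converge. One step moves by at most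
    [2 * e k + e k.+1], less than [6 * e k - 6 * e k.+1], so the total displacement is at most
    [6 * dl]. *)
Lemma nearly_fixed (b : A) (dl : R) : 0 < dl -> almost_fixed dl b ->
  exists2 c, fixed_points alpha c & rn (c - b) <= 6 * dl.
Proof.
move=> dl0 bdl; pose e k := dl * 2 ^- k.
have ek k : 0 < e k by rewrite mulr_gt0// dyadic_gt0.
have step (bk : A * nat) : exists b', almost_fixed (e bk.2) bk.1 ->
    rn (b' - bk.1) <= 3 * e bk.2 /\ almost_fixed (e bk.2.+1) b'.
  have [h|] := pselect (almost_fixed (e bk.2) bk.1); last by exists 0.
  have [b' h1 h2] := improve_fixed h (ek bk.2.+1); exists b' => _; split => //.
  rewrite (le_trans h1)//; have := ek bk.2; rewrite /e exprS invfM; lra.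
have [F FP] := choice step.
pose u := fix u k := if k is k'.+1 then F (u k', k') else b.
have uf k : almost_fixed (e k) (u k).
  elim: k => [|k IH]; first by rewrite /e expr0 invr1 mulr1.
  exact: (FP (u k, k) IH).2.
have du k : rn (u k.+1 - u k) <= - (6 * e k.+1) - - (6 * e k).
  have [h _] := FP (u k, k) (uf k); rewrite (le_trans h)//= /e exprS invfM; lra.
have [|c [_ cu]] := telescoping_cvg du (M := 0).
  by move=> n; rewrite oppr_le0 mulr_ge0// ltW.
exists c; last by have := cu 0%N; rewrite /e expr0 invr1 mulr1 sub0r opprK.
move=> h; apply/eqP; rewrite -subr_eq0; apply/eqP/rn_le0/ler_addgt0Pl => d d0.
(* 13 = 6 + 1 + 6: from [alpha h c] to [alpha h (u k)], then to [u k], then to [c]. *)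
rewrite addr0; have [k kd] : exists k, 13 * e k <= d.
  have c0 : (fun n => 13 * dl * (2^-1 : R) ^+ n) @ \oo --> 13 * dl * 0.
    apply: cvgM; first exact: cvg_cst.
    by apply: cvg_expr; rewrite ger0_norm// invf_lt1// ltr1n.
  rewrite mulr0 in c0; have /cvgr0Pnorm_le/(_ d d0)[N _ NP] := c0.
  exists N; have := NP N (leqnn _); apply: le_trans.
  by rewrite /= exprVn /e mulrA ler_norm.
have h1 := cu k; rewrite sub0r opprK in h1.
have h2 := uf k h; have h3 : rn (alpha h c - alpha h (u k)) <= 6 * e k.
  by rewrite -alphaB rn_alpha.
rewrite (le_trans (rn_tri (alpha h (u k)) _ _))//.
have := rn_tri (u k) (alpha h (u k)) c; rewrite (rnBC (u k)); lra.
Qed.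

End Averaging.

(** * Ideals of the fixed point algebra *)

Section GeneratedIdeal.
Context {R : realType} {A : cstarAlgType R}.

Definition triple_sum (l : seq (A * A * A)) : A := \sum_(p <- l) p.1.1 ** p.1.2 ** p.2.

Definition middle_in (C : set A) (l : seq (A * A * A)) := forall p, p \in l -> C p.1.2.

Definition generated_ideal (C : set A) : set A :=
  closure [set triple_sum l | l in middle_in C].

Variable C : set A.

Lemma generated_idealP x : generated_ideal C x <->
  forall e : R, 0 < e -> exists2 l, middle_in C l & rn (x - triple_sum l) < e.
Proof.
split=> [/rn_closureP h e /h[_ [l lC <-] xl]|h]; first by exists l.
by apply/rn_closureP => e /h[l lC xl]; exists (triple_sum l) => //; exists l.
Qed.

Lemma middle_in_map (F : A * A * A -> A * A * A) l : (forall p, (F p).1.2 = p.1.2) ->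
  middle_in C l -> middle_in C (map F l).
Proof. by move=> FE lC _ /mapP[p pl ->]; rewrite FE; exact: lC. Qed.

Lemma triple_sum_mull b l :
  b ** triple_sum l = triple_sum (map (fun p => (b ** p.1.1, p.1.2, p.2)) l).
Proof.
rewrite /triple_sum big_map amul_sumr.
by apply: eq_bigr => p _; rewrite !amulA.
Qed.

Lemma triple_sum_mulr b l :
  triple_sum l ** b = triple_sum (map (fun p => (p.1.1, p.1.2, p.2 ** b)) l).
Proof.
rewrite /triple_sum big_map.
rewrite amul_suml.
by apply: eq_bigr => p _; rewrite !amulA.
Qed.

Lemma generated_ideal_closed : closed (generated_ideal C).
Proof. exact: closed_closure. Qed.

Lemma generated_ideal_mull b x : generated_ideal C x -> generated_ideal C (b ** x).
Proof.
move=> /generated_idealP Jx; apply/generated_idealP => e e0.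
have b1 : 0 < rn b + 1 by rewrite ltr_wpDl// rn_ge0.
have [l lC xl] := Jx _ (divr_gt0 e0 b1).
eexists; first exact: (@middle_in_map (fun p => (b ** p.1.1, p.1.2, p.2)) l).
rewrite -triple_sum_mull -amulBr (le_lt_trans (rnM _ _))//.
move: xl; rewrite ltr_pdivlMr//; apply: le_lt_trans.
by rewrite mulrC ler_wpM2l ?rn_ge0// lerDl.
Qed.

Lemma generated_ideal_mulr b x : generated_ideal C x -> generated_ideal C (x ** b).
Proof.
move=> /generated_idealP Jx; apply/generated_idealP => e e0.
have b1 : 0 < rn b + 1 by rewrite ltr_wpDl// rn_ge0.
have [l lC xl] := Jx _ (divr_gt0 e0 b1).
eexists; first exact: (@middle_in_map (fun p => (p.1.1, p.1.2, p.2 ** b)) l).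
rewrite -triple_sum_mulr -amulBl (le_lt_trans (rnM _ _))//.
move: xl; rewrite ltr_pdivlMr//; apply: le_lt_trans.
by rewrite ler_wpM2l ?rn_ge0// lerDl.
Qed.

Lemma generated_ideal_triple a c b : C c -> generated_ideal C (a ** c ** b).
Proof.
move=> Cc; apply: subset_closure; exists [:: (a, c, b)].
  by move=> p; rewrite inE => /eqP ->.
by rewrite /triple_sum big_seq1.
Qed.

Lemma generated_idealD x y : generated_ideal C x -> generated_ideal C y ->
  generated_ideal C (x + y).
Proof.
move=> /generated_idealP Jx /generated_idealP Jy; apply/generated_idealP => e e0.
have e2 : 0 < e / 2 by rewrite divr_gt0.
have [l lC xl] := Jx _ e2; have [m mC ym] := Jy _ e2.
exists (l ++ m); first by move=> p; rewrite mem_cat => /orP[/lC|/mC].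
rewrite /triple_sum big_cat /= opprD addrACA (le_lt_trans (rnD _ _))//.
by rewrite [e]splitr ltrD.
Qed.

Lemma generated_ideal0 : generated_ideal C 0.
Proof.
apply: subset_closure; exists [::]; first by [].
by rewrite /triple_sum big_nil.
Qed.

Lemma generated_idealZ (c : R[i]) x : generated_ideal C x -> generated_ideal C (c *: x).
Proof.
move=> /generated_idealP Jx; apply/generated_idealP => e e0.
have c0 : 0 <= complex.Re `|c| by have := normr_ge0 c; rewrite lecE => /andP[].
have c1 : 0 < complex.Re `|c| + 1 by rewrite ltr_wpDl.
have [l lC xl] := Jx _ (divr_gt0 e0 c1).
exists (map (fun p => (c *: p.1.1, p.1.2, p.2)) l); first exact: middle_in_map.
have -> : triple_sum (map (fun p => (c *: p.1.1, p.1.2, p.2)) l) = c *: triple_sum l.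
  by rewrite /triple_sum big_map scaler_sumr; apply: eq_bigr => p _; rewrite !amulZl.
rewrite -scalerBr rnZ; move: xl; rewrite ltr_pdivlMr//; apply: le_lt_trans.
by rewrite mulrC ler_wpM2l ?rn_ge0// lerDl.
Qed.

Lemma generated_ideal_cstar : cstar_ideal (generated_ideal C).
Proof.
split; first by split => //; exact: generated_ideal0.
- by move=> c x y Jx Jy; apply: generated_idealD => //; exact: generated_idealZ.
- by move=> s x _ Jx; split; [exact: generated_ideal_mull|exact: generated_ideal_mulr].
- exact: generated_ideal_closed.
Qed.

Lemma generated_ideal_invariant (G : topGroupType) (alpha : cstar_action G A) :
  C `<=` fixed_points alpha -> invariant_set alpha (generated_ideal C).
Proof.
move=> Cfix h x /generated_idealP Jx; apply/generated_idealP => e /Jx[l lC xl].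
exists (map (fun p => (alpha h p.1.1, p.1.2, alpha h p.2)) l); first exact: middle_in_map.
have -> : triple_sum (map (fun p => (alpha h p.1.1, p.1.2, alpha h p.2)) l) =
    alpha h (triple_sum l).
  rewrite /triple_sum big_map alpha_sum !big_seq; apply: eq_bigr => p pl.
  by rewrite /= !alphaM (Cfix _ (lC p pl)).
by rewrite -alphaB rn_alpha.
Qed.

End GeneratedIdeal.

Section FixedPointIdeals.
Context {R : realType} {A : cstarAlgType R} {G : topGroupType}.
Variable alpha : cstar_action G A.
Hypotheses (Ghaus : hausdorff_space G) (Gcompact : compact [set: G])
  (G2 : @second_countable G) (Asu : sigma_unital A) (rok : Rokhlin_property alpha).

Lemma triple_perturb (a c b u v : A) (e al be : R) : 0 <= e -> e <= 1 ->
  rn (u - a) <= e -> rn (v - b) <= e -> rn a <= al -> rn b <= be ->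
  rn (u ** c ** v - a ** c ** b) <= e * (rn c * (al + be + 1)).
Proof.
move=> e0 e1 ua vb aal bbe.
have -> : u ** c ** v - a ** c ** b = (u - a) ** c ** v + a ** c ** (v - b).
  by rewrite amulBr !amulBl; zmod.
have vle : rn v <= be + 1.
  by rewrite (le_trans (rn_le_dist v b))// lerD// (le_trans vb).
have h1 : rn ((u - a) ** c ** v) <= e * rn c * (be + 1).
  by apply: rnM_le => //; exact: rnM_leLHS.
have h2 : rn (a ** c ** (v - b)) <= al * rn c * e.
  by apply: rnM_le => //; exact: rnM_leLHS.
by rewrite (le_trans (rnD _ _))//; nra.
Qed.

Lemma triple_sum_perturb (l : seq (A * A * A)) (U V : A * A * A -> A)
    (S T : A * A * A -> A) (e : R) (al be : A * A * A -> R) :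
  0 <= e -> e <= 1 ->
  (forall k, k \in l -> [/\ rn (U k - S k) <= e, rn (V k - T k) <= e,
      rn (S k) <= al k & rn (T k) <= be k]) ->
  rn (\sum_(k <- l) U k ** k.1.2 ** V k - \sum_(k <- l) S k ** k.1.2 ** T k) <=
  e * \sum_(k <- l) rn k.1.2 * (al k + be k + 1).
Proof.
move=> e0 e1 h; rewrite -sumrB mulr_sumr (le_trans (rn_sum _ _ _))//.
rewrite !big_seq; apply: ler_sum => k /h[? ? ? ?].
exact: triple_perturb.
Qed.

(** [I] absorbs only fixed elements, so both outer factors of each triple must become fixed. The key
    estimate is what allows the averages to be inserted into the whole sum at once. *)
Lemma fixed_in_ideal (I : set A) (x : A) : cstar_ideal_of (fixed_points alpha) I ->
  generated_ideal I x -> fixed_points alpha x -> I x.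
Proof.
move=> [[Ifix I0] Ilin Iid Icl] /generated_idealP Jx xfix.
apply: (rn_closed Icl) => eps0 e00.
pose e := eps0 / 12; have e0 : 0 < e by rewrite divr_gt0.
have [l lI xl] := Jx e e0.
(* Sensitivity of the sum of triples to errors in its outer factors; [2 * rn a + 1] bounds the
   averages [psi n a]. *)
pose B := \sum_(k <- l) rn k.1.2 * ((2 * rn k.1.1 + 1) + (2 * rn k.2 + 1) + 1).
have B0 : 0 <= B.
  by apply: sumr_ge0 => k _; rewrite mulr_ge0 ?rn_ge0// !addr_ge0// mulr_ge0// rn_ge0.
pose eta1 := Num.min 1 (e / (B + 1)).
have B1 : 0 < B + 1 by rewrite ltr_wpDl.
have eta0 : 0 < eta1 by rewrite lt_min ltr01 divr_gt0.
have eta_le1 : eta1 <= 1 by rewrite ge_min lexx.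
have etaB : eta1 * B <= e.
  have : eta1 <= e / (B + 1) by rewrite ge_min lexx orbT.
  by rewrite ler_pdivlMr//; apply: le_trans; rewrite ler_wpM2l ?(ltW eta0)// lerDl.
(* 36 = 6 * 6: averages are fixed up to [6 * eps1], and [nearly_fixed] costs another factor 6. *)
pose eps1 := eta1 / 36.
have eps10 : 0 < eps1 by rewrite divr_gt0.
have eps1_le1 : eps1 <= 1 by rewrite /eps1; lra.
pose els := [seq k.1.1 | k <- l] ++ [seq k.2 | k <- l].
have els1 k : k \in l -> k.1.1 \in els.
  by move=> kl; rewrite mem_cat (map_f (fun k : A * A * A => k.1.1)).
have els2 k : k \in l -> k.2 \in els.
  by move=> kl; rewrite mem_cat orbC (map_f (fun k : A * A * A => k.2)).
have [D [X [HX Di Dl]]] := rokhlin_data Gcompact G2 Asu rok (x :: els ++ [seq k.1.2 | k <- l]).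
have Dx : ssa_set D x by apply: Dl; rewrite mem_head.
have Del a : a \in els -> ssa_set D a.
  by move=> al; apply: Dl; rewrite in_cons mem_cat al orbT.
have Dmid k : k \in l -> ssa_set D k.1.2.
  move=> kl; apply: Dl; rewrite in_cons mem_cat.
  by rewrite (map_f (fun k : A * A * A => k.1.2))// !orbT.
have [s [g [g1 g2 g3 g4]]] := orbit_partition alpha Ghaus Gcompact els eps10.
pose psi n a := orbit_average alpha X s g n a.
(* The function t |-> sum_k (sum_p g_p(t) alpha_p a_k) c_k (sum_q g_q(t) alpha_q b_k) - x
   is uniformly small, being close to t |-> alpha_t (triple_sum l - x). *)
have main : le_lim (fun n => \sum_(k <- l) psi n k.1.1 ** k.1.2 ** psi n k.2 - x) (4 * e).
  (* [None] carries [- x] with the constant function 1, so that [x] takes part in the same tensor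
     estimate as the triples. *)
  pose r := None :: [seq Some (k, pq) | k <- l, pq <- [seq (p, q) | p <- s, q <- s]].
  pose f (i : option ((A * A * A) * (G * G))) : G -> R[i]^o :=
    if i is Some (_, (p, q)) then real_fun (g p) ** real_fun (g q) else cst 1.
  pose d (i : option ((A * A * A) * (G * G))) : A :=
    if i is Some (k, (p, q)) then alpha p k.1.1 ** k.1.2 ** alpha q k.2 else - x.
  have rE (V : zmodType) (F : option ((A * A * A) * (G * G)) -> V) :
      \sum_(i <- r) F i =
      F None + \sum_(k <- l) \sum_(p <- s) \sum_(q <- s) F (Some (k, (p, q))).
    rewrite /r big_cons; congr (_ + _); rewrite big_allpairs_dep /=.
    by apply: eq_bigr => k _; rewrite big_allpairs_dep.
  have fc i : CG (f i).
    case: i => [[k [p q]]|] /=; last exact: CG_cst.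
    by apply: CGM; exact: CG_real.
  have Dd i : i \in r -> ssa_set D (d i).
    case: i => [[k [p q]]|] /=; last first.
      by move=> _; rewrite -scaleN1r -[_ *: _]addr0; apply: ssaP => //; exact: ssa0.
    rewrite /r in_cons /= => /allpairsP[[k' pq] /= [kl _ [-> _]]].
    apply: ssaM; last by apply: Di; apply: Del; exact: els2.
    by apply: ssaM; [apply: Di; apply: Del; exact: els1|exact: Dmid].
  have ev t : rn (\sum_(i <- r) f i t *: d i) <= 2 * e.
    rewrite rE /f /d /= scale1r.
    pose at_ a := \sum_(p <- s) (g p t)%:C%C *: alpha p a.
    have -> : \sum_(k <- l) \sum_(p <- s) \sum_(q <- s)
        (real_fun (g p) ** real_fun (g q)) t *: (alpha p k.1.1 ** k.1.2 ** alpha q k.2) =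
        \sum_(k <- l) at_ k.1.1 ** k.1.2 ** at_ k.2.
      apply: eq_bigr => k _; rewrite /at_.
      rewrite !amul_suml.
      apply: eq_bigr => p _.
      rewrite amul_sumr.
      by apply: eq_bigr => q _; rewrite amulZr !amulZl scalerA mulrC.
    have h1 : rn (\sum_(k <- l) at_ k.1.1 ** k.1.2 ** at_ k.2 -
        \sum_(k <- l) alpha t k.1.1 ** k.1.2 ** alpha t k.2) <= e.
      apply: le_trans etaB; apply: le_trans (@triple_sum_perturb l (fun k => at_ k.1.1)
        (fun k => at_ k.2) (fun k => alpha t k.1.1) (fun k => alpha t k.2) eps1
        (fun k => rn k.1.1) (fun k => rn k.2) (ltW eps10) eps1_le1 _) _.
        move=> k kl; rewrite !rn_alpha; split => //.
          exact: (orbit_partition_near g2 g3 (g4 _ (els1 k kl))).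
        exact: (orbit_partition_near g2 g3 (g4 _ (els2 k kl))).
      have S0 : 0 <= \sum_(k <- l) rn k.1.2 * (rn k.1.1 + rn k.2 + 1).
        by apply: sumr_ge0 => k _; rewrite mulr_ge0 ?rn_ge0// !addr_ge0// rn_ge0.
      have SB : \sum_(k <- l) rn k.1.2 * (rn k.1.1 + rn k.2 + 1) <= B.
        apply: ler_sum => k _; rewrite ler_wpM2l ?rn_ge0//.
        by have := rn_ge0 k.1.1; have := rn_ge0 k.2; lra.
      by rewrite ler_pM// ?(ltW eps10)// /eps1; lra.
    have h2 : rn (\sum_(k <- l) alpha t k.1.1 ** k.1.2 ** alpha t k.2 - x) <= e.
      have -> : \sum_(k <- l) alpha t k.1.1 ** k.1.2 ** alpha t k.2 = alpha t (triple_sum l).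
        rewrite /triple_sum alpha_sum !big_seq; apply: eq_bigr => k kl.
        by rewrite !alphaM (Ifix _ (lI k kl)).
      by rewrite -{1}(xfix t) -alphaB rn_alpha rnBC ltW.
    set P := \sum_(k <- l) at_ k.1.1 ** k.1.2 ** at_ k.2 in h1 *.
    rewrite [- x + P]addrC mulr2n mulrDl mul1r; exact: le_trans (rn_tri _ _ _) (lerD h1 h2).
  have e2 : 0 <= 2 * e by rewrite mulr_ge0// ltW.
  have := lift_tensor_bound_in Ghaus Gcompact HX fc Dd e2 ev.
  rewrite mulrA -natrM => h; apply: le_lim_nul h.
  have n1 : nul (fun n => \sum_(k <- l) \sum_(p <- s) \sum_(q <- s)
     ((X (real_fun (g p)) n ** (alpha p k.1.1 ** k.1.2)) ** (X (real_fun (g q)) n ** alpha q k.2) -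
      X (real_fun (g p) ** real_fun (g q)) n ** ((alpha p k.1.1 ** k.1.2) ** alpha q k.2))).
    apply: nul_sum => k kl; apply: nul_sum => p _; apply: nul_sum => q _.
    apply: (lift_mul HX); [exact: CG_real|exact: CG_real| |].
      by apply: ssaM; [apply: Di; apply: Del; exact: els1|exact: Dmid].
    by apply: Di; apply: Del; exact: els2.
  apply: eq_nul (nulD n1 (rl_one HX Dx)) => n.
  rewrite rE /f /d /= amulNr.
  have -> : \sum_(k <- l) psi n k.1.1 ** k.1.2 ** psi n k.2 =
     \sum_(k <- l) \sum_(p <- s) \sum_(q <- s)
     ((X (real_fun (g p)) n ** (alpha p k.1.1 ** k.1.2)) ** (X (real_fun (g q)) n ** alpha q k.2)).
    apply: eq_bigr => k _; rewrite /psi /orbit_average.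
    rewrite !amul_suml.
    apply: eq_bigr => p _.
    rewrite amul_sumr.
    by apply: eq_bigr => q _; rewrite !amulA.
  under eq_bigr => k _ do under eq_bigr => p _ do rewrite sumrB.
  under eq_bigr => k _ do rewrite sumrB.
  rewrite sumrB; zmod.
have near1 : \forall n \near \oo, forall a, a \in els ->
    almost_fixed alpha (6 * eps1) (psi n a) /\ rn (psi n a) <= 2 * rn a + 1.
  apply: near_all_seq => a ael.
  have a1 := orbit_average_invariant Ghaus Gcompact HX Di g1 g2 g3 (Del a ael) eps10 (g4 a ael).
  have a2 := orbit_average_le HX Di g1 g2 g3 (Del a ael) ltr01.
  by apply: filterS2 a1 a2.
have [n [n1 n2]] := filter_ex (filterI (main e e0) near1).
have fixc a : exists c, a \in els -> fixed_points alpha c /\ rn (c - psi n a) <= eta1.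
  have [ael|] := boolP (a \in els); last by exists 0.
  have e6 : 0 < 6 * eps1 by rewrite mulr_gt0.
  have [c c1 c2] := nearly_fixed Ghaus Gcompact G2 Asu rok e6 (n2 a ael).1.
  by exists c => _; split => //; rewrite (le_trans c2)// /eps1; lra.
have [F FP] := choice fixc.
exists (\sum_(k <- l) F k.1.1 ** k.1.2 ** F k.2).
  rewrite big_seq; elim/big_rec: _ => [//|k y kl Iy].
  rewrite -[X in I (X + _)]scale1r; apply: Ilin => //.
  have [f1 _] := FP _ (els1 k kl); have [f2 _] := FP _ (els2 k kl).
  by apply: (Iid _ _ f2 (Iid _ _ f1 (lI k kl)).1).2.
have h := @triple_sum_perturb l (fun k => F k.1.1) (fun k => F k.2)
  (fun k => psi n k.1.1) (fun k => psi n k.2) eta1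
  (fun k => 2 * rn k.1.1 + 1) (fun k => 2 * rn k.2 + 1) (ltW eta0) eta_le1.
have {}h : rn (\sum_(k <- l) F k.1.1 ** k.1.2 ** F k.2 -
    \sum_(k <- l) psi n k.1.1 ** k.1.2 ** psi n k.2) <= e.
  apply: le_trans (h _) etaB => k kl.
  have [_ f1] := FP _ (els1 k kl); have [_ f2] := FP _ (els2 k kl).
  by split => //; [exact: (n2 _ (els1 k kl)).2|exact: (n2 _ (els2 k kl)).2].
rewrite rnBC (le_lt_trans (rn_tri (\sum_(k <- l) psi n k.1.1 ** k.1.2 ** psi n k.2) _ _))//.
rewrite (le_lt_trans (lerD h n1))//; rewrite /e; lra.
Qed.

(** Fixed elements within [1 / (m + 1)] of the almost invariant unit, replaced by their real parts
    so that a left approximate unit is a right one too. The bound 2 comes from [1 + 1 / (m + 1)]. *)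
Lemma fixed_unit : exists c : nat -> A,
  [/\ forall n, fixed_points alpha (c n), forall n, rn (c n) <= 2,
    forall a, nul (fun n => c n ** a - a) & forall a, nul (fun n => a ** c n - a)].
Proof.
have [x [xs x1 xi xu]] := invariant_unit alpha Gcompact Asu.
have step m : exists c, (fixed_points alpha c /\ star c = c) /\
    exists2 n, (m <= n)%N & rn (c - x n) <= m.+1%:R^-1.
  have e0 : 0 < m.+1%:R^-1 / 6 :> R by rewrite divr_gt0.
  have [N _ NP] := xi _ e0.
  have [c c1 c2] := nearly_fixed Ghaus Gcompact G2 Asu rok e0 (NP (m + N)%N (leq_addl _ _)).
  exists (half *: (c + star c)); split.
    split; last by rewrite starZr starD starK addrC.
    by move=> g; rewrite alphaZ alphaD alphaS c1.
  exists (m + N)%N; first exact: leq_addr.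
  have -> : half *: (c + star c) - x (m + N)%N =
      half *: ((c - x (m + N)%N) + star (c - x (m + N)%N)).
    rewrite starB xs -{1}(halfD (x (m + N)%N)) -scalerDr -scalerBr.
    by congr (_ *: _); zmod.
  have h : rn (c - x (m + N)%N) <= m.+1%:R^-1 by rewrite (le_trans c2)// mulrC divfK.
  rewrite rn_half ler_pdivrMr// (le_trans (rnD _ _))// rn_star.
  by rewrite mulr_natr mulr2n lerD.
have [c cP] := choice step.
have cu a : nul (fun n => c n ** a - a).
  move=> e e0; have a1 : 0 < rn a + 1 by rewrite ltr_wpDl// rn_ge0.
  have e2 : 0 < e / 2 by rewrite divr_gt0.
  have [N _ NP] := xu a _ e2.
  have [M _ MP] := near_infty_natSinv_lt (PosNum (divr_gt0 e2 a1)).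
  exists (N + M)%N => // m /= Nm; have [_ [n mn cx]] := cP m.
  have h1 := NP n (leq_trans (leq_trans (leq_addr _ _) Nm) mn).
  have h2 := MP m (leq_trans (leq_addl _ _) Nm); rewrite /= in h1 h2.
  have -> : c m ** a - a = (c m - x n) ** a + (x n ** a - a).
    by rewrite amulBl; zmod.
  rewrite (le_lt_trans (rnD _ _))// [e]splitr ltr_leD//; last exact: ltW.
  have h3 : rn ((c m - x n) ** a) <= m.+1%:R^-1 * rn a by exact: rnM_leLHS.
  rewrite (le_lt_trans h3)//; move: h2; rewrite ltr_pdivlMr//; apply: le_lt_trans.
  by rewrite ler_wpM2l// lerDl.
have cs n : star (c n) = c n by have [[]] := cP n.
exists c; split => //.
- by move=> n; have [[]] := cP n.
- move=> n; have [_ [m _ h]] := cP n; rewrite (le_trans (rn_le_dist _ (x m)))//.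
  have h2 : n.+1%:R^-1 <= 1 :> R by rewrite invf_le1// ler1n.
  by rewrite (_ : 2 = 1 + 1) ?lerD// (le_trans h).
- move=> a; apply: eq_nul (nul_star (cu (star a))) => n.
  by rewrite starB starM starK cs.
Qed.

Lemma ideal_of_fixed_points (I : set A) : cstar_ideal_of (fixed_points alpha) I ->
  exists J, [/\ cstar_ideal J, invariant_set alpha J & I = J `&` fixed_points alpha].
Proof.
move=> Iid; have [[Ifix _] _ _ _] := Iid; exists (generated_ideal I); split.
- exact: generated_ideal_cstar.
- exact: generated_ideal_invariant.
apply/seteqP; split => [y Iy|y [Jy yfix]]; last exact: fixed_in_ideal.
split; last exact: Ifix.
have [c [_ c2 cl cr]] := fixed_unit.
have cb : bnd c by exists 2.
apply: (rn_closed (@generated_ideal_closed _ _ I)) => e e0.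
have h : nul (fun n => c n ** y ** c n - y).
  apply: (@nul_trans _ _ (fun n => y ** c n)); last exact: cr.
  by apply: eq_nul (nulMr cb (cl y)) => n; rewrite amulBl.
have [n hn] := filter_ex (h e e0).
exists (c n ** y ** c n); first exact: generated_ideal_triple.
by rewrite rnBC.
Qed.

End FixedPointIdeals.

(** * Ideals of the crossed product *)

Section Saturation.
Context {R : realType} {A : cstarAlgType R} {G : topGroupType}.
Variable alpha : cstar_action G A.
Hypotheses (Ghaus : hausdorff_space G) (Gcompact : compact [set: G])
  (G2 : @second_countable G) (Asu : sigma_unital A) (rok : Rokhlin_property alpha).
Variable C : set A.

Definition bracket_sum (l : seq (A * A * A)) (s : G) : A :=
  \sum_(p <- l) p.1.1 ** p.1.2 ** alpha s p.2.

Definition bracket_limit (h : G -> A) := forall e : R, 0 < e ->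
  exists2 l, middle_in C l & forall s, rn (h s - bracket_sum l s) <= e.

Lemma bracket_limit_closed (h : G -> A) :
  (forall e : R, 0 < e -> exists2 h', bracket_limit h' & forall s, rn (h s - h' s) <= e) ->
  bracket_limit h.
Proof.
move=> H e e0; have e2 : 0 < e / 2 by rewrite divr_gt0.
have [h' hl hh] := H _ e2; have [l lC hl'] := hl _ e2.
exists l => // s; rewrite (le_trans (rn_tri (h' s) _ _))// [e]splitr lerD//.
Qed.

Lemma bracket_limitD (h k : G -> A) : bracket_limit h -> bracket_limit k ->
  bracket_limit (fun s => h s + k s).
Proof.
move=> H K e e0; have e2 : 0 < e / 2 by rewrite divr_gt0.
have [l lC hl] := H _ e2; have [m mC km] := K _ e2.
exists (l ++ m); first by move=> p; rewrite mem_cat => /orP[/lC|/mC].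
move=> s; rewrite /bracket_sum big_cat /= opprD addrACA (le_trans (rnD _ _))//.
by rewrite [e]splitr lerD.
Qed.

Lemma bracket_limit_sum (I : eqType) (r : seq I) (F : I -> G -> A) :
  (forall i, i \in r -> bracket_limit (F i)) -> bracket_limit (fun s => \sum_(i <- r) F i s).
Proof.
elim: r => [_|i r IH H].
  move=> e e0; exists [::] => // s.
  by rewrite big_nil /bracket_sum big_nil subr0 rn0 ltW.
have h1 : bracket_limit (F i) by apply: H; rewrite mem_head.
have h2 : bracket_limit (fun s => \sum_(j <- r) F j s).
  by apply: IH => j jr; apply: H; rewrite in_cons jr orbT.
move=> e e0; have [l lC h] := bracket_limitD h1 h2 e0.
by exists l => // s; rewrite big_cons; exact: h.
Qed.

(** Uniformity in [r] lets a single partition of unity serve all [t] in [bracket_limit_scaled]. *)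
Lemma translation_tube (f : G -> R) (t0 : G) (dl : R) : continuous f -> 0 < dl ->
  nbhs t0 [set t | forall r, `|f (t * r^-1)%g - f (t0 * r^-1)%g| < dl].
Proof.
move=> fc dl0; have /compact_near_coveringP cT := Gcompact.
apply: filterS (cT G (nbhs t0) (fun t r => `|f (t * r^-1)%g - f (t0 * r^-1)%g| < dl) _ _).
  by move=> t h r; exact: h.
move=> r0 _; have d2 : 0 < dl / 2 by rewrite divr_gt0.
have Fc : (fun z : G * G => f (z.2 * z.1^-1)%g) z @[z --> (r0, t0)] --> f (t0 * r0^-1)%g.
  apply: (@cvg_comp _ _ _ (fun z : G * G => (z.2 * z.1^-1)%g) f); last exact: fc.
  apply: (@cvg_comp _ _ _ (fun z : G * G => (z.2, z.1^-1%g)) (fun z : G * G => (z.1 * z.2)%g) _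
    (nbhs (t0, r0^-1%g))); last exact: (@mulg_continuous G (t0, r0^-1%g)).
  apply: cvg_pair => /=; first exact: cvg_snd.
  apply: (@cvg_comp _ _ _ (fun z : G * G => z.1) (fun z : G => z^-1%g) _ (nbhs r0)).
    exact: cvg_fst.
  exact: invg_continuous.
have /cvgrPdist_lt/(_ _ d2)[[U V] /= [Ur Vt] UV] := Fc.
exists (U, V) => // -[r t] [/= Ur' Vt'].
have h1 := UV (r, t) (conj Ur' Vt').
have h2 := UV (r, t0) (conj Ur' (nbhs_singleton Vt)); rewrite /= in h1 h2.
rewrite (le_lt_trans (ler_distD (f (t0 * r0^-1)%g) _ _))// [dl]splitr ltrD//.
by rewrite distrC.
Qed.

Lemma bracket_continuous (a b : A) : continuous (fun s => a ** alpha s b).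
Proof.
move=> s; apply: (@continuous_comp _ _ _ (fun s => alpha s b) (amul a)).
  exact: act_continuous.
exact: amul_continuousl.
Qed.

Lemma scaled_continuous (f : G -> R) (h : G -> A) : continuous f -> continuous h ->
  continuous (fun s => (f s)%:C%C *: h s).
Proof.
move=> fc hc s; apply: cvgZ; last exact: hc.
exact: (CG_real fc).
Qed.

(** The scalar function is created inside the outer factors. With [u_p = g_p] and
    [v_p(r) = f(p r^-1)], the sum of [X(u_p) a c alpha_t(X(v_p) b)] is asymptotically the lift of
    [x |-> sum_p g_p(x) f(p x^-1 t)] times [a c alpha_t(b)]. Where [g_p(x)] is nonzero,
    [f(p x^-1 t)] is close to [f(t)], so this function is nearly the constant [f(t)]. *)
Lemma bracket_limit_scaled (f : G -> R) (a c b : A) : continuous f -> C c ->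
  bracket_limit (fun s => (f s)%:C%C *: (a ** c ** alpha s b)).
Proof.
move=> fc Cc e e0.
have [D [X [HX Di Dl]]] := rokhlin_data Gcompact G2 Asu rok [:: a; c; b].
have Da : ssa_set D a by apply: Dl; rewrite !inE eqxx.
have Dc : ssa_set D c by apply: Dl; rewrite !inE eqxx !orbT.
have Db : ssa_set D b by apply: Dl; rewrite !inE eqxx !orbT.
pose K := rn a * rn c * rn b.
have K0 : 0 <= K by rewrite !mulr_ge0 ?rn_ge0.
have K1 : 0 < K + 1 by rewrite ltr_wpDl.
pose dl := e / 4 / (K + 1); have dl0 : 0 < dl by rewrite !divr_gt0.
have dlK : dl * K <= e / 4.
  by rewrite /dl mulrAC ler_pdivrMr// ler_pM2l ?divr_gt0// lerDl.
have [p|s [g [g1 g2 g3 g4]]] := @partition_of_unity R G Ghaus Gcompact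
  (fun p => [set t | forall r, `|f (t * r^-1)%g - f (p * r^-1)%g| < dl]).
  exact: translation_tube.
pose u p := real_fun (g p).
pose v p := real_fun (fun r => f (p * r^-1)%g).
have uc p : CG (u p) by exact: CG_real.
have vc p : CG (v p).
  apply: CG_real => r; apply: continuous_comp; last exact: fc.
  apply: (@continuous_comp _ _ _ (fun r : G => r^-1%g) (fun r => (p * r)%g)).
    exact: invg_continuous.
  exact: mulg_continuousl.
pose L n := [seq (X (u p) n ** a, c, X (v p) n ** b) | p <- s].
have LE n t : bracket_sum (L n) t = \sum_(p <- s) X (u p) n ** a ** c ** alpha t (X (v p) n ** b).
  by rewrite /bracket_sum big_map.
have Vc t p : CG (left_translation t (v p)) by exact: CG_left_translation.
pose Fs t := \sum_(p <- s) 1 *: (u p ** left_translation t (v p)).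
have FsE t x : rn (Fs t x - (f t)%:C%C) <= dl.
  have -> : Fs t x - (f t)%:C%C =
      \sum_(p <- s) (g p x)%:C%C *: ((f (p * (t^-1 * x)^-1)%g - f t)%:C%C : R[i]^o).
    have h : (f t)%:C%C = \sum_(p <- s) (g p x)%:C%C * (f t)%:C%C.
      by rewrite -mulr_suml (g_sumC g3 x) mul1r.
    rewrite /Fs fct_sumE h -sumrB; apply: eq_bigr => p _.
    by rewrite scale1r rmorphB scalerBr.
  rewrite (le_trans (rn_sum _ _ _))//.
  have -> : dl = \sum_(p <- s) g p x * dl by rewrite -mulr_suml g3 mul1r.
  apply: ler_sum => p _; rewrite rnZr (ger0_norm (g2 p x)).
  have [->|gp] := eqVneq (g p x) 0; first by rewrite !mul0r.
  rewrite ler_wpM2l//; have := g4 p x gp (t^-1 * x)%g.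
  have -> : (x * (t^-1 * x)^-1)%g = t by rewrite invgM mulVKg invgK.
  by rewrite distrC /rn normc_def /= expr0n addr0 sqrtr_sqr => /ltW.
have pointwise t : le_lim (fun n => bracket_sum (L n) t - (f t)%:C%C *: (a ** c ** alpha t b)) (e / 4).
  pose d := a ** c ** alpha t b.
  have Dac : ssa_set D (a ** c) by exact: ssaM.
  have Dtb : ssa_set D (alpha t b) by exact: Di.
  have Dd : ssa_set D d by exact: ssaM.
  have [Fc n1] := lift_lincomb HX s (fun=> 1) (fun p => CGM (uc p) (Vc t p)) Dd.
  have n2 : nul (fun n => \sum_(p <- s) (X (u p) n ** a ** c ** alpha t (X (v p) n ** b) -
     X (u p ** left_translation t (v p)) n ** d)).
    apply: nul_sum => p _.
    have b1 := rl_bnd HX (uc p).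
    have b2 := rl_bnd HX (Vc t p).
    have m1 := nulMl (bndM b1 (bnd_cst (a ** c))) (rl_act HX t (vc p) Dtb).
    have m2 := nulMl b1 (nulMr (bnd_cst (alpha t b)) (nulBC (rl_comm HX (Vc t p) Dac))).
    have m3 := nulBC (rl_mul HX (uc p) (Vc t p) Dd).
    apply: eq_nul (nulD (nulD m1 m2) m3) => n; rewrite alphaM /d.
    by rewrite !(amulBr, amulBl) !amulA; zmod.
  have n3 := lift_scaled_sum HX (- (f t)%:C%C) (@CG_cst R G 1) Fc Dd.
  rewrite -/(Fs t) in n1 n3.
  have n4 := nulZ (f t)%:C%C (rl_one HX Dd).
  pose w := - (f t)%:C%C *: cst 1 + Fs t : G -> R[i]^o.
  have wc : CG w := CGP (c := - (f t)%:C%C) (@CG_cst R G 1) Fc.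
  have h1 : le_lim (fun n => X w n ** d) (dl * rn d).
    apply: (lift_contractive HX) => // x.
    have -> : w x = Fs t x - (f t)%:C%C.
      by rewrite -[w x]/(- (f t)%:C%C * 1 + Fs t x) mulr1 addrC.
    exact: FsE.
  have n5 : nul (fun n => bracket_sum (L n) t - (f t)%:C%C *: d - X w n ** d).
    apply: eq_nul (nulD (nulD n2 (nulN n1)) (nulD n4 (nulN n3))) => n.
    rewrite LE sumrB -/w scalerBr scaleNr.
    have -> : \sum_(p <- s) 1 *: (X (u p ** left_translation t (v p)) n ** d) =
       \sum_(p <- s) X (u p ** left_translation t (v p)) n ** d.
      by apply: eq_bigr => p _; rewrite scale1r.
    zmod.
  apply: (le_lim_nul n5); apply: le_lim_le h1; apply: le_trans dlK.
  rewrite ler_wpM2l ?(ltW dl0)// /K /d; apply: rnM_le; first exact: rnM_le.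
  by rewrite rn_alpha.
(* The estimate at each [t0] becomes uniform: half of [e] covers the limit at [t0], one quarter the
   equicontinuity in [n] of the bracket sums, one quarter the continuity of the target. *)
have near_all : \forall n \near \oo, forall t,
    rn ((f t)%:C%C *: (a ** c ** alpha t b) - bracket_sum (L n) t) <= e.
  have e4 : 0 < e / 4 by rewrite divr_gt0.
  apply: compact_eventually => // t0.
  have bL p : exists M : R, 0 < M /\ forall n, rn (X (u p) n ** a ** c) <= M.
    have [M M0 MP] : bnd (fun n => X (u p) n ** a ** c).
      by apply: bndM; [apply: bndM; [exact: (rl_bnd HX)|exact: bnd_cst]|exact: bnd_cst].
    by exists (M + 1); split=> [|n]; rewrite ?ltr_wpDl// (le_trans (MP n))// lerDl.
  have [M MP] := choice bL.
  pose m : R := (size s).+1%:R; have m0 : 0 < m by [].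
  pose d1 p := e / 4 / m / M p.
  have d10 p : 0 < d1 p by rewrite !divr_gt0//; have [] := MP p.
  have nb1 : nbhs t0 [set t | forall p, p \in s ->
      forall n, rn (alpha t (X (v p) n ** b) - alpha t0 (X (v p) n ** b)) <= d1 p].
    apply: near_all_seq => p _; apply: equiM => //; [exact: (rl_bnd HX)|exact: bnd_cst| |exact: equi_cst].
    exact: (rl_equi HX).
  have nb2 := rn_near_point t0 (@scaled_continuous f _ fc (@bracket_continuous (a ** c) b)) e4.
  exists ([set t | forall p, p \in s ->
      forall n, rn (alpha t (X (v p) n ** b) - alpha t0 (X (v p) n ** b)) <= d1 p] `&`
    [set t | rn ((f t)%:C%C *: (a ** c ** alpha t b) - (f t0)%:C%C *: (a ** c ** alpha t0 b)) < e / 4]).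
    exact: filterI.
  apply: filterS (pointwise t0 _ e4) => n h t [/= t1 t2].
  have t3 : rn (bracket_sum (L n) t - bracket_sum (L n) t0) <= e / 4.
    rewrite !LE -sumrB.
    have h1 : forall p, p \in s -> rn (X (u p) n ** a ** c ** alpha t (X (v p) n ** b) -
        X (u p) n ** a ** c ** alpha t0 (X (v p) n ** b)) <= e / 4 / m.
      move=> p ps; rewrite -amulBr; have [M0 Mp] := MP p.
      have -> : e / 4 / m = M p * d1 p by rewrite /d1 [M p * _]mulrC divfK// gt_eqF.
      by apply: rnM_le => //; exact: t1.
    rewrite (le_trans (rn_sum_le_size h1))// mulrCA ler_piMr ?(ltW e4)//.
    by rewrite ler_pdivrMr// mul1r ler_nat.
  have := rn_tri ((f t0)%:C%C *: (a ** c ** alpha t0 b)) ((f t)%:C%C *: (a ** c ** alpha t b)) (bracket_sum (L n) t).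
  have := rn_tri (bracket_sum (L n) t0) ((f t0)%:C%C *: (a ** c ** alpha t0 b)) (bracket_sum (L n) t).
  rewrite -(rnBC (bracket_sum (L n) t0)) in h *; rewrite rnBC in t3; lra.
have [n hn] := filter_ex near_all.
exists (L n) => //.
by move=> _ /mapP[p _ ->].
Qed.

(** Near [p] the element [b] is close to [alpha t (alpha p^-1 b)], which has the form treated
    before; a partition of unity glues these local replacements, its functions being absorbed into
    [f]. *)
Lemma bracket_limit_constant (f : G -> R) (a c b : A) : continuous f -> C c ->
  bracket_limit (fun s => (f s)%:C%C *: (a ** c ** b)).
Proof.
move=> fc Cc; apply: bracket_limit_closed => e e0.
have [M fM] := continuous_bounded Gcompact fc.
have M0 : 0 <= M := le_trans (normr_ge0 _) (fM point).
pose K := M * rn (a ** c); have K0 : 0 <= K by rewrite mulr_ge0 ?rn_ge0.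
have K1 : 0 < K + 1 by rewrite ltr_wpDl.
pose dl := e / (K + 1); have dl0 : 0 < dl by rewrite divr_gt0.
have dlK : K * dl <= e.
  by rewrite /dl mulrCA ler_piMr ?(ltW e0)// ler_pdivrMr// mul1r lerDl.
have bc : continuous (fun t => alpha t^-1%g b).
  move=> t; apply: (@continuous_comp _ _ _ (fun t : G => t^-1%g) (fun t => alpha t b)).
    exact: invg_continuous.
  exact: act_continuous.
have [t0|s [g [g1 g2 g3 g4]]] := @partition_of_unity R G Ghaus Gcompact
  (fun p => [set t | rn (alpha t^-1%g b - alpha p^-1%g b) < dl]).
  exact: rn_near_point bc dl0.
exists (fun t => \sum_(p <- s) (g p t * f t)%:C%C *: (a ** c ** alpha t (alpha p^-1%g b))).
  apply: bracket_limit_sum => p _; apply: bracket_limit_scaled => // t.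
  by apply: continuousM; [exact: g1|exact: fc].
move=> t; have -> : (f t)%:C%C *: (a ** c ** b) - \sum_(p <- s) (g p t * f t)%:C%C *:
    (a ** c ** alpha t (alpha p^-1%g b)) =
    \sum_(p <- s) (g p t)%:C%C *:
      ((f t)%:C%C *: (a ** c ** alpha t (alpha t^-1%g b - alpha p^-1%g b))).
  have -> : (f t)%:C%C *: (a ** c ** b) = \sum_(p <- s) (g p t)%:C%C *: ((f t)%:C%C *: (a ** c ** b)).
    by rewrite -scaler_suml (g_sumC g3 t) scale1r.
  rewrite -sumrB; apply: eq_bigr => p _.
  by rewrite alphaB alphaK amulBr !scalerBr !scalerA rmorphM.
rewrite (le_trans (rn_sum _ _ _))//.
have -> : e = \sum_(p <- s) g p t * e by rewrite -mulr_suml g3 mul1r.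
apply: ler_sum => p _; rewrite rnZr (ger0_norm (g2 p t)).
have [->|gp] := eqVneq (g p t) 0; first by rewrite !mul0r.
rewrite ler_wpM2l//; apply: le_trans dlK; rewrite rnZr /K -mulrA.
apply: ler_pM => //; first exact: rn_ge0.
by apply: rnM_le => //; rewrite rn_alpha; apply: ltW; exact: g4.
Qed.

(** Near [p], [h] is close to its value [h p], hence to a sum of triples independent of [t]; the
    pieces are again glued by a partition of unity. *)
Lemma bracket_limit_generated (h : G -> A) : continuous h ->
  (forall s, generated_ideal C (h s)) -> bracket_limit h.
Proof.
move=> hc hC; apply: bracket_limit_closed => e e0.
have e2 : 0 < e / 2 by rewrite divr_gt0.
have [t0|s [g [g1 g2 g3 g4]]] := @partition_of_unity R G Ghaus Gcompact
  (fun p => [set t | rn (h t - h p) < e / 2]).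
  exact: rn_near_point hc e2.
have hl p : exists l, middle_in C l /\ rn (h p - triple_sum l) < e / 2.
  by have /generated_idealP/(_ _ e2)[l lC hl] := hC p; exists l.
have [l lP] := choice hl.
exists (fun t => \sum_(p <- s) \sum_(q <- l p) (g p t)%:C%C *: (q.1.1 ** q.1.2 ** q.2)).
  apply: bracket_limit_sum => p _; apply: bracket_limit_sum => q ql.
  by apply: bracket_limit_constant => //; exact: (lP p).1.
move=> t; have -> : h t - \sum_(p <- s) \sum_(q <- l p) (g p t)%:C%C *: (q.1.1 ** q.1.2 ** q.2) =
    \sum_(p <- s) (g p t)%:C%C *: (h t - triple_sum (l p)).
  have -> : h t = \sum_(p <- s) (g p t)%:C%C *: h t.
    by rewrite -scaler_suml (g_sumC g3 t) scale1r.
  rewrite -sumrB; apply: eq_bigr => p _; rewrite scalerBr -scaler_sumr.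
  by rewrite -scaler_suml (g_sumC g3 t) scale1r.
rewrite (le_trans (rn_sum _ _ _))//.
have -> : e = \sum_(p <- s) g p t * e by rewrite -mulr_suml g3 mul1r.
apply: ler_sum => p _; rewrite rnZr (ger0_norm (g2 p t)).
have [->|gp] := eqVneq (g p t) 0; first by rewrite !mul0r.
rewrite ler_wpM2l// (le_trans (rn_tri (h p) _ _))// [e]splitr.
by apply: lerD; apply: ltW; [exact: g4|exact: (lP p).2].
Qed.

End Saturation.

Section BoundedRepresentation.
Context {R : realType} {A B : cstarAlgType R} {G : topGroupType}.
Hypothesis Gcompact : compact [set: G].
Variables (alpha : cstar_action G A) (mu : probability (borel G) R) (iota : (G -> A) -> B).
Hypothesis rep : L1_rep mu alpha iota.
Implicit Types f h : G -> A.

Lemma CGA0 : CGA (0 : G -> A).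
Proof. by move=> s; exact: (@cvg_cst A). Qed.

Lemma CGAP (c : R[i]) f h : CGA f -> CGA h -> CGA (c *: f + h).
Proof.
move=> fc hc s; apply: cvgD; last exact: hc.
exact: (cvgZl_tmp (k := c) (fc s)).
Qed.

Lemma CGAD f h : CGA f -> CGA h -> CGA (f + h).
Proof. by move=> fc hc s; apply: cvgD; [exact: fc|exact: hc]. Qed.

Lemma CGA_sum (I : Type) (r : seq I) (F : I -> G -> A) :
  (forall i, CGA (F i)) -> CGA (\sum_(i <- r) F i).
Proof.
move=> Fc; elim/big_rec: _ => [|i h _ hc]; first exact: CGA0.
by apply: CGAD; first exact: Fc.
Qed.

Lemma iota0 : iota 0 = 0.
Proof.
have [lin _ _ _] := rep; have := lin (-1) 0 0 CGA0 CGA0.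
by rewrite scaler0 addr0 scaleN1r addNr.
Qed.

Lemma iotaZ (c : R[i]) f : CGA f -> iota (c *: f) = c *: iota f.
Proof.
have [lin _ _ _] := rep => fc; have := lin c f 0 fc CGA0.
by rewrite iota0 !addr0.
Qed.

Lemma iotaD f h : CGA f -> CGA h -> iota (f + h) = iota f + iota h.
Proof.
have [lin _ _ _] := rep => fc hc; have := lin 1 f h fc hc.
by rewrite !scale1r.
Qed.

Lemma iotaB f h : CGA f -> CGA h -> iota (f - h) = iota f - iota h.
Proof.
have [lin _ _ _] := rep => fc hc; have := lin (-1) h f hc fc.
by rewrite !scaleN1r addrC [in RHS]addrC.
Qed.

Lemma iota_sum (I : Type) (r : seq I) (F : I -> G -> A) : (forall i, CGA (F i)) ->
  iota (\sum_(i <- r) F i) = \sum_(i <- r) iota (F i).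
Proof.
move=> Fc; elim: r => [|i r IH]; first by rewrite !big_nil iota0.
by rewrite !big_cons iotaD ?IH//; exact: CGA_sum.
Qed.

(** The [L^1] norm is at most the supremum norm because [mu] has total mass 1. Uniform approximation
    of functions thus suffices in the crossed product. *)
Lemma rn_iota_le f (c : R) : CGA f -> (forall s, rn (f s) <= c) -> rn (iota f) <= c.
Proof.
have [_ _ _ bd] := rep => fc fle.
have nc : continuous (fun s => rn (f s)).
  apply: (@continuous_real_dominated R G A f (@rn R A) 1) => // x y.
  have h1 := rn_le_dist x y; have h2 := rn_le_dist y x; rewrite (rnBC y) in h2.
  by rewrite mul1r ler_norml; apply/andP; split; lra.
have := bd f fc; rewrite /L1norm /cintegral rnE lecE /= => /andP[_].
move=> h; apply: (le_trans h); rewrite -[leRHS](mint_cst mu).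
by apply: mint_le => // x; exact: cvg_cst.
Qed.

End BoundedRepresentation.

Section MeanOverGroup.
Context {R : realType} {A : cstarAlgType R} {G : topGroupType}.
Hypotheses (Ghaus : hausdorff_space G) (Gcompact : compact [set: G]).
Variables (alpha : cstar_action G A) (mu : probability (borel G) R).
Hypothesis haar : normalized_haar mu.
Implicit Types x y : A.

Definition orbit_mean y : A := vintegral mu (fun r => alpha r y).

Lemma orbit_meanP y : is_vintegral mu (fun r => alpha r y) (orbit_mean y).
Proof.
have [v Fv] := @vintegral_exists R G Ghaus Gcompact mu A _ (@act_continuous _ _ _ alpha y).
by rewrite /orbit_mean (vintegralE Fv).
Qed.

Lemma Re_Im_dist (u v : R[i]^o) :
  `|complex.Re (u : R[i]) - complex.Re (v : R[i])| <= rn (u - v) /\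
  `|complex.Im (u : R[i]) - complex.Im (v : R[i])| <= rn (u - v).
Proof.
case: u v => [a b] [c d]; rewrite /rn normc_def /= -!sqrtr_sqr.
by split; rewrite ler_wsqrtr// ?lerDr ?lerDl sqr_ge0.
Qed.

Lemma functional_parts_continuous (phi : {linear A -> R[i]^o}) (F : G -> A) :
  continuous phi -> continuous F ->
  continuous (fun r => complex.Re (phi (F r) : R[i])) /\
  continuous (fun r => complex.Im (phi (F r) : R[i])).
Proof.
move=> phic Fc; have [K K0 phiK] := linear_functional_bounded phic.
split.
  apply: (@continuous_real_dominated R G A F (fun v => complex.Re (phi v : R[i])) K) => // x y.
  by apply: le_trans (phiK (x - y)); rewrite raddfB; exact: (Re_Im_dist _ _).1.
apply: (@continuous_real_dominated R G A F (fun v => complex.Im (phi v : R[i])) K) => // x y.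
by apply: le_trans (phiK (x - y)); rewrite raddfB; exact: (Re_Im_dist _ _).2.
Qed.

Lemma orbit_mean_fixed y : fixed_points alpha (orbit_mean y).
Proof.
move=> g; have h1 : is_vintegral mu (fun r => alpha g (alpha r y)) (alpha g (orbit_mean y)).
  apply: vintegral_map; last exact: orbit_meanP; last exact: alpha_continuous.
  by move=> c u v; rewrite alphaD alphaZ.
rewrite -(vintegralE h1); apply: vintegralE => phi phic.
rewrite (orbit_meanP y phic) /cintegral.
have [rc ic] := functional_parts_continuous phic (@act_continuous _ _ _ alpha y).
have := mint_translate Gcompact g haar rc; have := mint_translate Gcompact g haar ic.
rewrite /mint => <- <-; congr Complex; congr Rintegral; apply/funext => r;
  by rewrite actM.
Qed.

Lemma orbit_mean_id y : fixed_points alpha y -> orbit_mean y = y.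
Proof.
move=> yfix; apply: vintegralE.
have -> : (fun r => alpha r y) = (fun=> y) by apply/funext => r; exact: yfix.
move=> phi phic; rewrite /cintegral.
have := @mint_cst R G mu (complex.Re (phi y : R[i])).
have := @mint_cst R G mu (complex.Im (phi y : R[i])).
by rewrite /mint => -> ->; case: (phi y).
Qed.

End MeanOverGroup.

Section Brackets.
Context {R : realType} {A B : cstarAlgType R} {G : topGroupType}.
Hypotheses (Ghaus : hausdorff_space G) (Gcompact : compact [set: G]).
Variables (alpha : cstar_action G A) (mu : probability (borel G) R) (iota : (G -> A) -> B).
Hypotheses (haar : normalized_haar mu) (rep : L1_rep mu alpha iota).
Implicit Types a b c d e x y : A.

Definition bracket a b : B := iota (fun s => a ** alpha s b).

Let bc a b : CGA (fun s => a ** alpha s b).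
Proof. exact: bracket_continuous. Qed.

Lemma bracketDl a a' b : bracket (a + a') b = bracket a b + bracket a' b.
Proof.
rewrite /bracket -(iotaD rep)//; congr iota; apply/funext => s.
by rewrite amulDl.
Qed.

Lemma bracketDr a b b' : bracket a (b + b') = bracket a b + bracket a b'.
Proof.
rewrite /bracket -(iotaD rep)//; congr iota; apply/funext => s.
by rewrite alphaD amulDr.
Qed.

Lemma bracketZl (t : R[i]) a b : bracket (t *: a) b = t *: bracket a b.
Proof.
rewrite /bracket -(iotaZ rep)//; congr iota; apply/funext => s.
by rewrite amulZl.
Qed.

Lemma bracketZr (t : R[i]) a b : bracket a (t *: b) = t *: bracket a b.
Proof.
rewrite /bracket -(iotaZ rep)//; congr iota; apply/funext => s.
by rewrite alphaZ amulZr.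
Qed.

Lemma bracketBl a a' b : bracket (a - a') b = bracket a b - bracket a' b.
Proof. by rewrite -scaleN1r bracketDl bracketZl scaleN1r. Qed.

Lemma bracketBr a b b' : bracket a (b - b') = bracket a b - bracket a b'.
Proof. by rewrite -scaleN1r bracketDr bracketZr scaleN1r. Qed.

Lemma bracket0l b : bracket 0 b = 0.
Proof. by rewrite -(scale0r 0) bracketZl scale0r. Qed.

Lemma rn_bracket a b : rn (bracket a b) <= rn a * rn b.
Proof.
apply: (rn_iota_le Gcompact rep) => // s.
by rewrite (le_trans (rnM _ _))// rn_alpha.
Qed.

(** In the convolution [alpha r] cancels the [r^-1] acting on [d]: the integrand is
    [a alpha_r(b c) alpha_s(d)] and its outer factors leave the integral. *)
Lemma bracketM a b c d :
  bracket a b ** bracket c d = bracket (a ** orbit_mean alpha mu (b ** c)) d.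
Proof.
have [_ iM _ _] := rep; rewrite /bracket -iM//; congr iota; apply/funext => s.
apply: vintegralE.
have -> : (fun r => a ** alpha r b ** alpha r (c ** alpha (r^-1 * s)%g d)) =
    (fun r => a ** alpha r (b ** c) ** alpha s d).
  by apply/funext => r; rewrite !alphaM -actM mulVKg !amulA.
apply: (@vintegral_map _ _ mu _ (fun z => a ** z ** alpha s d)); last exact: orbit_meanP.
  by move=> t u v; rewrite amulDr amulZr amulDl amulZl.
move=> z; apply: (@continuous_comp _ _ _ (amul a) (fun z => z ** alpha s d)).
  exact: amul_continuousl.
exact: amul_continuousr.
Qed.

Lemma bracket_star a b : star (bracket a b) = bracket (star b) (star a).
Proof.
have [_ _ iS _] := rep; rewrite /bracket -iS//; congr iota; apply/funext => s.
by rewrite /convolution_star starM alphaM -alphaS alphaK.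
Qed.

Lemma bracket_fixed a e b : fixed_points alpha e -> bracket a (e ** b) = bracket (a ** e) b.
Proof.
by move=> efix; rewrite /bracket; congr iota; apply/funext => s; rewrite alphaM efix amulA.
Qed.

Lemma iota_bracket_sum (l : seq (A * A * A)) :
  iota (bracket_sum alpha l) = \sum_(p <- l) bracket (p.1.1 ** p.1.2) p.2.
Proof.
rewrite -(iota_sum rep)//; congr iota; apply/funext => s.
by rewrite fct_sumE.
Qed.

Lemma bracket_sum_continuous (l : seq (A * A * A)) : CGA (bracket_sum alpha l).
Proof.
have -> : bracket_sum alpha l = \sum_(p <- l) (fun s => p.1.1 ** p.1.2 ** alpha s p.2).
  by apply/funext => s; rewrite fct_sumE.
exact: CGA_sum.
Qed.

Hypotheses (G2 : @second_countable G) (Asu : sigma_unital A) (rok : Rokhlin_property alpha).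
Hypothesis dense : closure [set iota f | f in @CGA R G A] = [set: B].

Definition bracket_pairs (l : seq (A * A)) : B := \sum_(p <- l) bracket p.1 p.2.

(** Saturation is used with [C] the set of all fixed elements. The fixed approximate unit puts every
    element of [A] into the ideal they generate, so every continuous function qualifies. *)
Lemma bracket_dense (z : B) (e : R) : 0 < e -> exists l, rn (z - bracket_pairs l) < e.
Proof.
move=> e0; have : closure [set iota f | f in @CGA R G A] z by rewrite dense.
have e2 : 0 < e / 2 by rewrite divr_gt0.
move=> /rn_closureP/(_ _ e2)[_ [f fc <-] zf].
have [c [c1 c2 c3 c4]] := fixed_unit Ghaus Gcompact G2 Asu rok.
have fC s : generated_ideal (fixed_points alpha) (f s).
  have cb : bnd c by exists 2.
  have h : nul (fun n => f s ** c n ** c n - f s).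
    apply: (@nul_trans _ _ (fun n => f s ** c n)); last exact: c4.
    by apply: eq_nul (nulMr cb (c4 (f s))) => n; rewrite amulBl.
  apply: (rn_closed (@generated_ideal_closed _ _ _)) => d d0.
  have [n hn] := filter_ex (h d d0).
  exists (f s ** c n ** c n); first exact: generated_ideal_triple.
  by rewrite rnBC.
have [l lC fl] := bracket_limit_generated Ghaus Gcompact G2 Asu rok fc fC e2.
exists [seq (p.1.1 ** p.1.2, p.2) | p <- l].
have -> : bracket_pairs [seq (p.1.1 ** p.1.2, p.2) | p <- l] = iota (bracket_sum alpha l).
  by rewrite iota_bracket_sum /bracket_pairs big_map.
rewrite (le_lt_trans (rn_tri (iota f) _ _))// [e]splitr ltr_leD//.
rewrite -(iotaB rep)//; last exact: bracket_sum_continuous.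
apply: (rn_iota_le Gcompact rep) => //.
by move=> s; apply: continuousB; [exact: fc|exact: bracket_sum_continuous].
Qed.

End Brackets.

Section ApproximateUnitInIdeal.
Context {R : realType} {B : cstarAlgType R}.
Implicit Types x y : B.

(** For [k = star x ** x] the square of [rn (x - x ** u)] is [rn ((1 - u) k (1 - u))], at most
    [rn (k - k ** u)]; hence [rho = e^2] in the regularization. *)
Lemma right_approximation x (e : R) : 0 < e -> exists u, [/\
  forall S, closed_subalg S -> S (star x ** x) -> S u, star u = u,
  rn (x - x ** u) <= e & forall b, rn (b - b ** u) <= rn b].
Proof.
move=> e0; pose k := star x ** x; have ks : star k = k by rewrite /k starM starK.
have rho0 : 0 < e ^+ 2 by rewrite exprn_gt0.
have [u [[us uk _ uS] ul ur ku]] := regularization rho0 ks.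
exists u; split => //.
rewrite -(ler_sqr _ _) ?nnegrE ?rn_ge0 ?(ltW e0)// -rnC.
have -> : star (x - x ** u) ** (x - x ** u) = (k - k ** u) - u ** (k - k ** u).
  by rewrite starB starM us !(amulBl, amulBr) /k !amulA; zmod.
by rewrite (le_trans (ul _))// (le_trans ku)// ler_pdivrMr// ler_peMr ?ler1n// ltW.
Qed.

(** [star x] is close to [star x ** u] with [u] in the closed algebra generated by [x ** star x],
    and that algebra is contained in [I]. *)
Lemma cstar_ideal_star (I : set B) x : cstar_ideal I -> I x -> I (star x).
Proof.
move=> [[_ I0] Ilin Iid Icl] Ix; apply: (rn_closed Icl) => e e0.
have e2 : 0 < e / 2 by rewrite divr_gt0.
have [u [uS us xu _]] := right_approximation (star x) e2.
exists (star x ** u); last by rewrite (le_lt_trans xu)// ltr_pdivrMr// ltr_pMr// ltr1n.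
apply: (Iid _ _ Logic.I _).1 => //; apply: uS.
  by split => // y z _ Iz; exact: (Iid _ _ Logic.I Iz).1.
by rewrite starK; exact: (Iid _ _ Logic.I Ix).2.
Qed.

(* Each [x] is the limit of products [v ** x ** u] with [u], [v] close to units
   of the algebras generated by [star x ** x] and [x ** star x]. *)
Lemma closed_span_factor (M I : set B) : closed M ->
  (forall u x v, I x -> M (u ** x ** v)) -> I `<=` M.
Proof.
move=> Mcl MI x Ix; apply: (rn_closed Mcl) => e e0.
have e4 : 0 < e / 4 by rewrite divr_gt0.
have [u [_ _ xu ub]] := right_approximation x e4.
have [v [_ vs xv _]] := right_approximation (star x) e4.
exists (v ** x ** u); first exact: MI.
have vx : rn (x - v ** x) <= e / 4.
  by rewrite -rn_star starB starM vs.
have -> : x - v ** x ** u = (x - x ** u) + ((x - v ** x) - ((x - v ** x) - (x - v ** x) ** u)).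
  by rewrite !amulBl; zmod.
have h1 := ub (x - v ** x).
have := rnD (x - x ** u) ((x - v ** x) - ((x - v ** x) - (x - v ** x) ** u)).
have := rnB (x - v ** x) ((x - v ** x) - (x - v ** x) ** u).
lra.
Qed.

End ApproximateUnitInIdeal.

(** * Ideals of the crossed product and their fixed generators *)

Section IdealsOfCrossedProduct.
Context {R : realType} {A B : cstarAlgType R} {G : topGroupType}.
Hypotheses (Ghaus : hausdorff_space G) (Gcompact : compact [set: G]).
Variables (alpha : cstar_action G A) (mu : probability (borel G) R) (iota : (G -> A) -> B).
Hypotheses (haar : normalized_haar mu) (rep : L1_rep mu alpha iota).
Hypotheses (G2 : @second_countable G) (Asu : sigma_unital A) (rok : Rokhlin_property alpha).
Hypothesis dense : closure [set iota f | f in @CGA R G A] = [set: B].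
Variable I : set B.
Hypothesis Iideal : cstar_ideal I.
Implicit Types (a b c d e h x y : A) (t s : R).

Local Notation bracket := (bracket alpha iota).
Local Notation fixed := (fixed_points alpha).

Let I0 : I 0. Proof. by have [[]] := Iideal. Qed.
Let IZ (c : R[i]) z : I z -> I (c *: z).
Proof. by have [_ Ilin _ _] := Iideal => Iz; rewrite -[_ *: _]addr0; exact: Ilin. Qed.
Let ID z w : I z -> I w -> I (z + w).
Proof. by have [_ Ilin _ _] := Iideal => Iz Iw; rewrite -[z]scale1r; exact: Ilin. Qed.
Let IN z : I z -> I (- z).
Proof. by rewrite -scaleN1r; exact: IZ. Qed.
Let IMl z w : I w -> I (z ** w).
Proof. by have [_ _ Iid _] := Iideal => Iw; have [] := Iid z w Logic.I Iw. Qed.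
Let IMr z w : I z -> I (z ** w).
Proof. by have [_ _ Iid _] := Iideal => Iz; have [] := Iid w z Logic.I Iz. Qed.

(** The quotient norm of [z] modulo [I] is at most [t], expressed inside [B]. *)
Definition near_ideal (z : B) (t : R) := forall eta : R, 0 < eta ->
  exists2 i, I i & rn (z - i) <= t + eta.

Lemma near_idealD z w t s : near_ideal z t -> near_ideal w s -> near_ideal (z + w) (t + s).
Proof.
move=> zt ws e e0; have e2 : 0 < e / 2 by rewrite divr_gt0.
have [i Ii zi] := zt _ e2; have [j Ij wj] := ws _ e2.
exists (i + j); first exact: ID.
by rewrite opprD addrACA (le_trans (rnD _ _))//; lra.
Qed.

Lemma near_ideal_perturb z w t s : near_ideal z t -> rn (w - z) <= s -> near_ideal w (t + s).
Proof.
move=> zt wz e e0; have [i Ii zi] := zt _ e0; exists i => //.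
by have := rn_tri z w i; lra.
Qed.

Lemma near_idealM z w t s : 0 <= t -> 0 <= s ->
  near_ideal z t -> near_ideal w s -> near_ideal (z ** w) (t * s).
Proof.
move=> t0 s0 zt ws e e0; pose d := Num.min 1 (e / (t + s + 1)).
have k0 : 0 < t + s + 1 by rewrite ltr_wpDl// addr_ge0.
have d0 : 0 < d by rewrite lt_min ltr01 divr_gt0.
have d1 : d <= 1 by rewrite ge_min lexx.
have de : d * (t + s + 1) <= e by rewrite -ler_pdivlMr// ge_min lexx orbT.
have [i Ii zi] := zt _ d0; have [j Ij wj] := ws _ d0.
exists (i ** w + z ** j - i ** j); first by apply: ID; [apply: ID; [exact: IMr|exact: IMl]|apply/IN/IMr].
have -> : z ** w - (i ** w + z ** j - i ** j) = (z - i) ** (w - j).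
  by rewrite !(amulBl, amulBr); zmod.
apply: (le_trans (rnM_le zi wj)); nra.
Qed.

Lemma near_ideal_in z : (forall t, 0 < t -> near_ideal z t) -> I z.
Proof.
move=> h; have [_ _ _ Icl] := Iideal; apply: (rn_closed Icl) => e e0.
have e4 : 0 < e / 4 by rewrite divr_gt0.
have [i Ii zi] := h _ e4 _ e4; exists i => //; lra.
Qed.

(** [t] bounds the bilinear map [(x, y) |-> [x e, y]] into the quotient by [I]. Unlike membership in
    [I], this condition is stable under perturbation of [e]. *)
Definition small e t := forall x y, near_ideal (bracket (x ** e) y) (t * (rn x * rn y)).

Lemma small_perturb e e' t : small e t -> small e' (t + rn (e' - e)).
Proof.
move=> et x y; rewrite mulrDl; apply: near_ideal_perturb (et x y) _.
rewrite -(bracketBl rep) -amulBr (le_trans (rn_bracket Gcompact rep _ _))//.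
by rewrite mulrA ler_wpM2r ?rn_ge0// mulrC rnM.
Qed.

Lemma smallW e t s : t <= s -> small e t -> small e s.
Proof.
move=> ts et x y d d0; have [i Ii h] := et x y d d0; exists i => //.
by rewrite (le_trans h)// lerD2r ler_wpM2r// mulr_ge0 ?rn_ge0.
Qed.

Lemma smallD e e' t s : small e t -> small e' s -> small (e + e') (t + s).
Proof.
move=> et es x y; rewrite amulDr (bracketDl rep) mulrDl; exact: near_idealD.
Qed.

Lemma smallZ (c : R[i]) e t : small e t -> small (c *: e) (complex.Re `|c| * t).
Proof.
move=> et x y; have -> : bracket (x ** (c *: e)) y = bracket ((c *: x) ** e) y.
  by rewrite amulZr amulZl.
have -> : complex.Re `|c| * t * (rn x * rn y) = t * (rn (c *: x) * rn y); last exact: et.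
by rewrite rnZ; ring.
Qed.

Lemma small_star e t : fixed e -> small e t -> small (star e) t.
Proof.
move=> efix et x y d d0; have [i Ii h] := et (star y) (star x) d d0.
exists (star i); first exact: cstar_ideal_star.
have esfix : fixed (star e) by move=> g; rewrite alphaS efix.
rewrite -rn_star starB starK (bracket_star rep) starM starK.
by rewrite (bracket_fixed iota _ _ efix) [rn x * _]mulrC -(rn_star x) -(rn_star y).
Qed.

(** For a fixed approximate unit [c], [[x e, c_n] [c_n e', y] = [x e c_n c_n e', y]] tends to
    [[x e e', y]]: fixed elements are their own mean. The factor 4 bounds the square of
    [rn (c n)]. *)
Lemma smallM e e' t s : fixed e -> fixed e' -> 0 <= t -> 0 <= s -> small e t -> small e' s ->
  small (e ** e') (4 * (t * s)).
Proof.
move=> efix efix' t0 s0 et es x y d d0.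
have [c [c1 c2 c3 c4]] := fixed_unit Ghaus Gcompact G2 Asu rok.
have cb : bnd c by exists 2.
have h : nul (fun n => c n ** (c n ** e') - e').
  apply: (@nul_trans _ _ (fun n => c n ** e')); last exact: c3.
  by apply: eq_nul (nulMl cb (c3 e')) => n; rewrite amulBr.
pose K := rn x * rn e * rn y; have K0 : 0 <= K by rewrite !mulr_ge0 ?rn_ge0.
have K1 : 0 < K + 1 by rewrite ltr_wpDl.
have d2 : 0 < d / 2 / (K + 1) by rewrite !divr_gt0.
have [n hn] := filter_ex (h _ d2).
have fix2 : fixed (c n ** (c n ** e')) by move=> g; rewrite !alphaM c1 efix'.
have := near_idealM _ _ (et x (c n)) (es (c n) y).
rewrite (bracketM Ghaus Gcompact rep) (orbit_mean_id mu fix2).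
have x0 := rn_ge0 x; have y0 := rn_ge0 y; have z0 := rn_ge0 (c n); have z2 := c2 n.
move=> nr; have d3 : 0 < d / 2 by rewrite divr_gt0.
have [||i Ii hi] := nr _ _ _ d3; rewrite ?mulr_ge0//.
exists i => //; rewrite (le_trans (rn_tri (bracket (x ** e ** (c n ** (c n ** e'))) y) _ _))//.
have h1 : rn (bracket (x ** (e ** e')) y - bracket (x ** e ** (c n ** (c n ** e'))) y) <= d / 2.
  rewrite amulA -(bracketBl rep) -amulBr (le_trans (rn_bracket Gcompact rep _ _))//.
  have h2 := ltW hn; rewrite rnBC ler_pdivlMr// in h2.
  have h3 := rnM_le (rnM x e) (lexx (rn (e' - c n ** (c n ** e')))).
  have h4 := rn_ge0 (e' - c n ** (c n ** e')).
  apply: (le_trans (ler_wpM2r y0 h3)); apply: le_trans h2.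
  by rewrite mulrDr mulr1 mulrAC mulrC lerDl.
have h5 : rn (c n) * rn (c n) <= 4 by nra.
have h6 : t * (rn x * rn (c n)) * (s * (rn (c n) * rn y)) <= 4 * (t * s) * (rn x * rn y).
  rewrite (_ : _ * _ = rn (c n) * rn (c n) * (t * s * (rn x * rn y))); last by ring.
  by rewrite -[4 * _ * _]mulrA ler_wpM2r// !mulr_ge0.
lra.
Qed.

Lemma fixed_closed : closed fixed.
Proof.
have -> : fixed = \bigcap_(g in [set: G]) [set z | alpha g z = id z].
    by apply/seteqP; split=> z h' g; [move=> _|]; exact: h'.
apply: closed_bigI => g _; apply: closed_eq; first exact: alpha_continuous.
by move=> z; exact: cvg_id.
Qed.

(* Regularizing a selfadjoint fixed [h] turns [h] into [h ** u], where
   [(8t)^2 h u = h^3 - h^3 u]: the cube makes the distance to the ideal drop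
   while [h] moves by at most [4t]. *)
Lemma small_improve h t : 0 < t -> star h = h -> fixed h -> small h t ->
  exists h', [/\ star h' = h', fixed h', small h' (t / 4) & rn (h' - h) <= 4 * t].
Proof.
move=> t0 hs hfix ht; have rho0 : 0 < 8 * t by rewrite mulr_gt0.
have [u [[us uh ue uS] ul _ hu]] := regularization rho0 hs.
have ufix : fixed u.
  apply: uS => //; split.
  - exact: fixed_closed.
  - by move=> g; rewrite alpha0.
  - by move=> c z w zf wf g; rewrite alphaD alphaZ zf wf.
  - by move=> z w zf wf g; rewrite alphaM zf wf.
exists (h ** u); split.
- by rewrite starM us hs.
- by move=> g; rewrite alphaM hfix ufix.
(* 16 comes from applying [smallM] twice, and [16 t^3 / (8 t)^2 = t / 4] is the smallness
   announced. *)
- have h3 : small (h ** (h ** h)) (16 * t ^+ 3).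
    have t2 : 0 <= 4 * (t * t) by rewrite !mulr_ge0// ltW.
    have h2fix : fixed (h ** h) by move=> g; rewrite alphaM !hfix.
    have h2 := smallM hfix hfix (ltW t0) (ltW t0) ht ht.
    by apply: smallW (smallM hfix h2fix (ltW t0) t2 ht h2); nra.
  (* Since [u] is fixed, [1 - u] passes to the second entry of the bracket, where it does not
     increase the norm. *)
  have h4 : small (h ** (h ** h) - h ** (h ** h) ** u) (16 * t ^+ 3).
    move=> x y; rewrite amulBr (amulA x _ u) (bracketBl rep) -(bracket_fixed iota _ _ ufix).
    rewrite -(bracketBr rep) => d d0; have [i Ii hi] := h3 x (y - u ** y) d d0.
    exists i => //; apply: (le_trans hi); rewrite lerD2r ler_wpM2l//.
      by rewrite mulr_ge0// exprn_ge0// ltW.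
    by rewrite ler_wpM2l ?rn_ge0.
  have -> : h ** u = ((8 * t) ^- 2)%:C%C *: (h ** (h ** h) - h ** (h ** h) ** u).
    rewrite -!amulA -amulBr -ue amulZr scalerA -rmorphM mulVf ?scale1r//.
    by rewrite gt_eqF// exprn_gt0.
  apply: smallW (smallZ _ h4); rewrite normc_def /= expr0n addr0 sqrtr_sqr.
  rewrite ger0_norm ?invr_ge0 ?exprn_ge0 ?(ltW rho0)//.
  by rewrite le_eqVlt; apply/orP; left; apply/eqP; field; rewrite gt_eqF.
- by rewrite rnBC (le_trans hu)//; lra.
Qed.

(** As [I] is closed, smallness for all positive [t] means that every bracket [[x c, y]] belongs to
    [I]. *)
Definition ideal_part : set A := [set c | fixed c /\ forall t, 0 < t -> small c t].

(** Repeated improvement with [d n = t / 4^n]: step [n] moves by at most [4 * d n], below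
    [6 * d n - 6 * d n.+1]. The limit is within [6 * d n] of the [n]-th term, so it is small for
    every tolerance. *)
Lemma selfadjoint_small_approx h t : 0 < t -> star h = h -> fixed h -> small h t ->
  exists2 c, ideal_part c & rn (c - h) <= 6 * t.
Proof.
move=> t0 hs hfix ht; pose P (p : A * R) h' := 0 < p.2 -> star p.1 = p.1 -> fixed p.1 ->
  small p.1 p.2 -> [/\ star h' = h', fixed h', small h' (p.2 / 4) & rn (h' - p.1) <= 4 * p.2].
have Pex p : exists h', P p h'.
  have [[p0 ps pfix pt]|np] := pselect [/\ 0 < p.2, star p.1 = p.1, fixed p.1 & small p.1 p.2].
    by have [h' h'P] := small_improve p0 ps pfix pt; exists h'.
  by exists 0 => p0 ps pfix pt; case: np.
have [F FP] := choice Pex.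
pose d n : R := t / 4 ^+ n; have d0 n : 0 < d n by rewrite divr_gt0// exprn_gt0.
have dS n : d n.+1 = d n / 4 by rewrite /d exprSr invfM mulrA.
pose H := fix H n := if n is m.+1 then F (H m, d m) else h.
have HP n : [/\ star (H n) = H n, fixed (H n) & small (H n) (d n)].
  elim: n => [|n [h1 h2 h3]]; first by rewrite /d expr0 divr1.
  by have [] := FP (H n, d n) (d0 n) h1 h2 h3; rewrite /= -dS.
have Hstep n : rn (H n.+1 - H n) <= 4 * d n.
  by have [h1 h2 h3] := HP n; have [] := FP (H n, d n) (d0 n) h1 h2 h3.
have [||c [Hc cH]] := @telescoping_cvg R A H (fun n => - (6 * d n)) 0.
- by move=> n; rewrite (le_trans (Hstep n))// dS; have := d0 n; lra.
- by move=> n; rewrite oppr_le0 mulr_ge0// ltW.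
exists c; last by have := cH 0%N; rewrite /d expr0 divr1 sub0r opprK.
split.
  apply: (closed_cvg _ fixed_closed _ _ Hc).
  by apply: nearW => n; have [] := HP n.
move=> s s0; have [n dn] : exists n, 7 * d n <= s.
  have c0 : (fun n => 7 * t * (4^-1 : R) ^+ n) @ \oo --> 7 * t * 0.
    apply: cvgM; first exact: cvg_cst.
    by apply: cvg_expr; rewrite ger0_norm// invf_lt1// ltr1n.
  rewrite mulr0 in c0; have /cvgr0Pnorm_le/(_ s s0)[N _ NP] := c0.
  exists N; have := NP N (leqnn _); apply: le_trans.
  by rewrite /d mulrA exprVn ler_norm.
have [_ _ h3] := HP n; apply: smallW (small_perturb c h3).
by have := cH n; rewrite sub0r opprK; lra.
Qed.

Lemma ideal_partD c d : ideal_part c -> ideal_part d -> ideal_part (c + d).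
Proof.
move=> [cfix cs] [dfix ds]; split=> [g|t t0]; first by rewrite alphaD cfix dfix.
have t2 : 0 < t / 2 by rewrite divr_gt0.
by apply: smallW (smallD (cs _ t2) (ds _ t2)); rewrite -splitr.
Qed.

Lemma ideal_partZi c : ideal_part c -> ideal_part ('i%C *: c).
Proof.
move=> [cfix cs]; split=> [g|t t0]; first by rewrite alphaZ cfix.
apply: smallW (smallZ _ (cs t t0)).
by rewrite normc_def /= expr0n expr1n add0r sqrtr1 mul1r.
Qed.

(** Real and imaginary parts are treated separately; each contributes [6 * t]. *)
Lemma small_approx e t : 0 < t -> fixed e -> small e t ->
  exists2 c, ideal_part c & rn (c - e) <= 12 * t.
Proof.
move=> t0 efix et; have sfix : fixed (star e) by move=> g; rewrite alphaS efix.
have hn : complex.Re `|half : R[i]| = 2^-1.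
  by rewrite /half normc_def /= expr0n addr0 sqrtr_sqr ger0_norm ?invr_ge0.
have ic : (- 'i%C : R[i])^* = 'i%C by apply/eqP; rewrite eq_complex /= ?oppr0 ?opprK !eqxx.
have ii (z : A) : 'i%C *: (- 'i%C *: z) = z.
  by rewrite scalerA mulrN -expr2 sqr_i opprK scale1r.
have [c1 c1I ce1] : exists2 c, ideal_part c & rn (c - half *: (e + star e)) <= 6 * t.
  apply: selfadjoint_small_approx => //.
  - by rewrite starZr starD starK addrC.
  - by move=> g; rewrite alphaZ alphaD efix sfix.
  - apply: smallW (smallZ half (smallD et (small_star efix et))).
    by rewrite hn; lra.
have small_diff : small (- 'i%C *: (e - star e)) (t + t).
  have h1 : small (- star e) t.
    rewrite -scaleN1r; apply: smallW (smallZ _ (small_star efix et)).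
    by rewrite normrN normr1 mul1r.
  apply: smallW (smallZ _ (smallD et h1)).
  by rewrite normrN normc_def /= expr0n expr1n add0r sqrtr1 mul1r.
have [c2 c2I ce2] : exists2 c, ideal_part c & rn (c - half *: (- 'i%C *: (e - star e))) <= 6 * t.
  apply: selfadjoint_small_approx => //.
  - by rewrite starZr starZ starB starK ic scaleNr -scalerN opprB.
  - by move=> g; rewrite !alphaZ alphaB efix sfix.
  - by apply: smallW (smallZ half small_diff); rewrite hn; lra.
exists (c1 + 'i%C *: c2); first by apply: ideal_partD => //; exact: ideal_partZi.
have -> : c1 + 'i%C *: c2 - e = (c1 - half *: (e + star e)) +
    'i%C *: (c2 - half *: (- 'i%C *: (e - star e))).
  rewrite scalerBr scalerA mulrC -scalerA ii -{1}(halfD e) scalerDr scalerBr; zmod.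
by rewrite (le_trans (rnD _ _))// rnZi; lra.
Qed.

Lemma near_ideal_bracket a e b c t : fixed e -> ideal_part c -> rn (c - e) <= t ->
  rn (bracket (a ** c) b - bracket (a ** e) b) <= rn a * t * rn b.
Proof.
move=> efix cI ce; rewrite -(bracketBl rep) -amulBr.
rewrite (le_trans (rn_bracket Gcompact rep _ _))// ler_wpM2r ?rn_ge0//.
exact: rnM_le.
Qed.

Local Notation J := (generated_ideal ideal_part).
Local Notation M := (crossed_ideal iota J).

Lemma crossed_ideal_closed : closed M.
Proof. exact: closed_closure. Qed.

Lemma crossed_ideal_lin (t : R[i]) z w : M z -> M w -> M (t *: z + w).
Proof.
move=> /rn_closureP Mz /rn_closureP Mw; apply/rn_closureP => e e0.
have t0 : 0 <= complex.Re `|t| by have := normr_ge0 t; rewrite lecE => /andP[].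
have t1 : 0 < complex.Re `|t| + 1 by rewrite ltr_wpDl.
have e2 : 0 < e / 2 by rewrite divr_gt0.
have [_ [f [fc fJ] <-] zf] := Mz _ (divr_gt0 e2 t1).
have [_ [h [hc hJ] <-] wh] := Mw _ e2.
exists (iota (t *: f + h)).
  exists (t *: f + h) => //; split; first exact: CGAP.
  by move=> s; apply: generated_idealD; [exact: generated_idealZ|].
have [lin _ _ _] := rep; rewrite lin// opprD addrACA -scalerBr.
rewrite (le_lt_trans (rnD _ _))// [e]splitr ltr_leD//; last exact: ltW.
rewrite rnZ; move: zf; rewrite ltr_pdivlMr//; apply: le_lt_trans.
by rewrite mulrC ler_wpM2l ?rn_ge0// lerDl.
Qed.

Lemma crossed_ideal_bracket a c b : ideal_part c -> M (bracket (a ** c) b).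
Proof.
move=> cI; apply: subset_closure; exists (fun g : G => a ** c ** alpha g b) => //.
by split; [exact: bracket_continuous|move=> g; exact: generated_ideal_triple].
Qed.

(** The element [m] does not depend on the outer entries [a] and [b']. Letting these vary while [b],
    [z], [a'] stay the same shows that all brackets [[x m, y]] are close to elements of [I], so [m]
    is close to the ideal part. *)
Lemma bracket_ideal_bracket a b z a' b' : I z -> M (bracket a b ** z ** bracket a' b').
Proof.
move=> Iz; apply: (rn_closed crossed_ideal_closed) => e e0.
(* The first summand pays for replacing [z] by a sum of brackets, the second for replacing [m] by
   [c] through [small_approx]. *)
pose K := rn a * rn b * rn a' * rn b' + 12 * (rn a * (rn b * rn a' + 1) * rn b').
have [a0 b0 a0' b0'] : [/\ 0 <= rn a, 0 <= rn b, 0 <= rn a' & 0 <= rn b'].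
  by split; exact: rn_ge0.
have K0 : 0 <= K by rewrite addr_ge0// !mulr_ge0// addr_ge0// mulr_ge0.
have K1 : 0 < K + 1 by rewrite ltr_wpDl.
pose d := e / (K + 1); have d0 : 0 < d by rewrite divr_gt0.
have [l zl] := bracket_dense Ghaus Gcompact rep G2 Asu rok dense z d0.
pose E := orbit_mean alpha mu.
pose m := \sum_(p <- l) E (b ** p.1) ** E (p.2 ** a').
have mfix : fixed m.
  move=> g; rewrite alpha_sum; apply: eq_bigr => p _.
  by rewrite alphaM !(orbit_mean_fixed Ghaus Gcompact alpha haar).
have mE x y : bracket x b ** bracket_pairs alpha iota l ** bracket a' y = bracket (x ** m) y.
  rewrite /bracket_pairs amul_sumr.
  rewrite amul_suml.
  rewrite /m amul_sumr.
  have bD u v : bracket (u + v) y = bracket u y + bracket v y := bracketDl rep u v y.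
  rewrite (big_morph (fun u => bracket u y) bD (bracket0l rep y)); apply: eq_bigr => p _.
  by rewrite !(bracketM Ghaus Gcompact rep) amulA.
have dist x y : rn (bracket x b ** z ** bracket a' y - bracket (x ** m) y) <=
    rn x * rn b * d * (rn a' * rn y).
  rewrite -mE -amulBl -amulBr; apply: rnM_le; last exact: (rn_bracket Gcompact rep).
  by apply: rnM_le; [exact: (rn_bracket Gcompact rep)|exact: ltW].
(* The added 1 keeps the tolerance positive when [b] or [a'] is 0, as [small_approx] demands. *)
have small_m : small m (d * (rn b * rn a' + 1)).
  move=> x y t t0; exists (bracket x b ** z ** bracket a' y); first exact/IMr/IMl.
  rewrite rnBC (le_trans (dist x y))//.
  have xy : 0 <= d * (rn x * rn y) := mulr_ge0 (ltW d0) (mulr_ge0 (rn_ge0 x) (rn_ge0 y)).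
  lra.
have h0 : 0 < d * (rn b * rn a' + 1) by rewrite mulr_gt0// ltr_wpDl// mulr_ge0.
have [c cI cm] := small_approx h0 mfix small_m.
exists (bracket (a ** c) b'); first exact: crossed_ideal_bracket.
rewrite (le_lt_trans (rn_tri (bracket (a ** m) b') _ _))//.
have h1 := near_ideal_bracket a b' mfix cI cm; rewrite rnBC in h1.
have h2 : d * K < e.
  by rewrite /d mulrAC ltr_pdivrMr// ltr_pM2l// ltrDl.
apply: le_lt_trans h2; apply: le_trans (lerD (dist a b') h1) _.
by rewrite le_eqVlt; apply/orP; left; apply/eqP; rewrite /K; ring.
Qed.

Local Notation pairs := (bracket_pairs alpha iota).

Lemma dense_factorl (S : set B) w : closed S -> (forall l, S (pairs l ** w)) ->
  forall u, S (u ** w).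
Proof.
move=> Scl Sl u; apply: (rn_closed Scl) => e e0.
have w1 : 0 < rn w + 1 by rewrite ltr_wpDl// rn_ge0.
have [l ul] := bracket_dense Ghaus Gcompact rep G2 Asu rok dense u (divr_gt0 e0 w1).
exists (pairs l ** w) => //; rewrite -amulBl (le_lt_trans (rnM _ _))//.
by move: ul; rewrite ltr_pdivlMr//; apply: le_lt_trans; rewrite ler_wpM2l ?rn_ge0// lerDl.
Qed.

Lemma dense_factorr (S : set B) w : closed S -> (forall l, S (w ** pairs l)) ->
  forall u, S (w ** u).
Proof.
move=> Scl Sl u; apply: (rn_closed Scl) => e e0.
have w1 : 0 < rn w + 1 by rewrite ltr_wpDl// rn_ge0.
have [l ul] := bracket_dense Ghaus Gcompact rep G2 Asu rok dense u (divr_gt0 e0 w1).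
exists (w ** pairs l) => //; rewrite -amulBr (le_lt_trans (rnM _ _))// mulrC.
by move: ul; rewrite ltr_pdivlMr//; apply: le_lt_trans; rewrite ler_wpM2l ?rn_ge0// lerDl.
Qed.

Lemma crossed_ideal_sum (T : Type) (r : seq T) (F : T -> B) :
  (forall i, M (F i)) -> M (\sum_(i <- r) F i).
Proof.
move=> MF; elim/big_rec: _ => [|i z _ Mz].
  apply: subset_closure; exists 0; last exact: (iota0 rep).
  by split; [exact: CGA0|move=> g; exact: generated_ideal0].
by rewrite -[F i]scale1r; exact: crossed_ideal_lin.
Qed.

(** Each [z] in [I] is a limit of products [v ** z ** u], whose outer factors are approximated by
    sums of brackets. *)
Lemma sub_crossed_ideal : I `<=` M.
Proof.
apply: closed_span_factor; first exact: crossed_ideal_closed.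
move=> u z v Iz; apply: (dense_factorr crossed_ideal_closed) => l'.
rewrite -amulA; apply: (dense_factorl crossed_ideal_closed) => l.
rewrite /bracket_pairs amul_suml.
apply: crossed_ideal_sum => p.
rewrite amulA amul_sumr.
by apply: crossed_ideal_sum => q; exact: bracket_ideal_bracket.
Qed.

(** Saturation, now with [C] the ideal part, approximates a continuous function with values in the
    generated ideal by bracket sums whose images lie in [I]. *)
Lemma crossed_ideal_sub : M `<=` I.
Proof.
have [_ _ _ Icl] := Iideal; move=> z /rn_closureP Mz; apply: (rn_closed Icl) => e e0.
have e2 : 0 < e / 2 by rewrite divr_gt0.
have [_ [f [fc fJ] <-] zf] := Mz _ e2.
have [l lC fl] := bracket_limit_generated Ghaus Gcompact G2 Asu rok fc fJ e2.
exists (iota (bracket_sum alpha l)).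
  rewrite (iota_bracket_sum rep) big_seq; elim/big_rec: _ => [//|p w pl Iw].
  apply: ID => //; apply: near_ideal_in => t t0.
  have [_ sm] := lC p pl; pose k := rn p.1.1 * rn p.2.
  have k0 : 0 <= k by rewrite mulr_ge0 ?rn_ge0.
  have k1 : 0 < k + 1 by rewrite ltr_wpDl.
  move=> d d0; have [i Ii h] := sm _ (divr_gt0 t0 k1) p.1.1 p.2 d d0.
  exists i => //; apply: (le_trans h); rewrite lerD2r -/k mulrAC ler_pdivrMr//.
  by rewrite ler_wpM2l ?(ltW t0)// lerDl.
rewrite (le_lt_trans (rn_tri (iota f) _ _))// [e]splitr ltr_leD//.
have sc : CGA (bracket_sum alpha l) by exact: bracket_sum_continuous.
rewrite -(iotaB rep)//; apply: (rn_iota_le Gcompact rep) => //.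
by move=> g; apply: continuousB; [exact: fc|exact: sc].
Qed.

Lemma ideal_of_crossed_product :
  exists J, [/\ cstar_ideal J, invariant_set alpha J & I = crossed_ideal iota J].
Proof.
exists J; split; first exact: generated_ideal_cstar.
  by apply: generated_ideal_invariant => c [].
apply/seteqP; split; [exact: sub_crossed_ideal|exact: crossed_ideal_sub].
Qed.

End IdealsOfCrossedProduct.

Theorem theorem2p13 (R : realType) (A : cstarAlgType R) (G : topGroupType)
    (alpha : cstar_action G A) :
  sigma_unital A -> second_countable_compact G -> Rokhlin_property alpha ->
  (forall I : set A, cstar_ideal_of (fixed_points alpha) I ->
     exists J : set A,
       [/\ cstar_ideal J, invariant_set alpha J & I = J `&` fixed_points alpha])
  /\
  (forall (mu : probability (borel G) R) (B : cstarAlgType R)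
      (iota : (G -> A) -> B),
     normalized_haar mu -> is_crossed_product mu alpha iota ->
     forall I : set B, cstar_ideal I ->
     exists J : set A,
       [/\ cstar_ideal J, invariant_set alpha J & I = crossed_ideal iota J]).
Proof.
move=> Asu [Ghaus Gcompact G2] rok; split=> [I|mu B iota haar [rep dense _] I].
  exact: ideal_of_fixed_points.
exact: (ideal_of_crossed_product Ghaus Gcompact haar rep G2 Asu rok dense).
Qed.
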